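(* Let $D_1, D_2$ be 2-symmetric algebras and let $\pi_1,\pi_2$ be generic ordered inclusions of $D_1\oplus D_2$ in $D$. Then there is a star isomorphism $\alpha : D\to D$ with $\alpha(\pi_1(D_i))=\pi_2(D_i)$ for $i=1,2$ if and only if there is a group isomorphism $$\gamma_0\oplus\gamma_1 : K_0H_1(\pi_1)\to K_0H_1(\pi_2),$$ where $\gamma_0$ is a symmetry preserving scaled group isomorphism and $(\gamma_0\oplus\gamma_1)(\Sigma(\pi_1))=\Sigma(\pi_2)$.
   Context: All algebras are complex; direct limits here are algebraic (no completion). 4-cycle algebras. For positive integers $n_1,\dots,n_4$ with $r=\sum n_i$, the 4-cycle algebra with these block sizes is the algebra $A\subseteq M_r(\mathbb C)$ of block matrices $(a_{ij})$, $a_{ij}\in M_{n_i,n_j}(\mathbb C)$, with $a_{ij}=0$ unless $i=j$ or ($i\in\{1,2\}$, $j\in\{3,4\}$). $A(D_4)$ is the case $n_1=\dots=n_4=1$, with matrix units $e_{ij}$. $Q_1,\dots,Q_4$ denote the block projections. $C^*(A)=M_r(\mathbb C)$. An embedding (injective homomorphism) $\phi:A\to A'$ is star extendible if it extends to a $*$-homomorphism $C^*(A)\to C^*(A')$; its multiplicity is that of the extension. A multiplicity one star extendible embedding is rigid of type $\theta$ if $\theta$ is a permutation of $\{1,2,3,4\}$ preserving $\{1,2\}$ and $\{3,4\}$ and $\phi(Q_iAQ_j)\subseteq Q'_{\theta(i)}A'Q'_{\theta(j)}$ for all $i,j$ (four types: $\mathrm{id},(12),(34),(12)(34)$). A rigid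 embedding is a sum of multiplicity one rigid embeddings with mutually orthogonal ranges; it is generic if all four types occur. $H_1$ of a 4-cycle algebra is $\mathbb Z$ (with $g$ the generator given by the cycle $1,3,2,4$), and for $\phi$ rigid $H_1(\phi)$ is multiplication by (number of summands of type $\mathrm{id}$ or $(12)(34)$) minus (number of type $(12)$ or $(34)$). Systems. A generic system is a direct system $(A_k,\alpha_k)$ of 4-cycle algebras with all $\alpha_k$ generic; $A$ denotes its algebraic direct limit, $B$ the self-adjoint algebra generated by $A$ (the limit of the $C^*(A_k)$), and $A\cap A^*=D_1\oplus D_2$ where $D_1$ comes from blocks 1,2 and $D_2$ from blocks 3,4. A 2-symmetric algebra is an algebraic direct limit of algebras each a direct sum of two full matrix algebras, with $*$-embeddings whose partial multiplicities are given by matrices $\begin{bmatrix} x & y \\ y & x \end{bmatrix}$. A generic ordered inclusion $\pi:D_1\oplus D_2\to D$ is one which is star isomorphic to an inclusion $A\cap A^*\to B$, where $A$ is the algebraic direct limit of some generic system $(A_k,\alpha_k)$ of 4-cycle algebras and $B$ is the self-adjoint algebra generated by $A$ (the limit of the $C^*(A_k)$), with $D_1$ (resp. $D_2$) corresponding to blocks 1,2 (resp. 3,4); $A$ is then the associated limit algebra. Invariants. $K_0A=\varinjlim K_0(A_k\cap A_k^* )=K_0(D_1)\oplus K_0(D_2)$, where $K_0(A_k\cap A_k^* )=\mathbb Z^4$, with its order and scale $\Sigma_0A$ (classes of projections in the $A_k$); $H_1A=\varinjlim(H_1(A_k),H_1(\alpha_k))$. The joint scale $\Sigma A\subseteq K_0A\oplus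 H_1A$ is the set of elements $(K_0\phi([e_{11}\oplus e_{33}]),(H_1\phi)(g))$ for rigid embeddings $\phi:A(D_4)\to A_k$, $k\ge1$. Put $K_0H_1(\pi)=K_0A\oplus H_1A$ and $\Sigma(\pi)=\Sigma A$. Scaled group isomorphisms $\gamma_0$ are isomorphisms of the scaled ordered $K_0$ groups which respect the ordered summand structure $K_0(D_1)\oplus K_0(D_2)$. The canonical symmetries of $K_0A$ are the four automorphisms induced by the coordinate permutations $\mathrm{id},(12),(34),(12)(34)$ of each $\mathbb Z^4$; $\gamma_0$ is symmetry preserving if $\gamma_0\circ\theta=\theta\circ\gamma_0$ for each of these. *)

(* Defs.v *)
From HB Require Import structures.
From mathcomp Require Import all_boot all_order all_fingroup all_algebra.
From mathcomp Require Import complex.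
From mathcomp Require Import boolp classical_sets reals.

Set Implicit Arguments.
Unset Strict Implicit.
Unset Printing Implicit Defensive.

Import GRing.Theory Num.Theory.
Local Open Scope ring_scope.
Local Open Scope sesquilinear_scope.
Local Open Scope quotient_scope.

(* Star algebras are not assumed unital: direct limits along non-unital
   embeddings have no unit in general. *)
HB.mixin Record Lmodule_isStarAlgebra (C : numClosedFieldType) V
    of GRing.Lmodule C V := {
  smul : V -> V -> V;
  sstar : V -> V;
  smulA : associative smul;
  smulDl : left_distributive smul +%R;
  smulDr : right_distributive smul +%R;
  smulZl : forall (a : C) (x y : V), smul (a *: x) y = a *: smul x y;
  smulZr : forall (a : C) (x y : V), smul x (a *: y) = a *: smul x y;
  sstarD : {morph sstar : x y / x + y};
  sstarZ : forall (a : C) (x : V), sstar (a *: x) = a^* *: sstar x;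
  sstarK : involutive sstar;
  sstarM : forall x y, sstar (smul x y) = smul (sstar y) (sstar x)
}.

#[short(type="starAlgType")]
HB.structure Definition StarAlgebra (C : numClosedFieldType) :=
  { V of Lmodule_isStarAlgebra C V & GRing.Lmodule C V }.

Record star_hom (C : numClosedFieldType) (U V : starAlgType C) := StarHom {
  star_hom_fun :> {linear U -> V};
  star_homM : {morph star_hom_fun : x y / smul x y};
  star_homS : {morph star_hom_fun : x / sstar x}
}.

Section MatrixStarAlgebra.
Variables (C : numClosedFieldType) (n : nat).
Implicit Types A B : 'M[C]_n.

Fact mx_smulDl : left_distributive (@mulmx C n n n) +%R.
Proof. by move=> A B D; rewrite mulmxDl. Qed.

Fact mx_smulDr : right_distributive (@mulmx C n n n) +%R.
Proof. by move=> A B D; rewrite mulmxDr. Qed.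

Fact mx_smulZl (a : C) A B : (a *: A) *m B = a *: (A *m B).
Proof. by rewrite scalemxAl. Qed.

Fact mx_smulZr (a : C) A B : A *m (a *: B) = a *: (A *m B).
Proof. by rewrite scalemxAr. Qed.

Fact mx_starD : {morph (fun A => A ^t*) : A B / A + B}.
Proof. by move=> A B; rewrite linearD map_mxD. Qed.

Fact mx_starZ (a : C) A : (a *: A) ^t* = a^* *: A ^t*.
Proof. by apply/matrixP=> i j; rewrite !mxE rmorphM. Qed.

Fact mx_starM A B : (A *m B) ^t* = B ^t* *m A ^t*.
Proof. by rewrite trmx_mul map_mxM. Qed.

HB.instance Definition _ := Lmodule_isStarAlgebra.Build C 'M[C]_n
  (@mulmxA C n n n n) mx_smulDl mx_smulDr mx_smulZl mx_smulZr
  mx_starD mx_starZ (@trmxCK C n n) mx_starM.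

End MatrixStarAlgebra.

Section ProductStarAlgebra.
Variables (C : numClosedFieldType) (U V : starAlgType C).
Implicit Types x y : (U * V)%type.

Definition prod_smul x y : (U * V)%type := (smul x.1 y.1, smul x.2 y.2).
Definition prod_sstar x : (U * V)%type := (sstar x.1, sstar x.2).

Fact prod_smulA : associative prod_smul.
Proof. by move=> x y z; rewrite /prod_smul /= !smulA. Qed.

Fact prod_smulDl : left_distributive prod_smul +%R.
Proof. by move=> x y z; rewrite /prod_smul /= !smulDl. Qed.

Fact prod_smulDr : right_distributive prod_smul +%R.
Proof. by move=> x y z; rewrite /prod_smul /= !smulDr. Qed.

Fact prod_smulZl (a : C) x y : prod_smul (a *: x) y = a *: prod_smul x y.
Proof. by rewrite /prod_smul /= !smulZl. Qed.

Fact prod_smulZr (a : C) x y : prod_smul x (a *: y) = a *: prod_smul x y.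
Proof. by rewrite /prod_smul /= !smulZr. Qed.

Fact prod_sstarD : {morph prod_sstar : x y / x + y}.
Proof. by move=> x y; rewrite /prod_sstar /= !sstarD. Qed.

Fact prod_sstarZ (a : C) x : prod_sstar (a *: x) = a^* *: prod_sstar x.
Proof. by rewrite /prod_sstar /= !sstarZ. Qed.

Fact prod_sstarK : involutive prod_sstar.
Proof. by case=> x y; rewrite /prod_sstar /= !sstarK. Qed.

Fact prod_sstarM x y :
  prod_sstar (prod_smul x y) = prod_smul (prod_sstar y) (prod_sstar x).
Proof. by rewrite /prod_sstar /prod_smul /= !sstarM. Qed.

HB.instance Definition _ := Lmodule_isStarAlgebra.Build C (U * V)%type
  prod_smulA prod_smulDl prod_smulDr prod_smulZl prod_smulZr
  prod_sstarD prod_sstarZ prod_sstarK prod_sstarM.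

End ProductStarAlgebra.

(* The algebraic direct limit of T 0 -> T 1 -> ... : pairs (k, x) with x in
   T k, two pairs being identified when they become equal at a later stage. *)
Section DirectLimit.
Variables (T : nat -> zmodType) (f : forall k, {additive T k -> T k.+1}).

Definition dlim_step (u : {k & T k}) : {k & T k} :=
  Tagged T (f (tag u) (tagged u)).

Definition dlim_rel (u v : {k & T k}) : bool :=
  `[< exists m p, iter m dlim_step u = iter p dlim_step v >].

Fact dlim_rel_refl : reflexive dlim_rel.
Proof. by move=> u; apply/asboolP; exists 0, 0. Qed.

Fact dlim_rel_sym : symmetric dlim_rel.
Proof.
by move=> u v; apply/asboolP/asboolP => -[m [p e]]; exists p, m.
Qed.

Fact dlim_rel_trans : transitive dlim_rel.
Proof.
move=> v u w /asboolP[m [p e]] /asboolP[m' [p' e']]; apply/asboolP.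
by exists (m' + m)%N, (p + p')%N; rewrite !iterD e -e' -!iterD addnC.
Qed.

Canonical dlim_equiv :=
  EquivRel dlim_rel dlim_rel_refl dlim_rel_sym dlim_rel_trans.

Definition dlim := {eq_quot dlim_equiv}.
HB.instance Definition _ := Choice.on dlim.
HB.instance Definition _ := EqQuotient.on dlim.

Definition dlim_in k (x : T k) : dlim := \pi_dlim (Tagged T x).

Lemma dlim_inP k (x : T k) l (y : T l) :
  dlim_in x = dlim_in y <->
  exists m p, iter m dlim_step (Tagged T x) = iter p dlim_step (Tagged T y).
Proof.
split=> [/eqmodP/asboolP //|e].
by apply/eqmodP; apply/asboolP.
Qed.

Lemma dlim_surj (x : dlim) : exists k (a : T k), x = dlim_in a.
Proof.
elim/quotW: x => -[k a]; by exists k, a.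
Qed.

Lemma dlim_in_step k (x : T k) : dlim_in (f k x) = dlim_in x.
Proof. by apply/dlim_inP; exists 0, 1. Qed.

Fixpoint dlim_shift m k (x : T k) : T (m + k)%N :=
  if m is m'.+1 then f (m' + k) (dlim_shift m' x) else x.

Lemma iter_dlim_step m k (x : T k) :
  iter m dlim_step (Tagged T x) = Tagged T (dlim_shift m x).
Proof. by elim: m => //= m ->. Qed.

Lemma dlim_in_shift m k (x : T k) : dlim_in (dlim_shift m x) = dlim_in x.
Proof. by elim: m => //= m; rewrite dlim_in_step. Qed.

Lemma dlim_later k (x : T k) N : (k <= N)%N -> exists y : T N, dlim_in x = dlim_in y.
Proof.
move=> kN; rewrite -(subnK kN); exists (dlim_shift (N - k) x).
by rewrite dlim_in_shift.
Qed.

Lemma dlim_surj2 (x y : dlim) :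
  exists w : {k & (T k * T k)%type},
    x = dlim_in (tagged w).1 /\ y = dlim_in (tagged w).2.
Proof.
have [k [a ->]] := dlim_surj x; have [l [b ->]] := dlim_surj y.
have [a' ->] := dlim_later a (leq_maxl k l).
have [b' ->] := dlim_later b (leq_maxr k l).
by exists (Tagged (fun k => T k * T k)%type (a', b')).
Qed.

Lemma dlim_surj3 (x y z : dlim) :
  exists k (a b c : T k), [/\ x = dlim_in a, y = dlim_in b & z = dlim_in c].
Proof.
have [[k [a b]] /= [-> ->]] := dlim_surj2 x y.
have [l [c ->]] := dlim_surj z.
have [a' ->] := dlim_later a (leq_maxl k l).
have [b' ->] := dlim_later b (leq_maxl k l).
have [c' ->] := dlim_later c (leq_maxr k l).
by exists (maxn k l), a', b', c'.
Qed.

End DirectLimit.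

(* Operations on the limit induced by operations on each T k; the choice of
   representatives is immaterial by dlim_op1E and dlim_op2E. *)
HB.lock Definition dlim_op1 (T : nat -> zmodType)
    (f : forall k, {additive T k -> T k.+1}) (op : forall k, T k -> T k)
    (x : dlim f) : dlim f :=
  let w := cid (dlim_surj x) in dlim_in f (op _ (projT1 (cid (projT2 w)))).

HB.lock Definition dlim_op2 (T : nat -> zmodType)
    (f : forall k, {additive T k -> T k.+1}) (op : forall k, T k -> T k -> T k)
    (x y : dlim f) : dlim f :=
  let w := projT1 (cid (dlim_surj2 x y)) in
  dlim_in f (op (tag w) (tagged w).1 (tagged w).2).

Section DirectLimitZmodule.
Variables (T : nat -> zmodType) (f : forall k, {additive T k -> T k.+1}).

Local Notation dlim := (dlim f).
Local Notation dlim_in := (dlim_in f).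
Local Notation dlim_step := (dlim_step f).
Local Notation dlim_shift := (@dlim_shift T f).

Lemma dlim_op1E (op : forall k, T k -> T k) :
    (forall k a, f k (op k a) = op k.+1 (f k a)) ->
  forall k (a : T k), dlim_op1 op (dlim_in a) = dlim_in (op k a).
Proof.
move=> fop k a; rewrite unlock.
case: cid => l /= h; case: cid => b /= {h}.
move=> /dlim_inP[m [p]]; rewrite !iter_dlim_step => e.
have shop q i (c : T i) : dlim_shift q (op i c) = op (q + i)%N (dlim_shift q c).
  by elim: q => //= q ->; rewrite fop.
rewrite -(dlim_in_shift f p) -(dlim_in_shift f m (op k a)) !shop.
move: (dlim_shift m a) (dlim_shift p b) e.
move: (m + k)%N (p + l)%N => i j x y exy.
by have [? _] := (congr1 tag exy, exy); simpl in *; subst j;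
  move/eqP: exy; rewrite eq_Tagged /= => /eqP ->.
Qed.

Lemma dlim_op2E (op : forall k, T k -> T k -> T k) :
    (forall k a b, f k (op k a b) = op k.+1 (f k a) (f k b)) ->
  forall k (a b : T k),
    dlim_op2 op (dlim_in a) (dlim_in b) = dlim_in (op k a b).
Proof.
move=> fop k a b; rewrite unlock.
case: cid => -[l [c d]] /= [/dlim_inP[m [p e]] /dlim_inP[m' [p' e']]].
have shop q i (x y : T i) :
    dlim_shift q (op i x y) = op (q + i)%N (dlim_shift q x) (dlim_shift q y).
  by elim: q => //= q ->; rewrite fop.
have tags : (m + k = p + l)%N by move: (congr1 tag e); rewrite !iter_dlim_step.
have tags' : (m' + k = p' + l)%N.
  by move: (congr1 tag e'); rewrite !iter_dlim_step.
have eqpm : (m + p' = m' + p)%N.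
  by apply/eqP; rewrite -(eqn_add2r l) -!addnA -tags -tags' addnCA.
move/(congr1 (iter m' dlim_step)): e; rewrite -!iterD.
move/(congr1 (iter m dlim_step)): e'; rewrite -!iterD (addnC m m') eqpm.
rewrite !iter_dlim_step => e' e.
rewrite -(dlim_in_shift f (m' + p)) -(dlim_in_shift f (m' + m) (op k a b)) !shop.
move: (dlim_shift _ a) (dlim_shift _ c) e (dlim_shift _ b) (dlim_shift _ d) e'.
move: (m' + m + k)%N (m' + p + l)%N => i j x x' ex y y' ey.
have ij := congr1 tag ex; simpl in ij; subst j.
move/eqP: ex; rewrite eq_Tagged /= => /eqP ->.
by move/eqP: ey; rewrite eq_Tagged /= => /eqP ->.
Qed.

Definition dlim_add : dlim -> dlim -> dlim := dlim_op2 (fun k a b => a + b).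
Definition dlim_opp : dlim -> dlim := dlim_op1 (fun k a => - a).
Definition dlim_zero : dlim := dlim_in (0 : T 0%N).

Lemma dlim_addE k (a b : T k) : dlim_add (dlim_in a) (dlim_in b) = dlim_in (a + b).
Proof. by apply: dlim_op2E => i x y; rewrite raddfD. Qed.

Lemma dlim_oppE k (a : T k) : dlim_opp (dlim_in a) = dlim_in (- a).
Proof. by apply: dlim_op1E => i x; rewrite raddfN. Qed.

Lemma dlim_zeroE k : dlim_zero = dlim_in (0 : T k).
Proof.
elim: k => [//|k ->]; by rewrite -(dlim_in_step f (0 : T k)) raddf0.
Qed.

Fact dlim_addA : associative dlim_add.
Proof.
move=> x y z; have [k [a [b [c [-> -> ->]]]]] := dlim_surj3 x y z.
by rewrite !dlim_addE addrA.
Qed.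

Fact dlim_addC : commutative dlim_add.
Proof.
move=> x y; have [[k [a b]] /= [-> ->]] := dlim_surj2 x y.
by rewrite !dlim_addE addrC.
Qed.

Fact dlim_add0 : left_id dlim_zero dlim_add.
Proof.
by move=> x; have [k [a ->]] := dlim_surj x; rewrite (dlim_zeroE k) dlim_addE add0r.
Qed.

Fact dlim_addN : left_inverse dlim_zero dlim_opp dlim_add.
Proof.
move=> x; have [k [a ->]] := dlim_surj x.
by rewrite dlim_oppE dlim_addE addNr (dlim_zeroE k).
Qed.

HB.instance Definition _ :=
  GRing.isZmodule.Build dlim dlim_addA dlim_addC dlim_add0 dlim_addN.

Fact dlim_in_is_zmod_morphism k : zmod_morphism (@dlim_in k).
Proof.
by move=> a b; rewrite -[RHS]/(dlim_add _ (dlim_opp _)) dlim_oppE dlim_addE.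
Qed.

HB.instance Definition _ k :=
  GRing.isZmodMorphism.Build (T k) dlim (@dlim_in k) (@dlim_in_is_zmod_morphism k).

End DirectLimitZmodule.

Section StarDirectLimit.
Variables (C : numClosedFieldType) (T : nat -> starAlgType C).
Variable f : forall k, star_hom (T k) (T k.+1).

Definition sdlim := @dlim T (fun k => f k).
HB.instance Definition _ := GRing.Zmodule.on sdlim.

Definition sdlim_in k (x : T k) : sdlim := @dlim_in T (fun k => f k) k x.

Definition sdlim_scale (a : C) : sdlim -> sdlim := dlim_op1 (fun k x => a *: x).
Definition sdlim_star : sdlim -> sdlim := dlim_op1 (fun k x => sstar x).
Definition sdlim_mul : sdlim -> sdlim -> sdlim := dlim_op2 (fun k => smul).

Lemma sdlim_surj (x : sdlim) : exists k (a : T k), x = sdlim_in a.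
Proof. exact: dlim_surj. Qed.

Lemma sdlim_surj2 (x y : sdlim) :
  exists k (a b : T k), x = sdlim_in a /\ y = sdlim_in b.
Proof. by have [[k [a b]] /= [-> ->]] := dlim_surj2 x y; exists k, a, b. Qed.

Lemma sdlim_surj3 (x y z : sdlim) :
  exists k (a b c : T k), [/\ x = sdlim_in a, y = sdlim_in b & z = sdlim_in c].
Proof. exact: dlim_surj3. Qed.

Lemma sdlim_addE k (x y : T k) : sdlim_in x + sdlim_in y = sdlim_in (x + y).
Proof. by rewrite /sdlim_in raddfD. Qed.

Lemma sdlim_scaleE a k (x : T k) : sdlim_scale a (sdlim_in x) = sdlim_in (a *: x).
Proof. by apply: dlim_op1E => i y; rewrite /= linearZ. Qed.

Lemma sdlim_starE k (x : T k) : sdlim_star (sdlim_in x) = sdlim_in (sstar x).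
Proof. by apply: dlim_op1E => i y; rewrite /= star_homS. Qed.

Lemma sdlim_mulE k (x y : T k) :
  sdlim_mul (sdlim_in x) (sdlim_in y) = sdlim_in (smul x y).
Proof. by apply: dlim_op2E => i u v; rewrite /= star_homM. Qed.

Fact sdlim_scaleA a b x : sdlim_scale a (sdlim_scale b x) = sdlim_scale (a * b) x.
Proof.
by have [k [u ->]] := sdlim_surj x; rewrite !sdlim_scaleE scalerA.
Qed.

Fact sdlim_scale1 : left_id 1 sdlim_scale.
Proof. by move=> x; have [k [u ->]] := sdlim_surj x; rewrite sdlim_scaleE scale1r. Qed.

Fact sdlim_scaleDr : right_distributive sdlim_scale +%R.
Proof.
move=> a x y; have [k [u [v [-> ->]]]] := sdlim_surj2 x y.
by rewrite !(sdlim_scaleE, sdlim_addE) scalerDr.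
Qed.

Fact sdlim_scaleDl x : {morph sdlim_scale^~ x : a b / a + b}.
Proof.
move=> a b; have [k [u ->]] := sdlim_surj x.
by rewrite !(sdlim_scaleE, sdlim_addE) scalerDl.
Qed.

HB.instance Definition _ := GRing.Zmodule_isLmodule.Build C sdlim
  sdlim_scaleA sdlim_scale1 sdlim_scaleDr sdlim_scaleDl.

Lemma sdlim_inZ a k (x : T k) : a *: sdlim_in x = sdlim_in (a *: x).
Proof. exact: sdlim_scaleE. Qed.

Fact sdlim_mulA : associative sdlim_mul.
Proof.
move=> x y z; have [k [a [b [c [-> -> ->]]]]] := sdlim_surj3 x y z.
by rewrite !sdlim_mulE smulA.
Qed.

Fact sdlim_mulDl : left_distributive sdlim_mul +%R.
Proof.
move=> x y z; have [k [a [b [c [-> -> ->]]]]] := sdlim_surj3 x y z.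
by rewrite !(sdlim_mulE, sdlim_addE) smulDl.
Qed.

Fact sdlim_mulDr : right_distributive sdlim_mul +%R.
Proof.
move=> x y z; have [k [a [b [c [-> -> ->]]]]] := sdlim_surj3 x y z.
by rewrite !(sdlim_mulE, sdlim_addE) smulDr.
Qed.

Fact sdlim_mulZl (a : C) (x y : sdlim) : sdlim_mul (a *: x) y = a *: sdlim_mul x y.
Proof.
have [k [u [v [-> ->]]]] := sdlim_surj2 x y.
by rewrite !(sdlim_mulE, sdlim_inZ) smulZl.
Qed.

Fact sdlim_mulZr (a : C) (x y : sdlim) : sdlim_mul x (a *: y) = a *: sdlim_mul x y.
Proof.
have [k [u [v [-> ->]]]] := sdlim_surj2 x y.
by rewrite !(sdlim_mulE, sdlim_inZ) smulZr.
Qed.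

Fact sdlim_starD : {morph sdlim_star : x y / x + y}.
Proof.
move=> x y; have [k [u [v [-> ->]]]] := sdlim_surj2 x y.
by rewrite !(sdlim_starE, sdlim_addE) sstarD.
Qed.

Fact sdlim_starZ (a : C) (x : sdlim) : sdlim_star (a *: x) = a^* *: sdlim_star x.
Proof.
have [k [u ->]] := sdlim_surj x.
by rewrite !(sdlim_inZ, sdlim_starE) sstarZ.
Qed.

Fact sdlim_starK : involutive sdlim_star.
Proof. by move=> x; have [k [u ->]] := sdlim_surj x; rewrite !sdlim_starE sstarK. Qed.

Fact sdlim_starM x y :
  sdlim_star (sdlim_mul x y) = sdlim_mul (sdlim_star y) (sdlim_star x).
Proof.
have [k [u [v [-> ->]]]] := sdlim_surj2 x y.
by rewrite !(sdlim_mulE, sdlim_starE) sstarM.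
Qed.

HB.instance Definition _ := Lmodule_isStarAlgebra.Build C sdlim
  sdlim_mulA sdlim_mulDl sdlim_mulDr sdlim_mulZl sdlim_mulZr
  sdlim_starD sdlim_starZ sdlim_starK sdlim_starM.

End StarDirectLimit.

Local Open Scope classical_set_scope.

Section TwoSymmetric.
Variable C : numClosedFieldType.

Definition is_projection n (p : 'M[C]_n) : Prop := p *m p = p /\ p ^t* = p.

(* The multiplicity of a star homomorphism of full matrix algebras is the rank
   of the image of a minimal projection. *)
Definition has_multiplicity m n (f : 'M[C]_m -> 'M[C]_n) (c : nat) : Prop :=
  forall p, is_projection p -> \rank p = 1%N -> \rank (f p) = c.

Definition two_summands (a b : nat) : starAlgType C :=
  ('M[C]_a * 'M[C]_b)%type.

Definition symmetric_multiplicities a b a' b'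
    (f : two_summands a b -> two_summands a' b') : Prop :=
  exists x y : nat,
    [/\ has_multiplicity (fun u : 'M[C]_a => (f (u, 0)).1) x,
        has_multiplicity (fun u : 'M[C]_a => (f (u, 0)).2) y,
        has_multiplicity (fun v : 'M[C]_b => (f (0, v)).1) y
      & has_multiplicity (fun v : 'M[C]_b => (f (0, v)).2) x].

Definition star_isomorphic (U V : starAlgType C) : Prop :=
  exists beta : star_hom U V, bijective beta.

Definition two_symmetric (D : starAlgType C) : Prop :=
  exists (a b : nat -> nat)
    (f : forall k,
       star_hom (two_summands (a k) (b k)) (two_summands (a k.+1) (b k.+1))),
    [/\ forall k, (0 < a k)%N && (0 < b k)%N,
        forall k, injective (f k),
        forall k, symmetric_multiplicities (f k)
      & star_isomorphic D (sdlim f)].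

End TwoSymmetric.

Record block_sizes := BlockSizes {
  block_size :> 'I_4 -> nat;
  block_size_gt0 : forall i, (0 < block_size i)%N
}.

(* Blocks are numbered 0, 1, 2, 3 rather than 1, 2, 3, 4. *)
Definition D4_sizes : block_sizes := @BlockSizes (fun=> 1%N) (fun=> isT).

Section CycleAlgebras.
Variable C : numClosedFieldType.

(* C*(A) for the 4-cycle algebra A with block sizes n. *)
Definition cycle_cstar (n : block_sizes) : starAlgType C :=
  'M[C]_(\sum_i n i).

Definition block (n : block_sizes) (a : cycle_cstar n) (i j : 'I_4) :
    'M[C]_(n i, n j) :=
  submxblock a i j.

Definition cycle_alg (n : block_sizes) : set (cycle_cstar n) :=
  [set a | forall i j : 'I_4,
     ~~ ((i == j) || (i < 2)%N && (2 <= j)%N) -> block a i j = 0].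

Definition block_proj (n : block_sizes) (i : 'I_4) : cycle_cstar n :=
  \mxdiag_(j < 4) (if j == i then 1%:M else 0).

(* A minimal projection of the i-th diagonal block. *)
Definition block_unit (n : block_sizes) (i : 'I_4) : cycle_cstar n :=
  let r := tagnat.Rank i (Ordinal (block_size_gt0 n i)) in delta_mx r r.

Definition preserves_sides (theta : {perm 'I_4}) : Prop :=
  forall i, (theta i < 2)%N = (i < 2)%N.

Definition sym12 : {perm 'I_4} := tperm (inord 0) (inord 1).
Definition sym34 : {perm 'I_4} := tperm (inord 2) (inord 3).

(* As A generates C*(A), a star extendible embedding of 4-cycle algebras is
   determined by its extension, and it is represented by this extension. *)
Record rigid_of_type (n n' : block_sizes) (theta : {perm 'I_4})
    (f : star_hom (cycle_cstar n) (cycle_cstar n')) : Prop := RigidOfType {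
  rigid_alg : forall a, cycle_alg a -> cycle_alg (f a);
  rigid_mult1 : has_multiplicity f 1;
  rigid_sides : preserves_sides theta;
  rigid_block : forall i j a, cycle_alg a ->
    exists2 a', cycle_alg a' &
      f (block_proj n i *m a *m block_proj n j) =
        block_proj n' (theta i) *m a' *m block_proj n' (theta j)
}.

Record rigid_embedding (n n' : block_sizes) := RigidEmbedding {
  rigid_num : nat;
  rigid_num_gt0 : (0 < rigid_num)%N;
  rigid_part : 'I_rigid_num -> star_hom (cycle_cstar n) (cycle_cstar n');
  rigid_type : 'I_rigid_num -> {perm 'I_4};
  rigid_partP : forall s, rigid_of_type (rigid_type s) (rigid_part s);
  rigid_orth : forall s t, s != t ->
    forall a b, rigid_part s a *m rigid_part t b = 0
}.

Arguments rigid_part {n n'} r s : rename.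
Arguments rigid_type {n n'} r s : rename.

Section RigidEmbeddings.
Variables (n n' : block_sizes) (phi : rigid_embedding n n').

Definition rigid_fun (a : cycle_cstar n) : cycle_cstar n' :=
  \sum_s rigid_part phi s a.

Fact rigid_fun_is_linear : linear rigid_fun.
Proof.
move=> c a b; rewrite /rigid_fun scaler_sumr -big_split /=.
by apply: eq_bigr => s _; rewrite linearP.
Qed.

HB.instance Definition _ :=
  GRing.isLinear.Build C (cycle_cstar n) (cycle_cstar n') _ rigid_fun
    rigid_fun_is_linear.

Fact rigid_funM : {morph rigid_fun : a b / smul a b}.
Proof.
move=> a b; rewrite /rigid_fun [RHS]mulmx_suml; apply: eq_bigr => s _.
rewrite mulmx_sumr (bigD1 s) //= [X in _ + X]big1 => [|t ts].
  by rewrite [RHS]addr0; apply: star_homM.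
by apply: rigid_orth; rewrite eq_sym.
Qed.

Fact rigid_funS : {morph rigid_fun : a / sstar a}.
Proof.
move=> a; rewrite /rigid_fun (big_morph _ (@sstarD _ _) (_ : sstar 0 = 0)).
  by apply: eq_bigr => s _; apply: star_homS.
by apply/matrixP=> i j; rewrite !mxE rmorph0.
Qed.

Definition rigid_hom : star_hom (cycle_cstar n) (cycle_cstar n') :=
  @StarHom _ _ _ rigid_fun rigid_funM rigid_funS.

Definition is_generic : Prop :=
  forall theta, preserves_sides theta -> exists s, rigid_type phi s = theta.

(* H_1 of a 4-cycle algebra is int, with generator g = 1. *)
Definition rigid_H1 : int :=
  #|[pred s | rigid_type phi s \in [:: 1; sym12 * sym34]%g]|%:Z
    - #|[pred s | rigid_type phi s \in [:: sym12; sym34]]|%:Z.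

(* The map induced on K_0 = Z^4, for row vectors: the (i, j) entry is the
   rank in block j of the image of a minimal projection of block i. *)
Definition rigid_K0mx : 'M[int]_4 :=
  \matrix_(i, j) (\rank (block (rigid_hom (block_unit n i)) j j))%:Z.

Definition rigid_K0 : {additive 'rV[int]_4 -> 'rV[int]_4} := mulmxr rigid_K0mx.

Definition rigid_H1map : {additive int -> int} := rigid_H1 \*o idfun.

End RigidEmbeddings.

(* The class in K_0(A \cap A* ) = Z^4 of a projection of A. *)
Definition proj_class (n : block_sizes) (p : cycle_cstar n) : 'rV[int]_4 :=
  \row_i (\rank (block p i i))%:Z.

End CycleAlgebras.

Arguments rigid_part {C n n'} r s : rename.
Arguments rigid_type {C n n'} r s : rename.

Record generic_system (C : numClosedFieldType) := GenericSystem {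
  sys_size : nat -> block_sizes;
  sys_map : forall k, rigid_embedding C (sys_size k) (sys_size k.+1);
  sys_generic : forall k, is_generic (sys_map k)
}.

Section Limits.
Variables (C : numClosedFieldType) (S : generic_system C).

Definition cstar_lim : starAlgType C :=
  sdlim (fun k => rigid_hom (sys_map S k)).

Definition to_lim k (a : cycle_cstar C (sys_size S k)) : cstar_lim :=
  sdlim_in (fun k => rigid_hom (sys_map S k)) a.

(* The connecting maps are injective, so the limit A of the 4-cycle algebras
   is a subalgebra of the limit B of their C*-algebras. *)
Definition alg_lim : set cstar_lim :=
  [set x | exists k a, cycle_alg a /\ x = to_lim (k := k) a].

Definition diag_lim : set cstar_lim :=
  [set x | alg_lim x /\ alg_lim (sstar x)].

(* The elements of A \cap A* that come from the blocks in P. *)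
Definition diag_summand (P : pred 'I_4) : set cstar_lim :=
  [set x | exists k a,
     [/\ cycle_alg a, cycle_alg (sstar a),
         forall i, ~~ P i -> block a i i = 0 & x = to_lim (k := k) a]].

Definition sysK0 : zmodType := dlim (fun k => rigid_K0 (sys_map S k)).
Definition sysH1 : zmodType := dlim (fun k => rigid_H1map (sys_map S k)).

Definition to_K0 k (v : 'rV[int]_4) : sysK0 :=
  dlim_in (fun k => rigid_K0 (sys_map S k)) (k := k) v.
Definition to_H1 k (c : int) : sysH1 :=
  dlim_in (fun k => rigid_H1map (sys_map S k)) (k := k) c.

Definition sysK0_pos : set sysK0 :=
  [set x | exists k (v : 'rV[int]_4), (forall i, 0 <= v 0 i) /\ x = to_K0 k v].

Definition sysK0_scale : set sysK0 :=
  [set x | exists k (p : cycle_cstar C (sys_size S k)),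
     [/\ cycle_alg p, is_projection p & x = to_K0 k (proj_class p)]].

Definition sysK0_summand (P : pred 'I_4) : set sysK0 :=
  [set x | exists k (v : 'rV[int]_4), (forall i, ~~ P i -> v 0 i = 0) /\ x = to_K0 k v].

(* Well defined by sysK0_symE below. *)
Definition sysK0_sym (theta : {perm 'I_4}) : sysK0 -> sysK0 :=
  dlim_op1 (fun k => col_perm theta).

(* The image of g under H_1(phi) is the integer rigid_H1 phi. *)
Definition sys_joint_scale : set (sysK0 * sysH1) :=
  [set x | exists k (phi : rigid_embedding C D4_sizes (sys_size S k)),
     x = (to_K0 k (rigid_K0 phi
            (proj_class (block_unit C D4_sizes (inord 0)
                         + block_unit C D4_sizes (inord 2)))),
          to_H1 k (rigid_H1 phi))].

End Limits.

Arguments alg_lim {C} S _.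
Arguments diag_lim {C} S _.
Arguments diag_summand {C} S P _.
Arguments sysK0_pos {C} S _.
Arguments sysK0_scale {C} S _.
Arguments sysK0_summand {C} S P _.
Arguments sysK0_sym {C} S theta _.
Arguments sys_joint_scale {C} S _.

(* On K_0 a rigid embedding counts summands by type; hence its matrix commutes
   with the coordinate permutations and sysK0_sym is well defined. *)
Section RigidK0.
Variables (C : numClosedFieldType) (n n' : block_sizes).

Lemma mxrank_idem m (p : 'M[C]_m) : p *m p = p -> (\rank p)%:R = \tr p.
Proof.
move=> pp; move: (mulmx_base p) (col_base_full p) (row_base_free p).
move: (col_base p) (row_base p) => c d cd fc fd.
have dc : d *m c = 1%:M.
  apply: (row_full_inj fc); apply: (row_free_inj fd).
  by rewrite mulmx1 !mulmxA cd -mulmxA cd pp.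
by rewrite -[in RHS]cd mxtrace_mulC dc mxtrace1.
Qed.

Lemma block_projE (k : block_sizes) i a b :
  block (block_proj C k i) a b = (if (a == b) && (a == i) then pid_mx (k i) else 0).
Proof.
rewrite /block /block_proj /mxdiag mxblockK.
case: (altP (a =P b)) => [e|//]; subst b; rewrite conform_mx_id.
by case: eqP => // ->; rewrite pid_mx_1.
Qed.

Lemma mul_blockE (k : block_sizes) (a b : cycle_cstar C k) i j :
  block (a *m b : cycle_cstar C k) i j = \sum_l block a i l *m block b l j.
Proof.
rewrite /block -{1}[a]submxblockK -{1}[b]submxblockK.
by rewrite mul_mxblock mxblockK.
Qed.

Lemma block_corner (k : block_sizes) (a : cycle_cstar C k) i j u v :
  block (block_proj C k i *m a *m block_proj C k j : cycle_cstar C k) u v =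
    (if (u == i) && (v == j) then block a u v else 0).
Proof.
have projl (b : cycle_cstar C k) w : block (block_proj C k i *m b : cycle_cstar C k) u w =
    if u == i then block b u w else 0.
  rewrite mul_blockE (bigD1 u) //= [X in _ + X]big1 => [|l /negPf lu].
    rewrite [LHS]addr0 block_projE eqxx /=; case: eqP => [->|_].
      by rewrite pid_mx_1 mul1mx.
    by rewrite mul0mx.
  by rewrite block_projE eq_sym lu mul0mx.
rewrite mul_blockE (bigD1 v) //= [X in _ + X]big1 => [|l lv].
  rewrite [LHS]addr0 block_projE eqxx /= projl; case: (v =P j) => [<-|_].
    by rewrite pid_mx_1 mulmx1 andbT.
  by rewrite mulmx0 andbF.
by rewrite block_projE (negPf lv) mulmx0.
Qed.

Lemma block_inj (k : block_sizes) (a b : cycle_cstar C k) :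
  (forall u v, block a u v = block b u v) -> a = b.
Proof. by move/mxblockP. Qed.

Lemma mxtrace_block (k : block_sizes) (a : cycle_cstar C k) :
  \tr a = \sum_u \tr (block a u u).
Proof. by rewrite -[in LHS](submxblockK a) mxtrace_mxblock. Qed.

Lemma is_projection_unit (k : block_sizes) i : is_projection (block_unit C k i).
Proof.
split; first by rewrite mul_delta_mx.
by rewrite trmx_delta map_delta_mx.
Qed.

Lemma rank_unit (k : block_sizes) i : \rank (block_unit C k i) = 1%N.
Proof. exact: mxrank_delta. Qed.

Lemma block_unit0 (k : block_sizes) i u v : ~~ ((u == i) && (v == i)) ->
  block (block_unit C k i) u v = 0.
Proof.
move=> ne; apply/matrixP=> x y; rewrite !mxE -!val_eqE /= !tagnat.eq_Rank.
by case: (u == i) (v == i) ne => [] [] //= _; rewrite !andbF.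
Qed.

Lemma block_unit_corner (k : block_sizes) i :
  block_proj C k i *m block_unit C k i *m block_proj C k i = block_unit C k i.
Proof.
apply: block_inj => u v; rewrite block_corner.
by case: ifPn => // /block_unit0 ->.
Qed.

Lemma block_unit_alg (k : block_sizes) i : cycle_alg (block_unit C k i).
Proof.
move=> u v uv; apply: block_unit0; apply: contra uv => /andP[/eqP-> /eqP->].
by rewrite eqxx.
Qed.

Lemma rigid_of_type_block theta (f : star_hom (cycle_cstar C n) (cycle_cstar C n'))
    i u v : rigid_of_type theta f -> ~~ ((u == theta i) && (v == theta i)) ->
  block (f (block_unit C n i)) u v = 0.
Proof.
move=> [_ _ _ fb] /negPf ne; have [a' _ e] := fb i i _ (block_unit_alg n i).
by rewrite block_unit_corner in e; rewrite e block_corner ne.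
Qed.

Lemma star_hom_projection m m' (f : star_hom 'M[C]_m 'M[C]_m') (p : 'M[C]_m) :
  is_projection p -> is_projection (f p).
Proof.
case=> pp ps; split; first by rewrite -{3}pp; apply: esym; apply: star_homM.
by rewrite -{2}ps; apply: esym; apply: star_homS.
Qed.

Lemma rigid_of_type_trace theta (f : star_hom (cycle_cstar C n) (cycle_cstar C n'))
    i j : rigid_of_type theta f ->
  \tr (block (f (block_unit C n i)) j j) = (theta i == j)%:R.
Proof.
move=> rf; have up := is_projection_unit n i.
case: eqP => [<-|/eqP ne]; last first.
  rewrite (rigid_of_type_block rf) ?mxtrace0 // andbb.
  by apply: contra ne => /eqP ->.
have := @star_hom_projection _ _ f _ up => -[idem _].
have := mxrank_idem idem; rewrite (rigid_mult1 rf up (rank_unit n i)).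
rewrite mxtrace_block (bigD1 (theta i)) //= [X in _ + X]big1 ?addr0 => [-> //|u ne].
by rewrite (rigid_of_type_block rf) ?mxtrace0 // andbb.
Qed.

Lemma block_sum (k : block_sizes) (I : finType) (F : I -> cycle_cstar C k) u v :
  block (\sum_s F s) u v = \sum_s block (F s) u v.
Proof. exact: submxblock_sum. Qed.

Lemma rigid_K0mxE (phi : rigid_embedding C n n') i j :
  rigid_K0mx phi i j = #|[pred s | rigid_type phi s i == j]|%:Z.
Proof.
have phiE a : rigid_hom phi a = \sum_s rigid_part phi s a by [].
rewrite mxE; congr Posz; apply/eqP; rewrite -(eqr_nat C); apply/eqP.
rewrite mxrank_idem; last first.
  have [pp _] := star_hom_projection (rigid_hom phi) (is_projection_unit n i).
  rewrite -[in RHS]pp mul_blockE (bigD1 j) //= [X in _ + X]big1 ?addr0 // => l lj.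
  rewrite phiE block_sum [X in X *m _]big1 ?mul0mx // => s _.
  rewrite (rigid_of_type_block (rigid_partP s)) //.
  by apply: contra lj => /andP[/eqP -> /eqP ->].
rewrite phiE block_sum raddf_sum /= -sum1_card natr_sum [RHS]big_mkcond /=.
apply: eq_bigr => s _.
rewrite (rigid_of_type_trace _ _ (rigid_partP s)).
by rewrite inE; case: eqP.
Qed.

End RigidK0.

Lemma preserves_sidesC (s t : {perm 'I_4}) i :
  preserves_sides s -> preserves_sides t -> s (t i) = t (s i).
Proof.
move=> ps pt.
have three (x y z : 'I_4) : (x < 2)%N = (y < 2)%N -> (y < 2)%N = (z < 2)%N ->
    [|| x == y, y == z | x == z].
  by case: x y z => [[|[|[|[|//]]]] ?] [[|[|[|[|//]]]] ?] [[|[|[|[|//]]]] ?].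
have fix_case (p q : {perm 'I_4}) : preserves_sides p -> preserves_sides q ->
    p i = i -> p (q i) = q (p i).
  move=> pp pq pi; rewrite pi.
  have /or3P[/eqP e|/eqP //|/eqP e] := three i (q i) (p (q i)) (esym (pq i)) (esym (pp _)).
    by rewrite -e pi.
  by rewrite -e; apply: (@perm_inj _ p); rewrite pi.
have invol (p : {perm 'I_4}) : preserves_sides p -> p i != i -> p (p i) = i.
  move=> pp pi.
  have /or3P[/eqP e|/eqP e|/eqP //] := three i (p i) (p (p i)) (esym (pp i)) (esym (pp _)).
    by rewrite -e eqxx in pi.
  by rewrite -(perm_inj e) eqxx in pi.
have [si|si] := eqVneq (s i) i; first exact: fix_case.
have [ti|ti] := eqVneq (t i) i; first by rewrite [RHS]fix_case.
have st : s i = t i.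
  have /or3P[/eqP e|/eqP e|/eqP //] :=
      three (s i) i (t i) (ps i) (esym (pt i)).
    by rewrite e eqxx in si.
  by rewrite -e eqxx in ti.
by rewrite -st invol // st invol.
Qed.

Lemma rigid_K0_sym (C : numClosedFieldType) (n n' : block_sizes)
    (phi : rigid_embedding C n n') theta v : preserves_sides theta ->
  rigid_K0 phi (col_perm theta v) = col_perm theta (rigid_K0 phi v).
Proof.
move=> pt; apply/rowP => j; rewrite !mxE [RHS](reindex_perm theta) /=.
apply: eq_bigr => i _; rewrite mxE !rigid_K0mxE; congr (_ * Posz _).
apply: eq_card => s; rewrite !inE.
by rewrite -(preserves_sidesC _ pt (rigid_sides (rigid_partP s))) (inj_eq perm_inj).
Qed.

Lemma sysK0_symE (C : numClosedFieldType) (S : generic_system C) theta k v :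
  preserves_sides theta ->
  sysK0_sym S theta (to_K0 S k v) = to_K0 S k (col_perm theta v).
Proof.
move=> pt; rewrite /sysK0_sym /to_K0 dlim_op1E // => l w.
by rewrite rigid_K0_sym.
Qed.

Definition side12 : pred 'I_4 := fun i => (i < 2)%N.
Definition side34 : pred 'I_4 := fun i => (2 <= i)%N.

Section OrderedInclusions.
Variables (C : numClosedFieldType) (D1 D2 D : starAlgType C).

Definition summand1 (pi : (D1 * D2)%type -> D) : set D := range (fun d => pi (d, 0)).
Definition summand2 (pi : (D1 * D2)%type -> D) : set D := range (fun d => pi (0, d)).

Record generic_ordered_inclusion := GenericOrderedInclusion {
  goi_map :> star_hom (D1 * D2)%type D;
  goi_inj : injective goi_map;
  goi_system : generic_system C;
  goi_iso : exists beta : star_hom D (cstar_lim goi_system),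
    [/\ bijective beta,
        beta @` range goi_map = diag_lim goi_system,
        beta @` summand1 goi_map = diag_summand goi_system side12
      & beta @` summand2 goi_map = diag_summand goi_system side34]
}.

Implicit Type pi : generic_ordered_inclusion.

Definition K0 pi : zmodType := sysK0 (goi_system pi).
Definition H1 pi : zmodType := sysH1 (goi_system pi).
Definition K0_pos pi : set (K0 pi) := sysK0_pos (goi_system pi).
Definition K0_scale pi : set (K0 pi) := sysK0_scale (goi_system pi).
Definition K0_D1 pi : set (K0 pi) := sysK0_summand (goi_system pi) side12.
Definition K0_D2 pi : set (K0 pi) := sysK0_summand (goi_system pi) side34.
Definition K0_sym pi theta : K0 pi -> K0 pi := sysK0_sym (goi_system pi) theta.

Definition K0H1 pi : zmodType := (K0 pi * H1 pi)%type.
Definition joint_scale pi : set (K0H1 pi) := sys_joint_scale (goi_system pi).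

End OrderedInclusions.

Arguments K0_pos {C D1 D2 D} pi _.
Arguments K0_scale {C D1 D2 D} pi _.
Arguments K0_D1 {C D1 D2 D} pi _.
Arguments K0_D2 {C D1 D2 D} pi _.
Arguments K0_sym {C D1 D2 D} pi theta _.
Arguments joint_scale {C D1 D2 D} pi _.

Section Isomorphisms.
Variables (C : numClosedFieldType) (D1 D2 D : starAlgType C).
Variables pi1 pi2 : generic_ordered_inclusion D1 D2 D.

Record scaled_group_iso (g : {additive K0 pi1 -> K0 pi2}) : Prop :=
  ScaledGroupIso {
  sgi_bij : bijective g;
  sgi_pos : g @` K0_pos pi1 = K0_pos pi2;
  sgi_scale : g @` K0_scale pi1 = K0_scale pi2;
  sgi_D1 : g @` K0_D1 pi1 = K0_D1 pi2;
  sgi_D2 : g @` K0_D2 pi1 = K0_D2 pi2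
}.

Definition symmetry_preserving (g : K0 pi1 -> K0 pi2) : Prop :=
  forall theta, preserves_sides theta ->
    g \o K0_sym pi1 theta = K0_sym pi2 theta \o g.

(* gamma_0 (+) gamma_1 *)
Definition dsum_map (g : K0 pi1 -> K0 pi2) (h : H1 pi1 -> H1 pi2)
    (x : K0H1 pi1) : K0H1 pi2 :=
  (g x.1, h x.2).

End Isomorphisms.

(* Main.v *)
(** Up to conjugation by block diagonal unitaries, a rigid embedding is determined
    by the number of its summands of each type, equivalently by its maps on K_0
    and H_1. The types are read off from two commuting signs on the multiplicity
    space, one for each side {1,2}, {3,4} of the 4-cycle.

    If the invariants are isomorphic, the joint scale element of an embedding of
    A(D_4) in A_k yields, with the symmetries and the scale of K_0, a rigid
    embedding of A_k in some A'_l that lifts the isomorphism. The lifts are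
    corrected by unitaries and intertwined as in Elliott's argument.

    Conversely a star isomorphism restricts to maps C*(A_k) -> C*(A'_l) that
    respect A \cap A^*. A trace argument shows that such a map has a sign for each
    side, and since composing it with a lift of the inverse gives a connecting
    map, the two signs commute or anticommute. In the first case it is conjugate to
    a rigid embedding. In the second it vanishes on H_1, and after composing with
    further lifts its multiplicity is divisible by 4, so it has the invariants of
    a rigid embedding with equally many summands of each type. Either way it
    induces the maps on K_0 and H_1. *)

From HB Require Import structures.
Require Import Defs.
From mathcomp Require Import all_boot all_order all_fingroup all_algebra.
From mathcomp Require Import complex.
From mathcomp Require Import boolp classical_sets reals.
From mathcomp Require Import ring zify.

Set Implicit Arguments.
Unset Strict Implicit.
Unset Printing Implicit Defensive.
Import Order.TTheory GRing.Theory Num.Theory.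
Local Open Scope ring_scope.
Local Open Scope sesquilinear_scope.

(** * Projections and partial isometries *)

Section Projections.
Variables (C : numClosedFieldType) (n : nat).
Implicit Types p q u w : 'M[C]_n.

(** The four types are indexed by the group of flips Z/2 x Z/2. The traces of [f 1], [X true],
    [X false] and [X true X false], cut by a minimal projection, are the Fourier coefficients of the
    type counts: the first three amount to the map on K_0, the fourth to the map on H_1. The
    obstacle in the converse is that a homomorphism respecting A and A ∩ A* need not be rigid. Take
    two Pauli matrices as [X true] and [X false] on the multiplicity space C^2: then a -> a (x) 1
    maps A(D_4) into the 4-cycle algebra with blocks of size 2, but it is not a sum of multiplicity
    one rigid embeddings, since those have commuting signs. Its traces are those of half a summand
    of each type, and this is why the multiplicity has to be brought to a multiple of 4. For such
    lifts only equality of invariants with a rigid embedding is claimed, never conjugacy. *)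

Lemma mxtrace_idem p : p *m p = p -> \tr p = (\rank p)%:R.
Proof. by move=> /mxrank_idem. Qed.

(** The rows of [w] are an orthonormal basis of the row space of [p], obtained by Gram-Schmidt. *)
Lemma projection_isometry p r : is_projection p -> \rank p = r ->
  exists w : 'M[C]_(r, n), [/\ w *m w ^t* = 1%:M, w ^t* *m w = p & w *m p = w].
Proof.
move=> [pp ps] <- {r}; pose w := schmidt (row_base p).
suff: exists w : 'M[C]_(\rank p, n), w *m w ^t* = 1%:M /\ (w :=: p)%MS.
  move: (\rank p) => r [{}w [ww wp]]; exists w.
  have ewp : w *m p = w.
    have /submxP[x ->] : (w <= p)%MS by rewrite wp.
    by rewrite -mulmxA pp.
  have epw : p *m (w ^t* *m w) = p.
    have /submxP[x e] : (p <= w)%MS by rewrite wp.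
    by rewrite [in LHS]e mulmxA -(mulmxA x) ww mulmx1.
  (* The adjoint of [p w* w = p] is [w* w p = p], and [w p = w] absorbs the last factor. *)
  split=> //; move: (congr1 (fun a => a ^t*) epw).
  rewrite !trmx_mul !map_mxM /= ps trmxCK => <-.
  by rewrite -mulmxA ewp.
exists w.
have ww : w *m w ^t* = 1%:M.
  by apply/unitarymxP/schmidt_unitarymx/rank_leq_col.
have wp : (w :=: p)%MS.
  apply: eqmx_trans (eq_row_base p).
  by apply: eqmx_schmidt_free; exact: row_base_free.
by split.
Qed.

Lemma partial_isometry p q : is_projection p -> is_projection q ->
  \rank p = \rank q ->
  exists u, [/\ u ^t* *m u = p, u *m u ^t* = q, u *m p = u & q *m u = u].
Proof.
move=> pp pq epq; have [v [vv vp ve]] := projection_isometry pp epq.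
have [w [ww wq we]] := projection_isometry pq erefl.
move: (\rank q) v vv vp ve w ww wq we => r v vv vp ve w ww wq we {epq}.
exists (w ^t* *m v).
have e : (w ^t* *m v) ^t* = v ^t* *m w by rewrite trmx_mul map_mxM /= trmxCK.
rewrite e; split.
- by rewrite mulmxA -(mulmxA _ w) ww mulmx1.
- by rewrite mulmxA -(mulmxA _ v) vv mulmx1.
- by rewrite -mulmxA ve.
by rewrite mulmxA -wq -(mulmxA _ w) ww mulmx1.
Qed.

Lemma mx_star_sum (I : finType) (F : I -> 'M[C]_n) :
  (\sum_i F i) ^t* = \sum_i (F i) ^t*.
Proof.
by apply: (big_morph (fun a : 'M[C]_n => a ^t*) (@mx_starD C n));
  rewrite trmx0 map_mx0.
Qed.

(** Each pair of projections of equal rank is joined by a partial isometry; in the sum of these all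
    cross terms vanish by orthogonality. *)
Lemma partial_isometry_sum (I : finType) (e e' : I -> 'M[C]_n) :
  (forall i, is_projection (e i)) -> (forall i, is_projection (e' i)) ->
  (forall i j, i != j -> e i *m e j = 0) ->
  (forall i j, i != j -> e' i *m e' j = 0) ->
  (forall i, \rank (e i) = \rank (e' i)) ->
  exists u, [/\ u ^t* *m u = \sum_i e i, u *m u ^t* = \sum_i e' i,
    u *m \sum_i e i = u & forall i, u *m e i = e' i *m u].
Proof.
move=> pe pe' oe oe' er.
have /choice[u uP] : forall i, exists u : 'M[C]_n,
    [/\ u ^t* *m u = e i, u *m u ^t* = e' i, u *m e i = u & e' i *m u = u].
  by move=> i; exact: partial_isometry.
have uS i : (u i) ^t* = e i *m (u i) ^t*.
  by have [_ _ h _] := uP i; rewrite -{1}h mx_starM (pe i).2.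
have uS' i : (u i) ^t* = (u i) ^t* *m e' i.
  by have [_ _ _ h] := uP i; rewrite -{1}h mx_starM (pe' i).2.
have ue i j : u i *m e j = if i == j then u i else 0.
  case: eqVneq => [<-|ij]; first by have [] := uP i.
  by have [_ _ <- _] := uP i; rewrite -mulmxA oe ?mulmx0.
have eu i j : e' j *m u i = if i == j then u i else 0.
  case: eqVneq => [<-|ij]; first by have [] := uP i.
  by have [_ _ _ <-] := uP i; rewrite mulmxA oe' ?mul0mx // eq_sym.
exists (\sum_i u i); split.
- rewrite mx_star_sum mulmx_suml; apply: eq_bigr => i _.
  rewrite mulmx_sumr (bigD1 i) //= big1 ?addr0 => [|j ji]; first by have [] := uP i.
  by rewrite uS' -mulmxA eu (negPf ji) mulmx0.
- rewrite mx_star_sum mulmx_suml; apply: eq_bigr => i _.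
  rewrite mulmx_sumr (bigD1 i) //= big1 ?addr0 => [|j ji]; first by have [] := uP i.
  by rewrite uS mulmxA ue eq_sym (negPf ji) mul0mx.
- rewrite mulmx_suml; apply: eq_bigr => i _.
  rewrite mulmx_sumr (bigD1 i) //= big1 ?addr0 => [|j ji]; first by have [] := uP i.
  by rewrite ue eq_sym (negPf ji).
move=> j; rewrite mulmx_suml mulmx_sumr; apply: eq_bigr => i _.
by rewrite ue eu.
Qed.

End Projections.

(** * Block structure read from the labels of indices *)

Section Labels.
Variable C : numClosedFieldType.
Implicit Types n : block_sizes.

Notation "''X_' n" := 'M[C]_(\sum_(i < 4) block_size n i)
  (at level 8, n at level 2, format "''X_' n").
Notation hom n n' := (star_hom (cycle_cstar C n) (cycle_cstar C n')).

Section Homs.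
Variables (n n' : block_sizes) (f : hom n n').
Implicit Types a b : 'X_n.

Lemma homM a b : f (a *m b) = f a *m f b :> 'X_n'.
Proof. exact: star_homM. Qed.

Lemma homS a : f (a ^t*) = (f a : 'X_n') ^t* :> 'X_n'.
Proof. exact: star_homS. Qed.

Lemma homD a b : f (a + b) = (f a : 'X_n') + f b :> 'X_n'.
Proof. exact: linearD. Qed.

Lemma homN a : f (- a) = - (f a : 'X_n') :> 'X_n'.
Proof. exact: linearN. Qed.

Lemma homZ c a : f (c *: a) = c *: (f a : 'X_n') :> 'X_n'.
Proof. exact: linearZ. Qed.

Lemma hom0 : f 0 = 0 :> 'X_n'.
Proof. exact: linear0. Qed.

Lemma hom_sum (I : finType) (P : pred I) (F : I -> 'X_n) :
  f (\sum_(i | P i) F i) = \sum_(i | P i) (f (F i) : 'X_n') :> 'X_n'.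
Proof. exact: linear_sum. Qed.

Lemma hom1l a : f 1%:M *m f a = f a :> 'X_n'.
Proof. by rewrite -homM mul1mx. Qed.

Lemma hom1r a : f a *m f 1%:M = f a :> 'X_n'.
Proof. by rewrite -homM mulmx1. Qed.

Lemma hom_projection a : is_projection a -> is_projection (f a : 'X_n').
Proof. exact: star_hom_projection. Qed.

Lemma hom_expand a :
  f a = \sum_x \sum_y a x y *: (f (delta_mx x y) : 'X_n') :> 'X_n'.
Proof.
rewrite [in LHS](matrix_sum_delta a) hom_sum; apply: eq_bigr => x _.
by rewrite hom_sum; apply: eq_bigr => y _; rewrite homZ.
Qed.

End Homs.

Section Composition.
Variables (n n' n'' : block_sizes) (g : hom n' n'') (f : hom n n').

Let comp_fun : {linear cycle_cstar C n -> cycle_cstar C n''} := g \o f.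

Fact hom_compM : {morph comp_fun : x y / smul x y}.
Proof. by move=> a b; rewrite /comp_fun /= !star_homM. Qed.

Fact hom_compS : {morph comp_fun : x / sstar x}.
Proof. by move=> a; rewrite /comp_fun /= !star_homS. Qed.

Definition hom_comp : hom n n'' := StarHom hom_compM hom_compS.

Lemma hom_compE a : hom_comp a = g (f a).
Proof. by []. Qed.

End Composition.

Definition lab n (x : 'I_(\sum_(i < 4) block_size n i)) : 'I_4 := tagnat.sig1 x.

Lemma lab_Rank n i (k : 'I_(n i)) : lab (@tagnat.Rank 4 n i k) = i.
Proof. exact: tagnat.Rank1K. Qed.

Definition base n i : 'I_(\sum_(i < 4) block_size n i) :=
  @tagnat.Rank 4 n i (Ordinal (block_size_gt0 n i)).

Lemma lab_base n i : lab (base n i) = i.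
Proof. exact: lab_Rank. Qed.

Lemma blockE n (a : cycle_cstar C n) i j k l :
  block a i j k l = a (@tagnat.Rank 4 n i k) (@tagnat.Rank 4 n j l).
Proof. by rewrite /block !mxE. Qed.

Lemma block_eq0 n (a : cycle_cstar C n) i j :
  block a i j = 0 <-> forall x y, lab x = i -> lab y = j -> a x y = 0.
Proof.
split=> [e x y ex ey|e].
  subst i j; move/matrixP/(_ (tagnat.sig2 x) (tagnat.sig2 y)): e.
  by rewrite blockE mxE !tagnat.sig2K.
by apply/matrixP => k l; rewrite blockE mxE e ?lab_Rank.
Qed.

Definition lmx n (u : 'I_4 -> C) : 'X_n :=
  \matrix_(x, y) (u (lab x) *+ (x == y)).

Lemma lmx_mull n m u (a : 'M[C]_(_, m)) x y : (lmx n u *m a) x y = u (lab x) * a x y.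
Proof.
rewrite mxE (bigD1 x) //= [X in _ + X]big1 => [|z zx].
  by rewrite mxE eqxx addr0.
by rewrite mxE eq_sym (negPf zx) mul0r.
Qed.

Lemma lmx_mulr n m u (a : 'M[C]_(m, _)) x y : (a *m lmx n u) x y = a x y * u (lab y).
Proof.
rewrite mxE (bigD1 y) //= [X in _ + X]big1 => [|z zy].
  by rewrite mxE eqxx addr0.
by rewrite mxE (negPf zy) mulr0.
Qed.

Lemma eq_lmx n u v : u =1 v -> lmx n u = lmx n v.
Proof. by move=> uv; apply/matrixP => x y; rewrite !mxE uv. Qed.

Lemma lmxM n u v : lmx n u *m lmx n v = lmx n (fun i => u i * v i).
Proof. by apply/matrixP => x y; rewrite lmx_mull !mxE -mulrnAr. Qed.

Lemma lmx_comm n u v : lmx n u *m lmx n v = lmx n v *m lmx n u.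
Proof. by rewrite !lmxM; apply: eq_lmx => i; rewrite mulrC. Qed.

Lemma lmx1 n : lmx n (fun=> 1) = 1%:M.
Proof. by apply/matrixP => x y; rewrite !mxE. Qed.

Lemma lmxD n u v : lmx n (fun i => u i + v i) = lmx n u + lmx n v.
Proof. by apply/matrixP => x y; rewrite !mxE mulrnDl. Qed.

Lemma lmxZ n c u : lmx n (fun i => c * u i) = c *: lmx n u.
Proof. by apply/matrixP => x y; rewrite !mxE mulrnAr. Qed.

Lemma lmxS n u : (forall i, (u i)^* = u i) -> (lmx n u) ^t* = lmx n u.
Proof.
move=> ru; apply/matrixP => x y; rewrite !mxE eq_sym.
by case: eqP => [->|_]; rewrite ?mulr1n ?mulr0n ?rmorph0.
Qed.

Lemma lmx_delta n u (x y : 'I_(\sum_(i < 4) block_size n i)) :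
  lmx n u *m delta_mx x y = u (lab x) *: delta_mx x y.
Proof.
apply/matrixP => z t; rewrite lmx_mull !mxE.
by case: eqP => [->|] //=; rewrite !mulr0.
Qed.

Lemma delta_lmx n u (x y : 'I_(\sum_(i < 4) block_size n i)) :
  delta_mx x y *m lmx n u = u (lab y) *: delta_mx x y.
Proof.
apply/matrixP => z t; rewrite lmx_mulr !mxE.
by case: (t =P y) => [->|]; rewrite ?andbF ?mulr0 ?mul0r //= mulrC.
Qed.

Lemma block_proj_lmx n i : block_proj C n i = lmx n (fun j => (j == i)%:R).
Proof.
apply: block_inj => u v; rewrite block_projE; apply/matrixP => k l.
rewrite blockE mxE lab_Rank.
have -> : (@tagnat.Rank 4 n u k == @tagnat.Rank 4 n v l) = (u == v) && (k == l :> nat).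
  by rewrite -val_eqE /= tagnat.eq_Rank.
case: eqVneq => [e|_] /=; last by rewrite mxE mulr0n.
subst v; case: eqP => [e|_]; last by rewrite mxE mul0rn.
by subst i; rewrite pid_mx_1 mxE.
Qed.

Lemma mxtrace_block_proj n (a : 'X_n) i :
  \tr (block (a : cycle_cstar C n) i i) = \tr (block_proj C n i *m a).
Proof.
rewrite [RHS]Defs.mxtrace_block (bigD1 i) //= [X in _ + X]big1 => [|j ji].
  rewrite addr0 mul_blockE (bigD1 i) //= [X in _ + X]big1 => [|j ji].
    by rewrite addr0 block_projE eqxx /= pid_mx_1 mul1mx.
  by rewrite block_projE eq_sym (negPf ji) mul0mx.
rewrite mul_blockE big1 ?mxtrace0 // => l _.
by rewrite block_projE (negPf ji) andbF mul0mx.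
Qed.

(* Blocks 0 and 1 form the side [true], blocks 2 and 3 the side [false]. The
   symmetry [G b] is 1 and -1 on the two blocks of side b and 0 elsewhere, so a
   matrix is block diagonal iff it commutes with [G true] and [G false]. *)
Definition top (i : 'I_4) : bool := (i < 2)%N.
Definition sgn (i : 'I_4) : C := (-1) ^+ odd i.
Definition G n (b : bool) : 'X_n := lmx n (fun i => if top i == b then sgn i else 0).
Definition P n (b : bool) : 'X_n := lmx n (fun i => (top i == b)%:R).

Lemma sgn_sq i : sgn i * sgn i = 1.
Proof. by rewrite /sgn -signr_addb addbb. Qed.

Lemma sgn_conj i : (sgn i)^* = sgn i.
Proof. by rewrite /sgn rmorphXn rmorphN1. Qed.

Lemma GS n b : (G n b) ^t* = G n b.
Proof. by apply: lmxS => i; case: eqP; rewrite ?sgn_conj ?rmorph0. Qed.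

Lemma GG n b : G n b *m G n b = P n b.
Proof. by rewrite lmxM; apply: eq_lmx => i; case: eqP; rewrite ?sgn_sq ?mul0r. Qed.

Lemma PG n b : P n b *m G n b = G n b.
Proof. by rewrite lmxM; apply: eq_lmx => i; case: eqP; rewrite ?mul1r ?mul0r. Qed.

Lemma GP n b : G n b *m P n b = G n b.
Proof. by rewrite lmxM; apply: eq_lmx => i; case: eqP; rewrite ?mulr1 ?mul0r. Qed.

Lemma PP n b : P n b *m P n b = P n b.
Proof. by rewrite lmxM; apply: eq_lmx => i; rewrite -natrM mulnb andbb. Qed.

Lemma P_sum n : P n true + P n false = 1%:M.
Proof.
by rewrite -lmxD -lmx1; apply: eq_lmx => i; case: (top i); rewrite ?addr0 ?add0r.
Qed.

Lemma PS n b : (P n b) ^t* = P n b.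
Proof. by apply: lmxS => i; rewrite rmorph_nat. Qed.

Lemma PGN n b : P n (~~ b) *m G n b = 0.
Proof.
rewrite lmxM; apply/matrixP => x y; rewrite !mxE.
by case: top b => [] [] /=; rewrite ?mul0r ?mulr0 mul0rn.
Qed.

Lemma PN n b : P n (~~ b) *m P n b = 0.
Proof. by rewrite -[P n b]GG mulmxA PGN mul0mx. Qed.

Definition labdiag n (a : 'X_n) := forall b, G n b *m a = a *m G n b.

Lemma labdiag_lmx n u : labdiag (lmx n u).
Proof. by move=> b; exact: lmx_comm. Qed.

Lemma labdiagM n (a b : 'X_n) : labdiag a -> labdiag b -> labdiag (a *m b).
Proof. by move=> da db s; rewrite mulmxA da -!mulmxA db. Qed.

Lemma labdiagD n (a b : 'X_n) : labdiag a -> labdiag b -> labdiag (a + b).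
Proof. by move=> da db s; rewrite mulmxDr mulmxDl da db. Qed.

Lemma labdiagB n (a b : 'X_n) : labdiag a -> labdiag b -> labdiag (a - b).
Proof. by move=> da db s; rewrite mulmxBr mulmxBl da db. Qed.

Lemma labdiagS n (a : 'X_n) : labdiag a -> labdiag (a ^t*).
Proof. by move=> da s; rewrite -[G n s]GS -!mx_starM da. Qed.

Lemma sgn_neq0 i : sgn i != 0.
Proof. by rewrite /sgn signr_eq0. Qed.

(** Side and sign are coordinates on the four blocks; this is why the two symmetries detect block
    diagonal matrices. *)
Lemma sgn_inj i j : top i = top j -> sgn i = sgn j -> i = j.
Proof.
move=> eij /eqP; rewrite /sgn (inj_eq (@signr_inj _)) => /eqP.
move: eij; rewrite /top => h1 h2; apply: val_inj.
by case: i j h1 h2 => [[|[|[|[|//]]]] ?] [[|[|[|[|//]]]] ?].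
Qed.

Lemma labdiagP n (a : 'X_n) :
  labdiag a <-> forall x y, lab x != lab y -> a x y = 0.
Proof.
split=> [da x y|da b]; last first.
  apply/matrixP => x y; rewrite lmx_mull lmx_mulr mulrC.
  by case: (eqVneq (lab x) (lab y)) => [->|/da ->] //; rewrite !mul0r.
apply: contraNeq => z0.
(* A nonzero entry at [(x, y)] forces equal eigenvalues of [G] at [x] and [y]. On the side of [x]
   the eigenvalue is not 0, so [y] shares both side and sign. *)
have /matrixP/(_ x y) := da (top (lab x)).
rewrite lmx_mull lmx_mulr eqxx mulrC => /(mulfI z0).
case: eqP => [e /(sgn_inj (esym e)) -> //|_ /eqP].
by rewrite (negPf (sgn_neq0 _)).
Qed.

End Labels.

Arguments sgn {C} i.
Arguments G {C} n b.
Arguments P {C} n b.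

(** * Signs of a homomorphism and its trace invariants *)

Section TypedHoms.
Variable C : numClosedFieldType.
Implicit Types n : block_sizes.

Notation "''X_' n" := 'M[C]_(\sum_(i < 4) block_size n i)
  (at level 8, n at level 2, format "''X_' n").
Notation hom n n' := (star_hom (cycle_cstar C n) (cycle_cstar C n')).

(* A star homomorphism has the form a |-> a (x) 1 up to equivalence, and X b is
   the symmetry of the multiplicity space whose -1 part collects the summands
   that exchange the two blocks of side b. When X true and X false commute, they
   split f into multiplicity one rigid embeddings. *)
Record pretyped n n' (f : hom n n') (X : bool -> 'X_n') : Prop := Pretyped {
  pt_star : forall b, (X b) ^t* = X b;
  pt_sq : forall b, X b *m X b = f 1%:M;
  pt_unit : forall b, X b *m f 1%:M = X b;
  pt_comm : forall b (a : 'X_n), X b *m f a = f a *m X b;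
  pt_G : forall b (a : 'X_n), G n' b *m f a = X b *m f (G n b *m a)
}.

Definition typed n n' (f : hom n n') : Prop :=
  exists X : bool -> 'X_n',
    pretyped f X /\ X true *m X false = X false *m X true.

Section Pretyped.
Variables (n n' : block_sizes) (f : hom n n') (X : bool -> 'X_n').
Hypothesis fX : pretyped f X.
Implicit Types (a : 'X_n) (b : bool).

Lemma pt_Gr b a : f a *m G n' b = f (a *m G n b) *m X b.
Proof.
rewrite -[a]trmxCK homS -[G n' b]GS -mx_starM (pt_G fX) mx_starM (pt_star fX).
by rewrite -homS mx_starM GS.
Qed.

(** [P] is the square of [G], so the sign enters twice and disappears. *)
Lemma pt_P b a : P n' b *m f a = f (P n b *m a).
Proof.
rewrite -GG -mulmxA (pt_G fX) (pt_comm fX) mulmxA (pt_G fX) (pt_comm fX).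
by rewrite -mulmxA (pt_sq fX) hom1r mulmxA GG.
Qed.

Lemma pt_labdiag a : labdiag a -> labdiag (f a).
Proof. by move=> da b; rewrite (pt_G fX) da (pt_comm fX) pt_Gr. Qed.

(** [X b] is invertible in the corner of [f 1], so it cancels from the commutation relation. *)
Lemma pt_labdiag_inj a : injective f -> labdiag (f a) -> labdiag a.
Proof.
move=> fi da b; apply: fi.
have := da b; rewrite (pt_G fX) pt_Gr -(pt_comm fX) => /(congr1 (mulmx (X b))).
by rewrite !mulmxA (pt_sq fX) !hom1l.
Qed.

(** For [Z] commuting with the range, [tr (Z f a)] is a tracial functional of [a] on a full matrix
    algebra, hence a multiple of the trace, fixed by its value at one minimal projection. *)
Lemma comm_trace (Z : 'X_n') p : (forall a, Z *m f a = f a *m Z) ->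
  forall a, \tr (Z *m f a) = \tr a * \tr (Z *m f (delta_mx p p)).
Proof.
move=> Zf a; rewrite hom_expand mulmx_sumr raddf_sum /= mulr_suml.
apply: eq_bigr => x _; rewrite mulmx_sumr raddf_sum /= (bigD1 x) //=.
rewrite [X in _ + X]big1 => [|y yx]; last first.
  rewrite -scalemxAr mxtraceZ -(mul_delta_mx x x y) homM mulmxA.
  by rewrite mxtrace_mulC Zf mulmxA -homM mul_delta_mx_0 // hom0 mul0mx mxtrace0 mulr0.
rewrite addr0 -scalemxAr mxtraceZ; congr (_ * _).
rewrite -(mul_delta_mx p x x) homM mulmxA mxtrace_mulC mulmxA -Zf.
by rewrite -mulmxA -homM mul_delta_mx.
Qed.

End Pretyped.

Lemma pt_comp n n' n'' (g : hom n' n'') (f : hom n n') Y X :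
  pretyped g Y -> pretyped f X ->
  pretyped (hom_comp g f) (fun b => Y b *m g (X b)).
Proof.
move=> gY fX; split=> [b|b|b|b a|b a]; rewrite ?hom_compE.
- by rewrite mx_starM -homS (pt_star gY) (pt_star fX) (pt_comm gY).
- rewrite mulmxA -(mulmxA (Y b)) -(pt_comm gY) mulmxA (pt_sq gY) -mulmxA -homM.
  by rewrite (pt_sq fX) hom1l.
- by rewrite -mulmxA -homM (pt_unit fX).
- by rewrite -mulmxA -homM (pt_comm fX) homM !mulmxA (pt_comm gY).
by rewrite (pt_G gY) (pt_G fX) (homM g) mulmxA.
Qed.

Lemma typed_comp n n' n'' (g : hom n' n'') (f : hom n n') :
  typed g -> typed f -> typed (hom_comp g f).
Proof.
move=> [Y [gY cY]] [X [fX cX]]; exists (fun b => Y b *m g (X b)).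
split; first exact: pt_comp.
rewrite !mulmxA -(mulmxA (Y true)) -(mulmxA (Y false)) -!(pt_comm gY).
by rewrite !mulmxA cY -!mulmxA -!homM cX.
Qed.

Lemma eq_typed n n' (f g : hom n n') : f =1 g -> typed f -> typed g.
Proof.
move=> fg [X [[h1 h2 h3 h4 h5] cX]]; exists X; split=> //.
by split=> // *; rewrite -!fg.
Qed.

Definition Q n i : 'X_n := lmx n (fun j => (j == i)%:R).

Lemma lmx_sumQ n (u : 'I_4 -> C) : lmx n u = \sum_i u i *: Q n i.
Proof.
apply/matrixP => x y; rewrite summxE [RHS](bigD1 (lab x)) //= [X in _ + X]big1 ?addr0.
  by rewrite !mxE eqxx mulrnAr mulr1.
by move=> i /negPf ix; rewrite !mxE eq_sym ix mul0rn mulr0.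
Qed.

(** The block projections are the spectral projections of [G] on its side. *)
Lemma QE n j : Q n j = 2^-1 *: (P n (top j) + sgn j *: G n (top j)).
Proof.
rewrite -lmxZ -lmxD -lmxZ; apply: eq_lmx => i.
have [->|ij] := eqVneq i j; first by rewrite !eqxx sgn_sq -mulr2n mulVf ?pnatr_eq0.
case: eqP => [e|_]; last by rewrite mulr0 addr0 mulr0.
suff -> : sgn j * sgn i = -1 :> C by rewrite subrr mulr0.
have : sgn i != sgn j :> C by apply: contra ij => /eqP /(sgn_inj e) ->.
rewrite /sgn -signr_addb; case: (odd i) (odd j) => [] [] //=;
  by rewrite ?eqxx ?expr1.
Qed.

Lemma QS n j : (Q n j) ^t* = Q n j.
Proof. by apply: lmxS => i; rewrite rmorph_nat. Qed.

Lemma QQ n i j : Q n i *m Q n j = if i == j then Q n i else 0.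
Proof.
rewrite lmxM; case: eqP => [<-|/eqP ij].
  by apply: eq_lmx => k; rewrite -natrM mulnb andbb.
apply/matrixP => x y; rewrite !mxE.
by case: eqP => [->|]; rewrite ?(negPf ij) ?mulr0 ?mul0r mul0rn.
Qed.

Lemma Q_sum n : \sum_i Q n i = 1%:M.
Proof. by rewrite -lmx1 lmx_sumQ; apply: eq_bigr => i _; rewrite scale1r. Qed.

(** On block diagonal projections this is the class in K_0 with complex coefficients
    ([cls_projection]), but it is linear and makes sense for every matrix. *)
Definition cls n (a : 'X_n) : 'rV[C]_4 := \row_j \tr (Q n j *m a).

Lemma mxtrace_lmx n u (a : 'X_n) : \tr (lmx n u *m a) = \sum_i cls a 0 i * u i.
Proof.
rewrite lmx_sumQ mulmx_suml raddf_sum; apply: eq_bigr => i _.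
by rewrite /= -scalemxAl mxtraceZ mxE mulrC.
Qed.

Lemma mxtrace_delta m (x y : 'I_m) : \tr (delta_mx x y : 'M[C]_m) = (x == y)%:R.
Proof.
rewrite /mxtrace (bigD1 x) //= big1 ?addr0 => [|z zx]; rewrite mxE ?eqxx //.
by rewrite (negPf zx).
Qed.

Lemma cls_delta n x : cls (delta_mx x x : 'X_n) = delta_mx 0 (lab x).
Proof.
apply/rowP => j; rewrite !mxE /= lmx_delta mxtraceZ.
by rewrite mxtrace_delta eqxx mulr1 eq_sym.
Qed.

(* inv_h expresses the map on H_1 by a trace formula, hence for every hom. *)
Record inv n n' (f : hom n n') (K : 'M[int]_4) (h : int) : Prop := Inv {
  inv_cls : forall a : 'X_n, cls (f a) = cls a *m map_mx intr K;
  inv_h : forall a b : 'X_n,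
    \tr (G n' true *m f a *m G n' false *m f b) =
      h%:~R * \tr (G n true *m a *m G n false *m b)
}.

Lemma inv_comp n n' n'' (g : hom n' n'') (f : hom n n') K K' h h' :
  inv f K h -> inv g K' h' -> inv (hom_comp g f) (K *m K') (h * h').
Proof.
move=> [fK fh] [gK gh]; split=> [a|a b]; rewrite ?hom_compE.
  by rewrite map_mxM /= gK fK mulmxA.
by rewrite gh fh intrM mulrCA mulrA.
Qed.

Lemma eq_inv n n' (f g : hom n n') K h : f =1 g -> inv f K h -> inv g K h.
Proof. by move=> fg [h1 h2]; split=> *; rewrite -!fg ?h1 ?h2. Qed.

Lemma inv_uniq n n' (f : hom n n') K K' h h' :
  inv f K h -> inv f K' h' -> K = K' /\ h = h'.
Proof.
move=> [fK fh] [fK' fh']; split.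
  apply/matrixP => i j.
  have := fK (delta_mx (base n i) (base n i)).
  rewrite fK' !cls_delta lab_base => /rowP/(_ j).
  rewrite -!rowE !mxE => e; apply: esym.
  by apply/eqP; rewrite -(eqr_int C); apply/eqP.
(* A matrix unit between blocks 0 and 2 and its adjoint: both signs are 1, so the trace multiplied
   by h is 1. *)
pose i0 : 'I_4 := inord 0; pose i2 : 'I_4 := inord 2.
have := fh (delta_mx (base n i0) (base n i2)) (delta_mx (base n i2) (base n i0)).
rewrite fh' !lmx_delta !lab_base -!scalemxAl delta_lmx !lab_base.
rewrite -!scalemxAl !mul_delta_mx !mxtraceZ mxtrace_delta eqxx.
rewrite /top /sgn !inordK //= !mulr1 => e.
by apply/eqP; rewrite eq_sym -(eqr_int C); apply/eqP.
Qed.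

(** By [QE] the trace of [f a] in block [j] is a sum of an unsigned term and a term with [X], and
    [comm_trace] evaluates both. For H_1 the two [G] are moved through [f] and leave
    [X true X false]. *)
Lemma pretyped_inv n n' (f : hom n n') X p (K : 'M[int]_4) (h : int) :
  pretyped f X ->
  (forall i j, (K i j)%:~R = if top i == top j
     then 2^-1 * (\tr (f (delta_mx p p)) +
       sgn i * sgn j * \tr (X (top i) *m f (delta_mx p p))) else 0) ->
  h%:~R = \tr (X true *m X false *m f (delta_mx p p)) ->
  inv f K h.
Proof.
move=> fX eK eh; split=> [a|a b].
  apply/rowP => j; rewrite [LHS]mxE QE -scalemxAl mulmxDl -scalemxAl.
  rewrite (pt_P fX) (pt_G fX) mxtraceZ mxtraceD mxtraceZ.
  have T0 c : \tr (f c) = \tr c * \tr (f (delta_mx p p)).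
    have := @comm_trace _ _ f 1%:M p _ c; rewrite !mul1mx; apply=> e.
    by rewrite mul1mx mulmx1.
  rewrite T0 (comm_trace p (pt_comm fX (top j))).
  rewrite !mxtrace_lmx !mxE !mulr_suml.
  rewrite mulr_sumr -big_split mulr_sumr; apply: eq_bigr => i _ /=.
  rewrite !mxE eK; case: (top i =P top j) => [->|_]; last by rewrite !(mulr0, mul0r, addr0).
  rewrite (_ : true%:R = 1 :> C) // mulr1; move: (\tr _) (\tr _) (\tr _).
  by move=> z1 z2 z3; ring.
have XXf c : X true *m X false *m f c = f c *m (X true *m X false).
  by rewrite -mulmxA (pt_comm fX) mulmxA (pt_comm fX) mulmxA.
rewrite (pt_G fX) -[X in \tr X]mulmxA (pt_G fX) -mulmxA (mulmxA (f _)).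
rewrite -(pt_comm fX) -(mulmxA (X false)) mulmxA -homM (comm_trace p XXf) -eh.
by rewrite mulrC !mulmxA.
Qed.

End TypedHoms.

Arguments Q {C} n i.

(** * The four types as pairs of flips *)

Section FlipTypes.
Variable C : numClosedFieldType.
Implicit Types (t : bool * bool) (N : bool * bool -> nat).

Definition theta t : {perm 'I_4} :=
  ((if t.1 then sym12 else 1) * (if t.2 then sym34 else 1))%g.

Definition flips (s : {perm 'I_4}) : bool * bool :=
  (s (inord 0) != inord 0, s (inord 2) != inord 2).

Definition flip_on (b : bool) t : bool := if b then t.1 else t.2.

Arguments flips : simpl never.

(** [1 - i] exchanges blocks 0 and 1, and [5 - i] exchanges blocks 2 and 3. *)
Lemma theta_val t i :
  theta t i = (if flip_on (top i) t then if top i then 1 - i else 5 - i else i)%N :> nat.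
Proof.
have E (j k l : 'I_4) : (tperm j k l : nat) =
    if l == j :> nat then k : nat else if l == k :> nat then j : nat else l.
  rewrite !val_eqE; case: tpermP => [->|->|/eqP/negPf-> /eqP/negPf->] //.
    by rewrite eqxx.
  by rewrite eqxx; case: eqP => [->|].
rewrite /theta permM; case: t => [[] []] /=; rewrite ?perm1 ?E ?inordK //;
  case: i => [[|[|[|[|//]]]] ?] //=.
Qed.

Lemma top_theta t i : top (theta t i) = top i.
Proof.
rewrite /top theta_val.
by case: t i => [[] []] [[|[|[|[|//]]]] ?].
Qed.

Lemma preserves_theta t : preserves_sides (theta t).
Proof. exact: top_theta. Qed.

Lemma sgn_theta t i : sgn (theta t i) = (-1) ^+ flip_on (top i) t * sgn i :> C.
Proof.
rewrite /sgn theta_val; case: t i => [[] []] [[|[|[|[|//]]]] ?] /=;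
  by rewrite ?expr0 ?expr1 ?mulr1 ?mul1r ?mulN1r ?opprK.
Qed.

Lemma flipsK t : flips (theta t) = t.
Proof.
rewrite /flips -!val_eqE /= !theta_val /= /top !inordK //.
by case: t => [[] []].
Qed.

(** A side has two blocks, so the image of one of them decides that of the other. *)
Lemma thetaK s : preserves_sides s -> theta (flips s) = s.
Proof.
move=> ps; apply/permP => i; apply: val_inj; rewrite /= theta_val /top /flips.
rewrite -!val_eqE /= !inordK //.
have e0 := ps (inord 0); have e1 := ps (inord 1).
have e2 := ps (inord 2); have e3 := ps (inord 3).
rewrite !inordK // in e0 e1 e2 e3.
have d01 : (s (inord 0) != s (inord 1) :> nat) by rewrite val_eqE (inj_eq perm_inj) -val_eqE /= !inordK.
have d23 : (s (inord 2) != s (inord 3) :> nat) by rewrite val_eqE (inj_eq perm_inj) -val_eqE /= !inordK.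
have l k : (s k < 4)%N by [].
case: i => [[|[|[|[|//]]]] hi] /=.
- rewrite (_ : Ordinal hi = inord 0); last by apply: val_inj; rewrite /= inordK.
  by move: e0; case: (s _ : nat) => [|[|]].
- rewrite (_ : Ordinal hi = inord 1); last by apply: val_inj; rewrite /= inordK.
  by move: e0 e1 d01; case: (s _ : nat) => [|[|]] //; case: (s _ : nat) => [|[|]].
- rewrite (_ : Ordinal hi = inord 2); last by apply: val_inj; rewrite /= inordK.
  by move: (l (inord 2)) e2; case: (s _ : nat) => [|[|[|[|]]]].
rewrite (_ : Ordinal hi = inord 3); last by apply: val_inj; rewrite /= inordK.
move: (l (inord 2)) (l (inord 3)) e2 e3 d23.
by case: (s _ : nat) => [|[|[|[|]]]] //; case: (s _ : nat) => [|[|[|[|]]]].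
Qed.

(** Writes the indicator of equality as a polynomial in the signs, so that counting summands becomes
    taking signed traces. *)
Lemma eq_sgn (i j : 'I_4) :
  (i == j)%:R = (if top i == top j then 2^-1 * (1 + sgn i * sgn j) else 0) :> C.
Proof.
case: (eqVneq i j) => [->|ij]; first by rewrite eqxx sgn_sq -mulr2n mulVf ?pnatr_eq0.
case: eqP => [e|//]; suff -> : sgn i * sgn j = -1 :> C by rewrite subrr mulr0.
have : sgn i != sgn j :> C by apply: contra ij => /eqP /(sgn_inj e) ->.
rewrite /sgn -signr_addb; case: (odd i) (odd j) => [] [] //=;
  by rewrite ?eqxx ?expr1.
Qed.

(** [Kmx N] and [Hn N] are the maps on K_0 and H_1 of a rigid embedding with [N t] summands of type
    [theta t]. *)
Definition Kmx N : 'M[int]_4 := \matrix_(i, j) \sum_t (N t)%:Z * (theta t i == j)%:R.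
Definition Hn N : int := \sum_t (N t)%:Z * (-1) ^+ (t.1 (+) t.2).

Lemma sum_types (A : nmodType) (F : bool * bool -> A) :
  \sum_t F t = F (false, false) + F (false, true) + F (true, false) + F (true, true).
Proof.
rewrite (eq_bigr (fun t => F (t.1, t.2))) => [|[] //].
rewrite -(pair_bigA _ (fun x y => F (x, y))) /= !big_bool /= addrC.
by rewrite (addrC (F (false, true))) (addrC (F (true, true))) addrA.
Qed.

Lemma Kmx_intr N i j : (Kmx N i j)%:~R = (if top i == top j then 2^-1 *
  (\sum_t (N t)%:R + sgn i * sgn j * \sum_t (N t)%:R * (-1) ^+ flip_on (top i) t) else 0) :> C.
Proof.
rewrite mxE rmorph_sum /= mulr_sumr -big_split mulr_sumr /=.
transitivity (\sum_t (if top i == top j then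
    2^-1 * ((N t)%:R + sgn i * sgn j * ((N t)%:R * (-1) ^+ flip_on (top i) t)) else 0 : C)).
  apply: eq_bigr => t _; rewrite intrM !rmorph_nat.
  rewrite -[theta t i == j]/(theta t i == j) eq_sgn top_theta sgn_theta.
  case: ifP => _; last by rewrite mulr0.
  by rewrite -pmulrn; ring.
by case: ifP => _ //; rewrite big1.
Qed.

Lemma Hn_intr N : (Hn N)%:~R = \sum_t (N t)%:R * (-1) ^+ (t.1 (+) t.2) :> C.
Proof.
rewrite rmorph_sum; apply: eq_bigr => t _ /=.
by rewrite intrM rmorphXn rmorphN1.
Qed.

End FlipTypes.

(** * Invariants of rigid embeddings *)

Section RigidHoms.
Variable C : numClosedFieldType.
Implicit Types n : block_sizes.

Notation "''X_' n" := 'M[C]_(\sum_(i < 4) block_size n i)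
  (at level 8, n at level 2, format "''X_' n").
Notation hom n n' := (star_hom (cycle_cstar C n) (cycle_cstar C n')).

Lemma is_projection_delta m (x : 'I_m) : is_projection (delta_mx x x : 'M[C]_m).
Proof. by split; rewrite ?mul_delta_mx // trmx_delta map_delta_mx. Qed.

Lemma labdiag_cycle_alg n (a : 'X_n) : labdiag a -> cycle_alg (a : cycle_cstar C n).
Proof.
move=> /labdiagP da i j; case: (eqVneq i j) => // ij _.
by apply/block_eq0 => x y ex ey; apply: da; rewrite ex ey.
Qed.

(** Off the diagonal A has entries only from side {0,1} to side {2,3}, and the adjoint reverses this
    direction. *)
Lemma cycle_alg_labdiag n (a : 'X_n) :
  cycle_alg (a : cycle_cstar C n) -> cycle_alg (a ^t* : cycle_cstar C n) -> labdiag a.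
Proof.
move=> ca cas; apply/labdiagP => x y xy.
have [/andP[tx ty]|ne] := boolP ((lab x < 2)%N && (2 <= lab y)%N); last first.
  have /block_eq0 -> // : block (a : cycle_cstar C n) (lab x) (lab y) = 0.
  by apply: ca; rewrite negb_or xy.
have /block_eq0/(_ y x erefl erefl) :
    block (a ^t* : cycle_cstar C n) (lab y) (lab x) = 0.
  by apply: cas; rewrite eq_sym negb_or xy /= negb_and -!leqNgt (leq_trans _ ty).
by rewrite !mxE => /eqP; rewrite conjC_eq0 => /eqP.
Qed.

(** The hypotheses say that the four traces are the Fourier coefficients of [N] over the group of
    flips. *)
Lemma pretyped_counts n n' (f : hom n n') X p (N : bool * bool -> nat) :
  pretyped f X ->
  \tr (f (delta_mx p p)) = \sum_t (N t)%:R ->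
  (forall b, \tr (X b *m f (delta_mx p p)) = \sum_t (N t)%:R * (-1) ^+ flip_on b t) ->
  \tr (X true *m X false *m f (delta_mx p p)) = \sum_t (N t)%:R * (-1) ^+ (t.1 (+) t.2) ->
  inv f (Kmx N) (Hn N).
Proof.
move=> fX e eb eh; apply: (pretyped_inv (p := p) fX); last by rewrite Hn_intr.
by move=> i j; rewrite Kmx_intr e eb.
Qed.

Section OfType.
Variables (n n' : block_sizes) (s : {perm 'I_4}) (f : hom n n').
Hypothesis fs : rigid_of_type s f.

Lemma rigid_type_Q i : Q n' (s i) *m f (Q n i) = f (Q n i).
Proof.
have c1 : cycle_alg (1%:M : cycle_cstar C n).
  by apply: labdiag_cycle_alg => b; rewrite mulmx1 mul1mx.
have [a _] := rigid_block fs i i c1.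
rewrite !block_proj_lmx -!/(Q _ _) mulmx1 QQ eqxx => ->.
by rewrite !mulmxA QQ eqxx.
Qed.

(** On a single summand the sign is a scalar: -1 if its type exchanges the blocks of side [b], and 1
    otherwise. *)
Lemma rigid_type_G b (a : 'X_n) :
  G n' b *m f a = (-1) ^+ flip_on b (flips s) *: f (G n b *m a) :> 'X_n'.
Proof.
have Qs i : (G n' b : 'X_n') *m Q n' (s i) = (-1) ^+ flip_on b (flips s) *:
    ((if top i == b then sgn i else 0) *: Q n' (s i)).
  have ts := rigid_sides fs.
  rewrite [G _ _ *m _]lmxM -!lmxZ; apply: eq_lmx => j.
  case: (j =P s i) => [->|]; last by rewrite !mulr0.
  rewrite !mulr1 -(thetaK ts) top_theta sgn_theta; case: eqP => [->|]; last by rewrite mulr0.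
  by rewrite flipsK.
rewrite -[a in LHS]mul1mx -Q_sum mulmx_suml hom_sum mulmx_sumr.
rewrite [G n b]lmx_sumQ mulmx_suml hom_sum scaler_sumr; apply: eq_bigr => i _.
rewrite homM -scalemxAl homZ homM -[in LHS]rigid_type_Q.
rewrite 2!mulmxA Qs.
by rewrite -!scalemxAl rigid_type_Q.
Qed.

End OfType.

Section Rigid.
Variables (n n' : block_sizes) (phi : rigid_embedding C n n').

Definition counts (t : bool * bool) : nat := #|[pred s | flips (rigid_type phi s) == t]|.

(** Its value at [1%:M] is the sign [X b] of the embedding. *)
Definition type_sign b (a : 'X_n) : 'X_n' :=
  \sum_s (-1) ^+ flip_on b (flips (rigid_type phi s)) *: (rigid_part phi s a : 'X_n').

Lemma rigid_sumM (u v : 'I_(rigid_num phi) -> C) (a b : 'X_n) :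
  (\sum_s u s *: (rigid_part phi s a : 'X_n')) *m
  (\sum_s v s *: (rigid_part phi s b : 'X_n')) =
  \sum_s (u s * v s) *: (rigid_part phi s (a *m b) : 'X_n').
Proof.
rewrite mulmx_suml; apply: eq_bigr => s _.
rewrite mulmx_sumr (bigD1 s) //= [X in _ + X]big1 ?addr0 => [|t ts].
  by rewrite -scalemxAl -scalemxAr scalerA -homM.
by rewrite -scalemxAl -scalemxAr rigid_orth ?scaler0 // eq_sym.
Qed.

Lemma rigid_homE (a : 'X_n) :
  rigid_hom phi a = \sum_s (1 : C) *: (rigid_part phi s a : 'X_n') :> 'X_n'.
Proof. by apply: eq_bigr => s _; rewrite scale1r. Qed.

Lemma type_signM b (a c : 'X_n) : type_sign b a *m rigid_hom phi c = type_sign b (a *m c).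
Proof. by rewrite rigid_homE rigid_sumM; apply: eq_bigr => s _; rewrite mulr1. Qed.

Lemma rigid_pretyped : pretyped (rigid_hom phi) (fun b => type_sign b 1%:M).
Proof.
split=> [b|b|b|b a|b a].
- rewrite mx_star_sum; apply: eq_bigr => s _.
  by rewrite mx_starZ -homS trmx1 map_mx1 rmorphXn rmorphN1.
- rewrite rigid_sumM rigid_homE; apply: eq_bigr => s _.
  by rewrite mulmx1 -signr_addb addbb.
- by rewrite type_signM mulmx1.
- rewrite type_signM rigid_homE rigid_sumM; apply: eq_bigr => s _.
  by rewrite mulmx1 mul1mx mul1r.
rewrite type_signM mul1mx rigid_homE mulmx_sumr; apply: eq_bigr => s _.
by rewrite scale1r (rigid_type_G (rigid_partP s)).
Qed.

Lemma rigid_typed : typed (rigid_hom phi).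
Proof.
exists (fun b => type_sign b 1%:M); split; first exact: rigid_pretyped.
by rewrite !rigid_sumM; apply: eq_bigr => s _; rewrite mulrC.
Qed.

Lemma sum_counts (g : bool * bool -> C) :
  \sum_s g (flips (rigid_type phi s)) = \sum_t (counts t)%:R * g t.
Proof.
rewrite (partition_big (fun s => flips (rigid_type phi s)) xpredT) //=.
apply: eq_bigr => t _; rewrite /counts -sum1_card natr_sum mulr_suml.
by apply: eq_bigr => s /eqP ->; rewrite mul1r.
Qed.

Lemma rigid_inv_counts : inv (rigid_hom phi) (Kmx counts) (Hn counts).
Proof.
pose p := base n (inord 0).
have t1 s : \tr (rigid_part phi s (delta_mx p p) : 'X_n') = 1.
  have [idem _] := hom_projection (rigid_part phi s) (is_projection_delta p).
  have m1 := rigid_mult1 (rigid_partP s) (is_projection_delta p) (mxrank_delta C p p).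
  by rewrite (mxtrace_idem idem) m1.
apply: (pretyped_counts (p := p) rigid_pretyped).
- rewrite rigid_homE raddf_sum /= -[RHS](eq_bigr _ (fun t _ => mulr1 _)).
  by rewrite -(sum_counts (fun=> 1)); apply: eq_bigr => s _; rewrite scale1r t1.
- move=> b; rewrite type_signM mul1mx raddf_sum /= -(sum_counts (fun t => (-1) ^+ flip_on b t)).
  by apply: eq_bigr => s _; rewrite mxtraceZ t1 mulr1.
rewrite rigid_sumM rigid_homE rigid_sumM raddf_sum /=.
rewrite -(sum_counts (fun t => (-1) ^+ (t.1 (+) t.2))).
by apply: eq_bigr => s _; rewrite mxtraceZ !mul1mx t1 !mulr1 -signr_addb.
Qed.

Lemma rigid_K0mx_counts : rigid_K0mx phi = Kmx counts.
Proof.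
apply/matrixP => i j; rewrite rigid_K0mxE mxE; apply/eqP; rewrite -(eqr_int C).
rewrite rmorph_sum /=.
under eq_bigr => t _ do rewrite intrM rmorph_nat.
rewrite -(sum_counts (fun t => (theta t i == j)%:R)).
rewrite -sum1_card -pmulrn natr_sum big_mkcond /=.
apply/eqP; apply: eq_bigr => s _; rewrite inE thetaK; last exact: rigid_sides (rigid_partP s).
by case: eqP.
Qed.

Lemma rigid_H1_counts : rigid_H1 phi = Hn counts.
Proof.
apply/eqP; rewrite -(eqr_int C) Hn_intr -(sum_counts (fun t => (-1) ^+ (t.1 (+) t.2))).
have inj t t' : (theta t == theta t') = (t == t') by rewrite (can_eq flipsK).
have t00 : 1%g = theta (false, false) by rewrite /theta mulg1.
have t11 : (sym12 * sym34)%g = theta (true, true) by [].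
have t10 : sym12 = theta (true, false) by rewrite /theta mulg1.
have t01 : sym34 = theta (false, true) by rewrite /theta mul1g.
rewrite /rigid_H1 intrB -!pmulrn -!sum1_card !natr_sum big_mkcond.
rewrite [X in _ - X]big_mkcond -sumrB; apply/eqP; apply: eq_bigr => s _.
rewrite !inE -(thetaK (rigid_sides (rigid_partP s))) t11 t00 t10 t01 !inj. rewrite ?flipsK.
by case: (flips (rigid_type phi s)) => [[] []]; rewrite /= ?subr0 ?sub0r ?expr0 ?expr1. 
Qed.

(** Identifies the maps of the statement, defined by ranks and by counting types, with the trace
    invariants available for every homomorphism. *)
Lemma rigid_inv : inv (rigid_hom phi) (rigid_K0mx phi) (rigid_H1 phi).
Proof. by rewrite rigid_K0mx_counts rigid_H1_counts; exact: rigid_inv_counts. Qed.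

End Rigid.
End RigidHoms.

(** * Splitting a typed homomorphism by type *)

Section Realization.
Variable C : numClosedFieldType.
Implicit Types n : block_sizes.
Implicit Types t : bool * bool.

Notation "''X_' n" := 'M[C]_(\sum_(i < 4) block_size n i)
  (at level 8, n at level 2, format "''X_' n").
Notation hom n n' := (star_hom (cycle_cstar C n) (cycle_cstar C n')).

Section TypeProjections.
Variables (n n' : block_sizes) (f : hom n n') (X : bool -> 'X_n').
Hypotheses (fX : pretyped f X) (cX : X true *m X false = X false *m X true).

(** Spectral projection of [X b] in the corner of [f 1]; [s = true] belongs to the eigenvalue -1. *)
Definition half_proj b (s : bool) : 'X_n' := 2^-1 *: (f 1%:M + (-1) ^+ s *: X b).

Lemma half_projX b s : X b *m half_proj b s = (-1) ^+ s *: half_proj b s.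
Proof.
rewrite -scalemxAr mulmxDr -scalemxAr (pt_sq fX) (pt_unit fX).
rewrite [RHS]scalerA mulrC -[RHS]scalerA; congr (_ *: _).
by rewrite scalerDr scalerA -signr_addb addbb scale1r addrC.
Qed.

Lemma half_proj_comm b s (a : 'X_n) : half_proj b s *m f a = f a *m half_proj b s.
Proof.
rewrite -scalemxAl -scalemxAr mulmxDl mulmxDr -scalemxAl -scalemxAr (pt_comm fX).
by rewrite hom1l hom1r.
Qed.

Lemma half_proj1 b s : half_proj b s *m f 1%:M = half_proj b s.
Proof. by rewrite -scalemxAl mulmxDl hom1l -scalemxAl (pt_unit fX). Qed.

Lemma half_projM b s s' :
  half_proj b s *m half_proj b s' = if s == s' then half_proj b s else 0.
Proof.
rewrite {1}/half_proj -scalemxAl mulmxDl -scalemxAl half_projX.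
rewrite -half_proj_comm half_proj1 scalerA -signr_addb -[X in X + _]scale1r -scalerDl scalerA.
case: eqVneq => [->|ss].
  by rewrite addbb -mulr2n mulVf ?pnatr_eq0 // scale1r.
have -> : s (+) s' by move: ss; case: s s' => [] [].
by rewrite addrN mulr0 scale0r.
Qed.

Lemma half_projS b s : (half_proj b s) ^t* = half_proj b s.
Proof.
rewrite mx_starZ mx_starD mx_starZ (pt_star fX) -homS trmx1 map_mx1.
by rewrite rmorphXn rmorphN1 fmorphV rmorph_nat.
Qed.

Lemma half_proj_sum b : half_proj b true + half_proj b false = f 1%:M.
Proof.
rewrite -scalerDr addrACA -scalerDl expr1 expr0 addNr scale0r addr0 -mulr2n.
by rewrite -scaler_nat scalerA mulVf ?pnatr_eq0 // scale1r.
Qed.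

Lemma half_proj_swap s s' :
  half_proj true s *m half_proj false s' = half_proj false s' *m half_proj true s.
Proof.
rewrite -!scalemxAl -!scalemxAr !scalerA [in RHS]mulrC; congr (_ *: _).
rewrite !mulmxDl !mulmxDr -!scalemxAl -!scalemxAr cX !(pt_comm fX).
by rewrite scalerA mulrC -scalerA -!addrA; congr (_ + _); rewrite addrCA.
Qed.

Definition type_proj t := half_proj true t.1 *m half_proj false t.2.

Lemma type_projM t t' :
  type_proj t *m type_proj t' = if t == t' then type_proj t else 0.
Proof.
rewrite /type_proj mulmxA -(mulmxA (half_proj true t.1)) -half_proj_swap mulmxA half_projM.
rewrite -mulmxA half_projM; case: t t' => [u v] [u' v'] /=.
by rewrite xpair_eqE; case: eqP => _ /=; rewrite ?mul0mx //; case: eqP; rewrite ?mulmx0.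
Qed.

Lemma type_projS t : (type_proj t) ^t* = type_proj t.
Proof. by rewrite mx_starM !half_projS -half_proj_swap. Qed.

Lemma type_proj_comm t (a : 'X_n) : type_proj t *m f a = f a *m type_proj t.
Proof. by rewrite -mulmxA half_proj_comm mulmxA half_proj_comm mulmxA. Qed.

Lemma type_proj_sum : \sum_t type_proj t = f 1%:M.
Proof.
rewrite sum_types /type_proj /= -addrA -!mulmxDr !(addrC (half_proj false false)).
by rewrite half_proj_sum !half_proj1 addrC half_proj_sum.
Qed.

Lemma type_projX b t : X b *m type_proj t = (-1) ^+ flip_on b t *: type_proj t.
Proof.
case: b; first by rewrite mulmxA half_projX -scalemxAl.
by rewrite /type_proj half_proj_swap mulmxA half_projX -scalemxAl.
Qed.

Definition type_rank p t := \rank (type_proj t *m f (delta_mx p p)).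

Lemma type_proj_projection p t : is_projection (type_proj t *m f (delta_mx p p)).
Proof.
have [idem self] := hom_projection f (is_projection_delta C p).
split; last by rewrite mx_starM self type_projS type_proj_comm.
by rewrite mulmxA -(mulmxA (type_proj t)) -type_proj_comm mulmxA type_projM eqxx -mulmxA idem.
Qed.

(** Commuting signs have joint spectral projections, which commute with the range of [f]. Their
    ranks over one minimal projection are natural numbers that serve as type counts. *)
Lemma type_rank_inv p : inv f (Kmx (type_rank p)) (Hn (type_rank p)).
Proof.
have e t : \tr (type_proj t *m f (delta_mx p p)) = (type_rank p t)%:R.
  by apply: mxtrace_idem; have [] := type_proj_projection p t.
have d (Z : 'X_n') : Z *m f 1%:M = Z ->
    Z *m f (delta_mx p p) = \sum_t (Z *m type_proj t) *m f (delta_mx p p).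
  by move=> Z1; rewrite -mulmx_suml -mulmx_sumr type_proj_sum Z1.
apply: (pretyped_counts (p := p) fX).
- rewrite -[f (delta_mx p p)]hom1l (d (f 1%:M)) ?hom1r // raddf_sum.
  apply: eq_bigr => t _; rewrite -e /= -type_proj_comm.
  by rewrite /type_proj -mulmxA half_proj1.
- move=> b; rewrite d ?(pt_unit fX) // raddf_sum; apply: eq_bigr => t _.
  by rewrite /= type_projX -scalemxAl mxtraceZ e mulrC.
rewrite d -?mulmxA ?(pt_unit fX) // raddf_sum; apply: eq_bigr => t _.
rewrite /= -(mulmxA (X true)) type_projX -scalemxAr type_projX scalerA -scalemxAl mxtraceZ e.
by rewrite mulrC /= addbC -signr_addb.
Qed.

End TypeProjections.

(** View [N] as a 2 x 2 table. K_0 gives its row and column sums, H_1 the diagonal minus the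
    antidiagonal, and these determine the table. *)
Lemma Kmx_Hn_inj N N' : Kmx N = Kmx N' -> Hn N = Hn N' -> N =1 N'.
Proof.
move=> eK; rewrite /Hn !sum_types /= => eH.
have K i j := congr1 (fun M : 'M_4 => M i j) eK.
have v (i : nat) (hi : (i < 4)%N) : (inord i : 'I_4) = i :> nat by rewrite inordK.
have := K (inord 0) (inord 0); have := K (inord 0) (inord 1).
have := K (inord 2) (inord 2); have := K (inord 2) (inord 3).
move: eH; rewrite !mxE !sum_types -!val_eqE /= !theta_val /top !v //= ?subnn.
rewrite ?expr1 ?expr0 ?mulr0 ?mulr1 ?mulrN1.
by move=> h1 h2 h3 h4 h5 [[] []]; lia.
Qed.

(** Within each fibre, the k-th element of [A] is sent to the k-th element of [B]. *)
Lemma fiber_injection (A B : finType) (L : eqType) (la : A -> L) (lb : B -> L) :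
  (forall j, (#|[pred a | la a == j]| <= #|[pred b | lb b == j]|)%N) ->
  exists2 g : A -> B, injective g & forall a, lb (g a) = la a.
Proof.
move=> le.
(* If [A] is empty, [B] may be empty too and offers no default value for [nth]. *)
have [a0|A0] := pickP (@predT A); last first.
  have A0' : A -> False by move=> a; have := A0 a.
  by exists (fun a => False_rect _ (A0' a)) => a; case: (A0' a).
move=> _; pose fa a := enum [pred x | la x == la a].
pose fb a := enum [pred x | lb x == la a].
have ha a : (index a (fa a) < size (fb a))%N.
  apply: (@leq_trans (size (fa a))); last by rewrite /fa /fb -!cardE; exact: le.
  by rewrite index_mem mem_enum inE.
have [b0 _] : exists b : B, true.
  by have := ha a0; case: (fb a0) => // b; exists b.
exists (fun a => nth b0 (fb a) (index a (fa a))) => [a a'|a]; last first.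
  by have := mem_nth b0 (ha a); rewrite mem_enum inE => /eqP.
move=> e.
have el : la a = la a'.
  have := mem_nth b0 (ha a); have := mem_nth b0 (ha a').
  by rewrite -e !mem_enum !inE => /eqP <- /eqP <-.
have efa : fa a = fa a' by rewrite /fa el.
have efb : fb a = fb a' by rewrite /fb el.
move: e; rewrite efb => /eqP; rewrite nth_uniq ?enum_uniq //; last by rewrite -efb.
have mem x : x \in fa x by rewrite mem_enum inE.
move=> /eqP e; rewrite -(nth_index a (mem a)) e efa.
by rewrite nth_index.
Qed.

Section IsometryHom.
Variables (n n' : block_sizes) (w : 'M[C]_(\sum_(i < 4) n i, \sum_(i < 4) n' i)).
Hypothesis ww : w *m w ^t* = 1%:M.

Definition isometry_fun (a : cycle_cstar C n) : cycle_cstar C n' := w ^t* *m a *m w.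

Fact isometry_fun_linear : linear isometry_fun.
Proof.
by move=> c a b; rewrite /isometry_fun mulmxDr mulmxDl -scalemxAr -scalemxAl.
Qed.

HB.instance Definition _ :=
  GRing.isLinear.Build C (cycle_cstar C n) (cycle_cstar C n') _ isometry_fun
    isometry_fun_linear.

Fact isometry_funM : {morph isometry_fun : a b / smul a b}.
Proof.
move=> a b; rewrite /smul /= /isometry_fun !mulmxA; congr (_ *m _ *m _).
by rewrite -(mulmxA _ w) ww mulmx1.
Qed.

Fact isometry_funS : {morph isometry_fun : a / sstar a}.
Proof.
by move=> a; rewrite /sstar /= /isometry_fun !trmx_mul !map_mxM /= trmxCK mulmxA.
Qed.

Definition isometry_hom : hom n n' :=
  @StarHom _ _ _ isometry_fun isometry_funM isometry_funS.

Lemma isometry_homE (a : 'X_n) : isometry_hom a = w ^t* *m a *m w :> 'X_n'.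
Proof. by []. Qed.

End IsometryHom.

End Realization.

(** * Rigid embeddings with prescribed type counts *)

Section RealizeCounts.
Variable C : numClosedFieldType.
Implicit Types n : block_sizes.
Implicit Types t : bool * bool.

Notation "''X_' n" := 'M[C]_(\sum_(i < 4) block_size n i)
  (at level 8, n at level 2, format "''X_' n").
Notation hom n n' := (star_hom (cycle_cstar C n) (cycle_cstar C n')).

Lemma sum_tag (A : nmodType) (I : finType) (m : I -> nat) (g : I -> A) :
  \sum_(s : {i : I & 'I_(m i)}) g (tag s) = \sum_i g i *+ m i.
Proof.
transitivity (\sum_i \sum_(k : 'I_(m i)) g i).
  by rewrite sig_big_dep.
by apply: eq_bigr => i _; rewrite sumr_const card_ord.
Qed.

Lemma sum_lab (A : nmodType) n (g : 'I_4 -> A) :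
  \sum_(x : 'I_(\sum_(i < 4) block_size n i)) g (lab x) = \sum_i g i *+ n i.
Proof.
rewrite -(sum_tag _ g) (reindex tagnat.sig) //=.
by exists tagnat.rank => x _; [exact: tagnat.sigK | exact: tagnat.rankK].
Qed.

Section Realize.
Variables (n n' : block_sizes) (N : bool * bool -> nat).
Hypothesis N_gt0 : (0 < \sum_t N t)%N.
Hypothesis fits : forall j, \sum_i (n i)%:Z * Kmx N i j <= (n' j)%:Z.

Let I : finType := {t : bool * bool & 'I_(N t)}.
Let type (s : I) := theta (tag s).

(** The sum in [fits] counts the pairs (summand, basis vector) that have to go to block [j], so the
    inequality provides room for them. *)
Lemma realize_injection : exists2 g : I * 'I_(\sum_(i < 4) n i) -> 'I_(\sum_(i < 4) n' i),
  injective g & forall sx, lab (g sx) = type sx.1 (lab sx.2).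
Proof.
apply: fiber_injection => j; rewrite -!sum1_card big_mkcond [X in (_ <= X)%N]big_mkcond /=.
rewrite -(pair_bigA _ (fun s x => if type s (lab x) == j then 1 else 0)%N) /=.
rewrite (sum_tag N (fun t => \sum_x (if theta t (lab x) == j then 1 else 0)%N)).
rewrite (sum_lab n' (fun i => if i == j then 1 else 0)%N).
under eq_bigr => t _ do rewrite (sum_lab n (fun i => if theta t i == j then 1 else 0)%N).
rewrite [X in (_ <= X)%N](bigD1 j) //= [X in (_ <= _ + X)%N]big1 => [|i /negPf->]; last exact: mul0rn.
rewrite eqxx natn addn0 -lez_nat; apply: le_trans (fits j).
under eq_bigr => t _ do rewrite -mulr_natr natn.
rewrite (big_morph Posz PoszD (erefl _)).
have <- : \sum_t \sum_i (N t)%:Z * ((n i)%:Z * (theta t i == j)%:R) =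
    \sum_i (n i)%:Z * Kmx N i j.
  rewrite exchange_big; apply: eq_bigr => i _; rewrite mxE mulr_sumr.
  by apply: eq_bigr => t _; rewrite mulrCA.
apply: ler_sum => t _; rewrite -[_ * N t]/(_ * N t)%N PoszM mulrC.
rewrite (big_morph Posz PoszD (erefl _)) mulr_sumr.
apply: ler_sum => i _; rewrite -[_ *+ n i]mulr_natr natn -[_ * n i]/(_ * n i)%N PoszM (mulrC (n i)%:Z).
by case: eqP.
Qed.

Lemma realize : exists phi : rigid_embedding C n n',
  rigid_K0mx phi = Kmx N /\ rigid_H1 phi = Hn N.
Proof.
have [g g_inj gE] := realize_injection.
(* Each summand is conjugation by a 0-1 matrix placing the basis vectors along [g]; injectivity of
   [g] makes it an isometry and the ranges orthogonal. *)
pose w (s : I) : 'M[C]_(\sum_(i < 4) n i, \sum_(i < 4) n' i) :=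
  \matrix_(x, u) (g (s, x) == u)%:R.
have ww s s' : w s *m (w s') ^t* = if s == s' then 1%:M else 0.
  apply/matrixP => x y; rewrite mxE (bigD1 (g (s, x))) //= [X in _ + X]big1 ?addr0.
    rewrite !mxE eqxx mul1r rmorph_nat (inj_eq g_inj) xpair_eqE eq_sym.
    by case: eqP => _; rewrite mxE // eq_sym.
  by move=> u /negPf ne; rewrite !mxE eq_sym ne mul0r.
have wws s : w s *m (w s) ^t* = 1%:M by rewrite ww eqxx.
have cardI : #|I| = (\sum_t N t)%N.
  by rewrite card_tagged sumnE big_map -big_enum /=; apply: eq_bigr => t _; rewrite card_ord.
pose ev (k : 'I_#|I|) : I := enum_val k.
have I_gt0 : (0 < #|I|)%N by rewrite cardI.
have wQ s i : Q n i *m w s = w s *m Q n' (type s i).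
  apply/matrixP => x u; rewrite lmx_mull lmx_mulr mxE mulrC.
  case: eqP => [<-|_]; last by rewrite !mul0r.
  by rewrite gE /= (inj_eq perm_inj).
have wsQ s i : (w s) ^t* *m Q n i = Q n' (type s i) *m (w s) ^t*.
  move: (congr1 (fun a => a ^t*) (wQ s i)).
  by rewrite !trmx_mul !map_mxM /= !QS.
(* A type permutes the blocks and preserves sides, so a forbidden position of the target comes from
   a forbidden position of the source. *)
have alg s a : cycle_alg a -> cycle_alg (isometry_hom (wws s) a).
  move=> ca i j ij; apply/block_eq0 => u v eu ev'.
  rewrite mxE big1 // => y _; rewrite mxE big_distrl big1 //= => x _.
  rewrite !mxE; case: eqP => [xu|]; last by rewrite conjC0 !mul0r.
  case: eqP => [yv|]; last by rewrite mulr0.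
  suff -> : a x y = 0 by rewrite mulr0 mul0r.
  have /block_eq0 -> // : block a (lab x) (lab y) = 0.
  apply: ca; apply: contra ij; rewrite -eu -ev' -xu -yv !gE /= (inj_eq perm_inj).
  have tt z : (type s z < 2)%N = (z < 2)%N := top_theta _ z.
  by rewrite tt !(leqNgt 2) tt.
have rigid k : rigid_of_type (type (ev k)) (isometry_hom (wws (ev k))).
  move: (ev k) => {k} s; split.
  - exact: alg.
  - move=> p pp rp; apply/eqP; rewrite -(eqr_nat C).
    have [idem _] := hom_projection (isometry_hom (wws s)) pp.
    rewrite -(mxtrace_idem idem); apply/eqP.
    transitivity (\tr p); last by rewrite (mxtrace_idem pp.1) rp.
    by rewrite isometry_homE -mulmxA mxtrace_mulC -mulmxA wws mulmx1.
  - exact: preserves_theta.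
  move=> i j a ca; exists (isometry_hom (wws s) a); first exact: alg.
  rewrite !block_proj_lmx -!/(Q _ _) !isometry_homE !mulmxA wsQ -!mulmxA wQ //.
have orth k k' : k != k' -> forall a b : 'X_n,
    isometry_hom (wws (ev k)) a *m isometry_hom (wws (ev k')) b = 0.
  move=> kk a b; rewrite !isometry_homE !mulmxA -(mulmxA _ (w _)) ww (inj_eq enum_val_inj) (negPf kk).
  by rewrite mulmx0 !mul0mx.
pose phi := RigidEmbedding I_gt0 rigid orth.
suff cphi : counts phi =1 N.
  exists phi; rewrite rigid_K0mx_counts rigid_H1_counts; split.
    by apply/matrixP => i j; rewrite !mxE; apply: eq_bigr => t _; rewrite cphi.
  by apply: eq_bigr => t _; rewrite cphi.
move=> t; rewrite /counts -sum1_card big_mkcond /=.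
under eq_bigr => k _ do rewrite inE flipsK.
rewrite -(big_enum_val (fun s : I => if tag s == t then 1 else 0)%N).
rewrite (eq_bigl xpredT) // (sum_tag N (fun u => if u == t then 1 else 0)%N).
rewrite (bigD1 t) //= big1 => [|u /negPf->]; last exact: mul0rn.
by rewrite eqxx natn addr0.
Qed.

End Realize.
End RealizeCounts.

(** * Classes of projections and existence of rigid models *)

Section Conjugacy.
Variable C : numClosedFieldType.
Implicit Types n : block_sizes.
Implicit Types t : bool * bool.

Notation "''X_' n" := 'M[C]_(\sum_(i < 4) block_size n i)
  (at level 8, n at level 2, format "''X_' n").
Notation hom n n' := (star_hom (cycle_cstar C n) (cycle_cstar C n')).

Lemma delta_corner m (a : 'M[C]_m) (p x y : 'I_m) :
  delta_mx p x *m a *m delta_mx y p = a x y *: delta_mx p p.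
Proof.
apply/matrixP => i j; rewrite mxE (bigD1 y) //= [X in _ + X]big1 => [|k /negPf ky].
  rewrite addr0 mxE (bigD1 x) //= [X in _ + X]big1 => [|k /negPf kx].
    rewrite addr0 !mxE !eqxx !andbT andTb -mulnb natrM; ring.
  by rewrite mxE kx andbF mul0r.
by rewrite [X in _ * X]mxE ky mulr0.
Qed.

(** Simplicity of the matrix algebra: multiplying by matrix units on both sides isolates any entry
    of an element of the kernel. *)
Lemma hom_inj n n' (f : hom n n') p : f (delta_mx p p) != 0 -> injective f.
Proof.
move=> fp a b e; apply/matrixP => x y; apply/eqP; rewrite -subr_eq0.
have {e}: f (a - b) = 0 by rewrite linearB e subrr.
move/(congr1 (fun u : 'X_n' => f (delta_mx p x) *m u *m f (delta_mx y p))).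
rewrite mulmx0 mul0mx -!homM delta_corner homZ !mxE => /eqP.
by rewrite scaler_eq0 (negPf fp) orbF.
Qed.

Lemma labdiagQ n (a : 'X_n) j : labdiag a -> Q n j *m a = a *m Q n j.
Proof.
move=> da; rewrite QE -scalemxAl -scalemxAr mulmxDl mulmxDr -scalemxAl -scalemxAr da.
by rewrite -GG -mulmxA da mulmxA da mulmxA.
Qed.

Lemma cls_projection n (p : 'X_n) : labdiag p -> is_projection p ->
  cls p = map_mx intr (proj_class (p : cycle_cstar C n)).
Proof.
move=> dp [pp _]; apply/rowP => j; rewrite !mxE -pmulrn mxrank_idem.
  by rewrite mxtrace_block_proj block_proj_lmx.
rewrite -[in RHS]pp mul_blockE (bigD1 j) //= [X in _ + X]big1 ?addr0 // => l lj.
have /block_eq0 -> : forall x y, lab x = j -> lab y = l -> (p : 'X_n) x y = 0.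
  by move=> x y ex ey; move/labdiagP: dp; apply; rewrite ex ey eq_sym.
by rewrite mul0mx.
Qed.

Lemma proj_class_hom n n' (f : hom n n') K h (p : 'X_n) :
  inv f K h -> is_projection p -> labdiag p -> labdiag (f p : 'X_n') ->
  proj_class (f p : cycle_cstar C n') = proj_class (p : cycle_cstar C n) *m K.
Proof.
move=> [fK _] pp dp dfp; have := fK p; rewrite !cls_projection //; last exact: hom_projection.
rewrite -map_mxM => /matrixP e; apply/matrixP => i j; have := e i j; rewrite !mxE => {}e.
by apply/eqP; rewrite -(eqr_int C); apply/eqP.
Qed.

Lemma labdiag1 n : labdiag (1%:M : 'X_n).
Proof. by move=> b; rewrite mulmx1 mul1mx. Qed.

Lemma is_projection1 m : is_projection (1%:M : 'M[C]_m).
Proof. by split; rewrite ?mulmx1 // trmx1 map_mx1. Qed.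

Lemma proj_class1 n i : proj_class (1%:M : cycle_cstar C n) 0 i = (n i)%:Z.
Proof.
rewrite mxE (_ : block _ i i = 1%:M) ?mxrank1 //; apply/matrixP => k l.
by rewrite blockE !mxE -!val_eqE /= tagnat.eq_Rank eqxx.
Qed.

Lemma proj_class_le n (p : cycle_cstar C n) i : proj_class p 0 i <= (n i)%:Z.
Proof. by rewrite mxE lez_nat rank_leq_row. Qed.

(** The class of the projection [f 1] is bounded by that of the unit; this is the room required by
    [realize]. *)
Lemma inv_fits n n' (f : hom n n') K h : inv f K h -> labdiag (f 1%:M : 'X_n') ->
  forall j, \sum_i (n i)%:Z * K i j <= (n' j)%:Z.
Proof.
move=> fK df j; apply: le_trans (proj_class_le (f 1%:M) j).
rewrite (proj_class_hom fK (is_projection1 _) (@labdiag1 n) df) mxE.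
by apply: ler_sum => i _; rewrite proj_class1.
Qed.

(** The ranks of the type projections are realized by [phi]; injectivity excludes that all of them
    vanish. *)
Lemma typed_rigid n n' (f : hom n n') : typed f -> injective f ->
  exists phi : rigid_embedding C n n', inv f (rigid_K0mx phi) (rigid_H1 phi).
Proof.
move=> [X [fX cX]] fi; pose p := base n (inord 0).
have fN := type_rank_inv fX cX p.
have [||phi [eK eH]] := @realize C n n' (type_rank f X p).
- rewrite lt0n; apply/negP => /eqP N0.
  have : f (delta_mx p p) = f 0.
    rewrite hom0 -[LHS]hom1l -(type_proj_sum fX) mulmx_suml big1 // => t _.
    apply/eqP; rewrite -mxrank_eq0 -/(type_rank f X p t).
    by move/eqP: N0; rewrite sum_nat_eq0 => /forallP/(_ t).
  by move/fi/matrixP/(_ p p); rewrite !mxE !eqxx => /eqP; rewrite oner_eq0.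
- by apply: (inv_fits fN); apply: (pt_labdiag fX); exact: labdiag1.
by exists phi; rewrite eK eH.
Qed.

Section ConjugatingHom.
Variables (n : block_sizes) (w : 'X_n).
Hypotheses (ww : w *m w ^t* = 1%:M) (dw : labdiag w).

Lemma isometry_pretyped : pretyped (isometry_hom ww) (fun=> 1%:M).
Proof.
have ww' : w ^t* *m w = 1%:M by apply: mulmx1C.
split=> [b|b|b|b a|b a].
- by rewrite trmx1 map_mx1.
- by rewrite isometry_homE !mulmx1 ww'.
- by rewrite mul1mx isometry_homE mulmx1 ww'.
- by rewrite mulmx1 mul1mx.
by rewrite mul1mx !isometry_homE !mulmxA (labdiagS dw).
Qed.

Lemma isometry_typed : typed (isometry_hom ww).
Proof. by exists (fun=> 1%:M); split; first exact: isometry_pretyped. Qed.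

Lemma isometry_inv : inv (isometry_hom ww) 1%:M 1.
Proof.
split=> [a|a b]; rewrite !isometry_homE.
  rewrite map_mx1 mulmx1; apply/rowP => j; rewrite !mxE !mulmxA mxtrace_mulC !mulmxA.
  by rewrite -(labdiagQ _ dw) -(mulmxA _ w) ww mulmx1.
rewrite mul1r !mulmxA mxtrace_mulC !mulmxA -dw -(mulmxA (G n true) w) ww mulmx1.
by rewrite -(mulmxA _ w (G n false)) -dw mulmxA -(mulmxA _ w) ww mulmx1.
Qed.

End ConjugatingHom.

End Conjugacy.

(** * Equal invariants imply conjugacy by a block diagonal unitary *)

Section SameInvariants.
Variable C : numClosedFieldType.
Implicit Types n : block_sizes.
Implicit Types t : bool * bool.

Notation "''X_' n" := 'M[C]_(\sum_(i < 4) block_size n i)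
  (at level 8, n at level 2, format "''X_' n").
Notation hom n n' := (star_hom (cycle_cstar C n) (cycle_cstar C n')).

Lemma type_proj_sum_delta n n' (f : hom n n') X p : pretyped f X ->
  \sum_t type_proj f X t *m f (delta_mx p p) = f (delta_mx p p).
Proof. by move=> fX; rewrite -mulmx_suml type_proj_sum // hom1l. Qed.

Lemma delta1 m : \sum_x delta_mx x x = 1%:M :> 'M[C]_m.
Proof.
apply/matrixP => i j; rewrite summxE (bigD1 i) //= big1 => [|k /negPf ki].
  by rewrite !mxE eqxx addr0 eq_sym.
by rewrite mxE eq_sym ki.
Qed.

Section CornerSum.
Variables (n n' : block_sizes) (f f' : hom n n').

(** Amplifies a map [u] between the multiplicity spaces, seen as corners at [p]; the result
    intertwines [f] and [f'] for every [u]. *)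
Definition corner_sum p (u : 'X_n') : 'X_n' :=
  \sum_x f' (delta_mx x p) *m u *m f (delta_mx p x).

Lemma corner_sum_comm p u (a : 'X_n) : corner_sum p u *m f a = f' a *m corner_sum p u.
Proof.
pose E x y : 'X_n := delta_mx x y.
have EE x y z l : E x y *m E z l = if y == z then E x l else 0.
  by case: eqP => [->|/eqP yz]; rewrite /E (mul_delta_mx, mul_delta_mx_0).
have Er x : E p x *m a = \sum_y a x y *: E p y.
  rewrite [in LHS](matrix_sum_delta a) mulmx_sumr (bigD1 x) //=.
  rewrite [X in _ + X]big1 ?addr0 => [|z zx]; rewrite mulmx_sumr; last first.
    by rewrite [LHS]big1 // => y _; rewrite -scalemxAr EE eq_sym (negPf zx) scaler0.
  by apply: eq_bigr => y _; rewrite -scalemxAr EE eqxx.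
have Ec x : a *m E x p = \sum_y a y x *: E y p.
  rewrite [in LHS](matrix_sum_delta a) mulmx_suml; apply: eq_bigr => y _.
  rewrite mulmx_suml (bigD1 x) //= [X in _ + X]big1 ?addr0 => [|z zx].
    by rewrite -scalemxAl EE eqxx.
  by rewrite -scalemxAl EE (negPf zx) scaler0.
transitivity (\sum_x \sum_y f' (E x p) *m u *m (a x y *: f (E p y))).
  rewrite mulmx_suml; apply: eq_bigr => x _.
  rewrite -(mulmxA (f' (E x p) *m u)) -homM Er hom_sum mulmx_sumr.
  by apply: eq_bigr => y _; rewrite homZ.
rewrite exchange_big mulmx_sumr; apply: eq_bigr => x _.
rewrite 2!(mulmxA (f' a)) -homM Ec hom_sum !mulmx_suml; apply: eq_bigr => y _.
by rewrite homZ -scalemxAr -!scalemxAl.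
Qed.

End CornerSum.

Section Intertwiner.
Variables (n n' : block_sizes) (f f' : hom n n') (X X' : bool -> 'X_n').
Variables (K : 'M[int]_4) (h : int).
Hypotheses (fX : pretyped f X) (cX : X true *m X false = X false *m X true).
Hypotheses (fX' : pretyped f' X') (cX' : X' true *m X' false = X' false *m X' true).
Hypotheses (fK : inv f K h) (fK' : inv f' K h).

(** Equal invariants give equal ranks type by type. The partial isometry matching the type
    projections intertwines the signs, since [X b] and [X' b] act on each type by the same
    scalar. *)
Lemma corner_intertwiner p : exists u : 'X_n',
  [/\ u ^t* *m u = f (delta_mx p p), u *m u ^t* = f' (delta_mx p p),
      u *m f (delta_mx p p) = u & forall b, u *m X b = X' b *m u].
Proof.
have rk : type_rank f X p =1 type_rank f' X' p.
  have [e1 e2] := inv_uniq fK (type_rank_inv fX cX p).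
  have [e3 e4] := inv_uniq fK' (type_rank_inv fX' cX' p).
  by apply: Kmx_Hn_inj; rewrite -?e1 -?e2 -?e3 -?e4.
have orth (g : hom n n') Y : pretyped g Y -> Y true *m Y false = Y false *m Y true ->
    forall t t', t != t' -> type_proj g Y t *m g (delta_mx p p) *m
      (type_proj g Y t' *m g (delta_mx p p)) = 0.
  move=> gY cY t t' /negPf tt; rewrite (type_proj_comm gY) -mulmxA.
  by rewrite (mulmxA (type_proj g Y t)) (type_projM gY cY) tt mul0mx mulmx0.
have [u [uu uu' ue ut]] := partial_isometry_sum
  (fun t => type_proj_projection fX cX p t) (fun t => type_proj_projection fX' cX' p t)
  (orth f X fX cX) (orth f' X' fX' cX') rk.
rewrite (type_proj_sum_delta p fX) in uu ue; rewrite (type_proj_sum_delta p fX') in uu'.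
exists u; split=> // b.
have u' : f' (delta_mx p p) *m u = u.
  rewrite -(type_proj_sum_delta p fX') mulmx_suml -[RHS]ue -(type_proj_sum_delta p fX).
  by rewrite mulmx_sumr; apply: eq_bigr => t _; rewrite ut.
rewrite -[in LHS]ue -mulmxA -(pt_comm fX) -[in RHS]u' -(type_proj_sum_delta p fX).
rewrite -(type_proj_sum_delta p fX') mulmx_suml !mulmx_sumr; apply: eq_bigr => t _.
rewrite (mulmxA (X b)) type_projX // -scalemxAl -scalemxAr ut.
by rewrite 2!(mulmxA (X' b)) type_projX // -!scalemxAl.
Qed.

(** The amplification of the corner intertwiner. It is block diagonal because [G] passes through [f]
    and [f'] at the price of [X] and [X'], which the corner map exchanges. *)
Lemma support_intertwiner : exists v : 'X_n',
  [/\ v ^t* *m v = f 1%:M, v *m v ^t* = f' 1%:M,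
      v *m f 1%:M = v, labdiag v & forall a : 'X_n, v *m f a = f' a *m v].
Proof.
pose p := base n (inord 0).
have [u [uu uu' ue uX]] := corner_intertwiner p.
pose E x y : 'X_n := delta_mx x y.
have EE x y z l : E x y *m E z l = if y == z then E x l else 0.
  by case: eqP => [->|/eqP yz]; rewrite /E (mul_delta_mx, mul_delta_mx_0).
have ES x y : (E x y) ^t* = E y x by rewrite trmx_delta map_delta_mx.
have E1 : \sum_x E x x = 1%:M by exact: delta1.
have u' : f' (E p p) *m u = u by rewrite -uu' -mulmxA uu ue.
have uS : f (E p p) *m u ^t* = u ^t*.
  by move: (congr1 (fun a => a ^t*) ue); rewrite mx_starM -homS ES.
have uS' : u ^t* *m f' (E p p) = u ^t*.
  by move: (congr1 (fun a => a ^t*) u'); rewrite mx_starM -homS ES.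
pose v := corner_sum f f' p u.
have vS : v ^t* = \sum_x f (E x p) *m u ^t* *m f' (E p x).
  by rewrite mx_star_sum; apply: eq_bigr => x _; rewrite !mx_starM -!homS !ES mulmxA.
have vf a : v *m f a = f' a *m v by exact: corner_sum_comm.
exists v; split=> //.
- have mid x y : f' (E p x) *m (f' (E y p) *m u *m f (E p y)) =
      if x == y then u *m f (E p x) else 0.
    rewrite !mulmxA -homM EE; case: eqP => [->|_]; last by rewrite hom0 !mul0mx.
    by rewrite u'.
  rewrite -E1 hom_sum vS mulmx_suml; apply: eq_bigr => x _.
  rewrite mulmx_sumr (bigD1 x) //= [X in _ + X]big1 ?addr0 => [|y /negPf yx].
    rewrite -(mulmxA (f (E x p) *m u ^t* )) mid eqxx.
    by rewrite -(mulmxA (f (E x p))) (mulmxA (u ^t* )) uu -!homM !(EE, eqxx).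
  by rewrite -(mulmxA (f (E x p) *m u ^t* )) mid eq_sym yx mulmx0.
- have mid x y : f (E p x) *m (f (E y p) *m u ^t* *m f' (E p y)) =
      if x == y then u ^t* *m f' (E p x) else 0.
    rewrite !mulmxA -homM EE; case: eqP => [->|_]; last by rewrite hom0 !mul0mx.
    by rewrite uS.
  rewrite -E1 hom_sum vS mulmx_suml; apply: eq_bigr => x _.
  rewrite mulmx_sumr (bigD1 x) //= [X in _ + X]big1 ?addr0 => [|y /negPf yx].
    rewrite -(mulmxA (f' (E x p) *m u)) mid eqxx.
    by rewrite -(mulmxA (f' (E x p))) (mulmxA u) uu' -!homM !(EE, eqxx).
  by rewrite -(mulmxA (f' (E x p) *m u)) mid eq_sym yx mulmx0.
- by rewrite mulmx_suml; apply: eq_bigr => x _; rewrite -!mulmxA hom1r.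
move=> b; rewrite mulmx_sumr mulmx_suml; apply: eq_bigr => x _.
rewrite -[RHS]mulmxA (pt_Gr fX) delta_lmx homZ -scalemxAl -scalemxAr.
rewrite !mulmxA (pt_G fX') lmx_delta homZ -scalemxAr -!scalemxAl; congr (_ *: _).
by rewrite (pt_comm fX') -(mulmxA _ (X' b)) -uX !mulmxA -mulmxA (pt_comm fX) mulmxA.
Qed.

End Intertwiner.

Lemma labdiag_sum_Q n (a : 'X_n) : (forall j, Q n j *m a = a *m Q n j) -> labdiag a.
Proof.
move=> Qa b; rewrite /G lmx_sumQ mulmx_suml mulmx_sumr; apply: eq_bigr => i _.
by rewrite -scalemxAl -scalemxAr Qa.
Qed.

(** Inside each block the two projections have the same rank, so they can be matched block by
    block. *)
Lemma complement_intertwiner n (p p' : 'X_n) :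
  is_projection p -> is_projection p' -> labdiag p -> labdiag p' -> cls p = cls p' ->
  exists w : 'X_n, [/\ w ^t* *m w = p, w *m w ^t* = p', w *m p = w & labdiag w].
Proof.
move=> pp pp' dp dp' epp.
have proj q j : is_projection q -> labdiag q -> is_projection (Q n j *m q : 'X_n).
  move=> [qq qs] dq; split; last by rewrite mx_starM qs QS labdiagQ.
  by rewrite mulmxA -(mulmxA _ q) -labdiagQ // !mulmxA QQ eqxx -mulmxA qq.
have orth (q : 'X_n) i j : labdiag q -> i != j -> Q n i *m q *m (Q n j *m q) = 0.
  by move=> dq /negPf ij; rewrite labdiagQ // mulmxA -(mulmxA _ _ (Q n j)) QQ ij mulmx0 mul0mx.
have sumQ (q : 'X_n) : \sum_j Q n j *m q = q by rewrite -mulmx_suml Q_sum mul1mx.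
have [|||||w [ww ww' we wQ]] := @partial_isometry_sum C _ 'I_4
  (fun j => Q n j *m p) (fun j => Q n j *m p').
- by move=> j; exact: proj.
- by move=> j; exact: proj.
- by move=> i j; exact: orth.
- by move=> i j; exact: orth.
- move=> j; apply/eqP; rewrite -(eqr_nat C).
  rewrite -!mxtrace_idem; [|exact: (proj _ _ pp' dp').1|exact: (proj _ _ pp dp).1].
  by have := congr1 (fun r : 'rV_4 => r 0 j) epp; rewrite !mxE => ->.
rewrite !sumQ in ww ww' we; exists w; split=> //.
have we' : p' *m w = w by rewrite -ww' -mulmxA ww.
apply: labdiag_sum_Q => j.
by rewrite -[in LHS]we' mulmxA -wQ -[in RHS]we -mulmxA labdiagQ.
Qed.

Lemma typed_conj n n' (f f' : hom n n') K h :
  typed f -> typed f' -> inv f K h -> inv f' K h ->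
  exists u : hom n' n', [/\ typed u, inv u 1%:M 1 & f' =1 hom_comp u f].
Proof.
move=> [X [fX cX]] [X' [fX' cX']] fK fK'.
have [v [vv vv' ve dv vf]] := support_intertwiner fX cX fX' cX' fK fK'.
have d1 : labdiag (f 1%:M : 'X_n') by apply: (pt_labdiag fX); exact: labdiag1.
have d1' : labdiag (f' 1%:M : 'X_n') by apply: (pt_labdiag fX'); exact: labdiag1.
have compl (g : hom n n') : is_projection (1%:M - g 1%:M : 'X_n').
  have [gg gs] := hom_projection g (is_projection1 C _).
  split; last by rewrite linearB map_mxB /= gs trmx1 map_mx1.
  by rewrite mulmxBl mul1mx mulmxBr mulmx1 gg subrr subr0.
have [|||w [ww ww' we dw]] := complement_intertwiner (compl f) (compl f').
- by apply: labdiagB => //; exact: labdiag1.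
- by apply: labdiagB => //; exact: labdiag1.
- apply/rowP => j; rewrite !mxE !mulmxBr !mulmx1 !raddfB /=.
  have := inv_cls fK 1%:M; rewrite -(inv_cls fK') => /rowP/(_ j).
  by rewrite !mxE => ->.
(* The support part and the complement part add up to a unitary. The adjoint is taken because
   [isometry_hom] conjugates with the adjoint on the left. *)
pose u := (v + w) ^t*.
have uE : u ^t* = v + w by exact: trmxCK.
have wf a : w *m f a = 0.
  by rewrite -we -mulmxA mulmxBl mul1mx hom1l subrr mulmx0.
have vwS : v *m w ^t* = 0.
  rewrite -ve -mulmxA; have /(congr1 (fun a : 'X_n' => a ^t*)) := wf 1%:M.
  by rewrite mx_starM -homS trmx1 map_mx1 trmx0 map_mx0 => ->; rewrite mulmx0.
have wvS : w *m v ^t* = 0.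
  have /(congr1 (fun a : 'X_n' => a ^t*)) := vwS.
  by rewrite mx_starM trmxCK trmx0 map_mx0.
have uu : u *m u ^t* = 1%:M.
  apply: mulmx1C; rewrite uE /u mx_starD mulmxDl !mulmxDr vv' ww' vwS wvS addr0 add0r.
  by rewrite addrC subrK.
have du : labdiag u by apply/labdiagS/labdiagD.
exists (isometry_hom uu); split.
- exact: isometry_typed.
- exact: isometry_inv.
move=> a; rewrite hom_compE isometry_homE uE.
rewrite mulmxDl wf addr0 vf -mulmxA.
rewrite (_ : v *m u = f' 1%:M) ?hom1r //.
by rewrite /u mx_starD mulmxDr vv' vwS addr0.
Qed.

End SameInvariants.

Section RigidInjective.
Variable C : numClosedFieldType.

Fact id_isometry m : (1%:M : 'M[C]_m) *m 1%:M ^t* = 1%:M.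
Proof. by rewrite trmx1 map_mx1 mulmx1. Qed.

Definition id_hom n : star_hom (cycle_cstar C n) (cycle_cstar C n) :=
  isometry_hom (id_isometry (\sum_i block_size n i)).

Lemma id_homE n a : id_hom n a = a.
Proof. by rewrite isometry_homE mulmx1 trmx1 map_mx1 mul1mx. Qed.

Lemma id_typed n : typed (id_hom n).
Proof. by apply: isometry_typed; exact: labdiag1. Qed.

Lemma id_inv n : inv (id_hom n) 1%:M 1.
Proof. by apply: isometry_inv; exact: labdiag1. Qed.

(** Multiplying by one summand kills all the others, and this summand has rank 1 on a minimal
    projection. *)
Lemma rigid_inj n n' (phi : rigid_embedding C n n') : injective (rigid_hom phi).
Proof.
pose p := base n (inord 0).
apply: (@hom_inj _ _ _ _ p); apply/eqP => e.
pose s : 'I_(rigid_num phi) := Ordinal (rigid_num_gt0 phi).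
have m1 := rigid_mult1 (rigid_partP s) (is_projection_delta C p) (mxrank_delta C p p).
have : rigid_part phi s (delta_mx p p) *m rigid_hom phi (delta_mx p p) = 0.
  by rewrite e mulmx0.
rewrite [rigid_hom _ _]/(rigid_fun _ _) /rigid_fun mulmx_sumr (bigD1 s) //=.
rewrite [X in _ + X]big1 ?addr0 => [|t ts]; last by rewrite rigid_orth // eq_sym.
have [-> _] := hom_projection (rigid_part phi s) (is_projection_delta C p).
by move=> e0; rewrite e0 mxrank0 in m1.
Qed.

End RigidInjective.

(** * Connecting maps and their effect in the limit *)

Section Connections.
Variables (C : numClosedFieldType) (S : generic_system C).

Notation "''X_' n" := 'M[C]_(\sum_(i < 4) block_size n i)
  (at level 8, n at level 2, format "''X_' n").
Notation hom n n' := (star_hom (cycle_cstar C n) (cycle_cstar C n')).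
Notation size k := (sys_size S k).
Notation to_lim k := (@Defs.to_lim C S k).
Notation to_K0 k := (@Defs.to_K0 C S k).
Notation to_H1 k := (@Defs.to_H1 C S k).

Lemma to_limM k (a b : 'X_(size k)) : to_lim k (a *m b) = smul (to_lim k a) (to_lim k b).
Proof. by rewrite [RHS]sdlim_mulE. Qed.

Lemma to_limS k (a : 'X_(size k)) : to_lim k (a ^t*) = sstar (to_lim k a).
Proof. by rewrite [RHS]sdlim_starE. Qed.

Lemma to_limD k (a b : 'X_(size k)) : to_lim k (a + b) = to_lim k a + to_lim k b.
Proof. by rewrite [RHS]sdlim_addE. Qed.

Lemma to_limZ k c (a : 'X_(size k)) : to_lim k (c *: a) = c *: to_lim k a.
Proof. by rewrite [RHS]sdlim_scaleE. Qed.

Lemma to_lim_step k (a : 'X_(size k)) : to_lim k.+1 (rigid_hom (sys_map S k) a) = to_lim k a.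
Proof. by rewrite /Defs.to_lim /sdlim_in -[RHS]dlim_in_step. Qed.

Lemma to_K0_step k v : to_K0 k.+1 (v *m rigid_K0mx (sys_map S k)) = to_K0 k v.
Proof. by rewrite /Defs.to_K0 -[RHS]dlim_in_step. Qed.

Lemma to_H1_step k z : to_H1 k.+1 (rigid_H1 (sys_map S k) * z) = to_H1 k z.
Proof. by rewrite /Defs.to_H1 -[RHS]dlim_in_step. Qed.

(** A connecting map is characterized by its effect in the limit, so stages are compared without
    computing with equalities of indices. *)
Record connection k l := Connection {
  conn :> hom (size k) (size l);
  conn_K : 'M[int]_4;
  conn_h : int;
  conn_typed : typed conn;
  conn_inj : injective conn;
  conn_inv : inv conn conn_K conn_h;
  conn_lim : forall a, to_lim l (conn a) = to_lim k a;
  conn_toK0 : forall v, to_K0 l (v *m conn_K) = to_K0 k v;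
  conn_toH1 : forall z, to_H1 l (conn_h * z) = to_H1 k z
}.

Definition conn_id k : connection k k.
Proof.
apply: (@Connection k k (id_hom C (size k)) 1%:M 1).
- exact: id_typed.
- by move=> a b; rewrite !id_homE.
- exact: id_inv.
- by move=> a; rewrite id_homE.
- by move=> v; rewrite mulmx1.
- by move=> z; rewrite mul1r.
Defined.

Definition conn_next k l (c : connection k l) : connection k l.+1.
Proof.
apply: (@Connection k l.+1 (hom_comp (rigid_hom (sys_map S l)) c)
  (conn_K c *m rigid_K0mx (sys_map S l)) (conn_h c * rigid_H1 (sys_map S l))).
- by apply: typed_comp; [exact: rigid_typed | exact: conn_typed].
- by move=> a b /rigid_inj/conn_inj.
- by apply: inv_comp; [exact: conn_inv | exact: rigid_inv].
- move=> a; rewrite -(conn_lim c) hom_compE; exact: to_lim_step.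
- by move=> v; rewrite -(conn_toK0 c) mulmxA; exact: to_K0_step.
- move=> z; rewrite -(conn_toH1 c) -mulrA mulrCA; exact: to_H1_step.
Defined.

Fixpoint conn_shift k m : connection k (m + k) :=
  if m is m'.+1 then conn_next (conn_shift k m') else conn_id k.

Lemma connect k l : (k <= l)%N -> connection k l.
Proof. by move=> /subnK <-; exact: conn_shift. Qed.

Lemma to_lim_inj k : injective (to_lim k).
Proof.
move=> a b /dlim_inP[m [p]]; rewrite !iter_dlim_step => e.
have mp : m = p by apply/eqP; rewrite -(eqn_add2r k); apply/eqP; exact: (congr1 tag e).
subst p; move/eqP: e; rewrite eq_Tagged /= => /eqP.
suff shiftE q c : dlim_shift (fun k => rigid_hom (sys_map S k)) q c = conn_shift k q c.
  by rewrite !shiftE => /conn_inj.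
elim: q => [|q IH] /=; last by rewrite IH.
by apply: esym; exact: id_homE.
Qed.

(** As the stages embed in the limit, a homomorphism between them is determined there, and so are
    its invariants. *)
Lemma lim_hom_uniq k l (f : hom (size k) (size l)) K h (c : connection k l) :
  (forall a, to_lim l (f a) = to_lim k a) -> inv f K h ->
  [/\ f =1 c, K = conn_K c & h = conn_h c].
Proof.
move=> fl fK; have fc : f =1 c by move=> a; apply: to_lim_inj; rewrite fl conn_lim.
by split=> //; have [] := inv_uniq (eq_inv fc fK) (conn_inv c).
Qed.

Lemma conn_comp k l m (c : connection k l) (d : connection l m) (e : connection k m) :
  [/\ hom_comp d c =1 e, conn_K c *m conn_K d = conn_K e & conn_h c * conn_h d = conn_h e].
Proof.
apply: lim_hom_uniq; first by move=> a; rewrite hom_compE !conn_lim.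
by apply: inv_comp; exact: conn_inv.
Qed.

Lemma to_K0_eq k v v' : to_K0 k v = to_K0 k v' ->
  exists l0, forall l (c : connection k l), (l0 <= l)%N -> v *m conn_K c = v' *m conn_K c.
Proof.
move=> /dlim_inP[m [p]]; rewrite !iter_dlim_step => e.
have mp : m = p by apply/eqP; rewrite -(eqn_add2r k); apply/eqP; exact: (congr1 tag e).
subst p; move/eqP: e; rewrite eq_Tagged /= => /eqP.
have shiftE q c : dlim_shift (fun k => rigid_K0 (sys_map S k)) q (k := k) c =
    c *m conn_K (conn_shift k q).
  elim: q => [|q IH]; first exact/esym/mulmx1.
  by rewrite /= mulmxA -IH.
rewrite !shiftE => e; exists (m + k)%N => l c le.
by have [_ <- _] := conn_comp (conn_shift k m) (connect le) c; rewrite !mulmxA e.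
Qed.

Lemma to_H1_eq k z z' : to_H1 k z = to_H1 k z' ->
  exists l0, forall l (c : connection k l), (l0 <= l)%N -> conn_h c * z = conn_h c * z'.
Proof.
move=> /dlim_inP[m [p]]; rewrite !iter_dlim_step => e.
have mp : m = p by apply/eqP; rewrite -(eqn_add2r k); apply/eqP; exact: (congr1 tag e).
subst p; move/eqP: e; rewrite eq_Tagged /= => /eqP.
have shiftE q c : dlim_shift (fun k => rigid_H1map (sys_map S k)) q (k := k) c =
    conn_h (conn_shift k q) * c.
  by elim: q => [|q IH]; [exact/esym/mul1r | rewrite /= mulrAC -IH mulrC].
rewrite !shiftE => e; exists (m + k)%N => l c le.
have [_ _ <-] := conn_comp (conn_shift k m) (connect le) c.
by rewrite -!mulrA !(mulrCA (conn_h (conn_shift k m))) e.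
Qed.

Definition side (b : bool) : pred 'I_4 := if b then side12 else side34.

Lemma sideE b i : side b i = (top i == b).
Proof. by rewrite /top; case: b => /=; rewrite ?eqb_id // /side34 leqNgt; case: (i < 2)%N. Qed.

Definition in_side n b (a : 'X_n) := labdiag a /\ P n b *m a = a.

Lemma diag_summandP b x :
  diag_summand S (side b) x <-> exists k (a : 'X_(size k)), in_side b a /\ x = to_lim k a.
Proof.
split=> [[k [a [ca cas az ->]]]|[k [a [[da Pa] ->]]]]; exists k, a.
  split=> //; split; first exact: cycle_alg_labdiag.
  apply/matrixP => i j; rewrite lmx_mull; have [e|ne] := eqVneq (top (lab i)) b.
    by rewrite mul1r.
  rewrite mul0r; have [e|ij] := eqVneq (lab i) (lab j).
    have /az/block_eq0 -> // : ~~ side b (lab i) by rewrite sideE.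
  by have /labdiagP/(_ i j ij) := cycle_alg_labdiag ca cas.
split=> //; [exact: labdiag_cycle_alg | exact/labdiag_cycle_alg/labdiagS |].
move=> i; rewrite sideE => ib; apply/block_eq0 => u v eu ev.
by rewrite -Pa lmx_mull eu (negPf ib) mul0r.
Qed.

(** The witness may live at another stage. Both are compared at a common later one, since connecting
    maps preserve and reflect block diagonality and sides. *)
Lemma in_sideP k b (a : 'X_(size k)) : diag_summand S (side b) (to_lim k a) <-> in_side b a.
Proof.
rewrite diag_summandP; split=> [[l [a' [[da Pa] e]]]|]; last by exists k, a.
pose c := connect (leq_maxl k l); pose d := connect (leq_maxr k l).
have {}e : c a = d a' by apply: to_lim_inj; rewrite !conn_lim.
have [X [cX _]] := conn_typed c; have [Y [dY _]] := conn_typed d.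
split.
  apply: (pt_labdiag_inj cX (@conn_inj _ _ c)); rewrite e; exact: pt_labdiag dY _ da.
by apply: (@conn_inj _ _ c); rewrite -(pt_P cX) e (pt_P dY) Pa.
Qed.

End Connections.

(** * From maps of invariants to rigid embeddings *)

Section LiftInvariants.
Variable C : numClosedFieldType.
Implicit Types S T : generic_system C.
Implicit Types N : bool * bool -> nat.

HB.instance Definition _ S k := GRing.isZmodMorphism.Build 'rV[int]_4 (sysK0 S) (to_K0 S k)
  (@raddfB _ _ (dlim_in (fun k => rigid_K0 (sys_map S k)) (k := k))).

HB.instance Definition _ S k := GRing.isZmodMorphism.Build int (sysH1 S) (to_H1 S k)
  (@raddfB _ _ (dlim_in (fun k => rigid_H1map (sys_map S k)) (k := k))).

Lemma eq_additive_int (A : zmodType) (f g : {additive int -> A}) : f 1 = g 1 -> f =1 g.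
Proof. by move=> e z; rewrite -[z]intz !raddfMz e. Qed.

Lemma eq_additive_row (A : zmodType) m (f g : {additive 'rV[int]_m -> A}) :
  (forall i, f (delta_mx 0 i) = g (delta_mx 0 i)) -> f =1 g.
Proof.
move=> e v; rewrite (row_sum_delta v) !raddf_sum; apply: eq_bigr => i _.
by rewrite -[v 0 i]intz scaler_int !raddfMz e.
Qed.

Lemma rigid_num_counts n n' (phi : rigid_embedding C n n') :
  (\sum_t counts phi t)%N = rigid_num phi.
Proof.
apply/eqP; rewrite -(eqr_nat C) natr_sum.
have := sum_counts phi (fun=> 1); rewrite sumr_const card_ord => ->.
by apply/eqP; apply: eq_bigr => t _; rewrite mulr1.
Qed.

Lemma rigid_K0E n n' (phi : rigid_embedding C n n') v : rigid_K0 phi v = v *m rigid_K0mx phi.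
Proof. by []. Qed.

Definition mask b : 'M[int]_4 := \matrix_(i, j) ((i == j) && (top i == b))%:R.

Lemma mulmx_mask m (A : 'M[int]_(m, 4)) b i j : (A *m mask b) i j = A i j *+ (top j == b).
Proof.
rewrite mxE (bigD1 j) //= big1 => [|k /negPf kj]; last by rewrite mxE kj mulr0.
by rewrite mxE eqxx addr0 mulr_natr.
Qed.

Lemma mask_comm N b : Kmx N *m mask b = mask b *m Kmx N.
Proof.
apply/matrixP => i j; rewrite mulmx_mask [RHS]mxE (bigD1 i) //= [X in _ + X]big1 => [|k /negPf ki]; last first.
  by rewrite mxE eq_sym ki mul0r.
rewrite [mask _ _ _]mxE eqxx addr0 !mxE mulr_natl -!sumrMnl; apply: eq_bigr => t _.
by case: eqP => [<-|_]; rewrite ?top_theta // mulr0 !mul0rn.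
Qed.

(* The projections of K_0 onto the summands K_0(D_1) and K_0(D_2). *)
Definition sysK0_mask S b : sysK0 S -> sysK0 S := dlim_op1 (fun k v => v *m mask b).

Lemma sysK0_maskE S b k v : sysK0_mask b (to_K0 S k v) = to_K0 S k (v *m mask b).
Proof.
apply: dlim_op1E => l w /=.
by rewrite rigid_K0mx_counts -!mulmxA mask_comm.
Qed.

Lemma to_K0_surj S x : exists k v, x = to_K0 S k v.
Proof. exact: dlim_surj. Qed.

Lemma to_K0_surj2 S x y : exists k u v, x = to_K0 S k u /\ y = to_K0 S k v.
Proof. by have [[k [u v]] /= e] := dlim_surj2 x y; exists k, u, v. Qed.

Lemma sysK0_maskD S b : {morph @sysK0_mask S b : x y / x + y}.
Proof.
move=> x y; have [k [u [v [-> ->]]]] := to_K0_surj2 x y.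
by rewrite -raddfD !sysK0_maskE -raddfD -mulmxDl.
Qed.

Lemma sysK0_mask_summand S b b' x : sysK0_summand S (side b) x ->
  sysK0_mask b' x = x *+ (b == b').
Proof.
move=> [k [v [vb ->]]]; rewrite sysK0_maskE -raddfMn; congr (to_K0 S k _).
apply/rowP => j; rewrite mulmx_mask mulmxnE; have [tj|] := eqVneq (top j) b; first by rewrite tj.
by rewrite -sideE => /vb ->; rewrite !mul0rn.
Qed.

(** A one-way notion, with inclusions only; an isomorphism provides one such map in each
    direction. *)
Record invariant_map S T (g : {additive sysK0 S -> sysK0 T})
    (h : {additive sysH1 S -> sysH1 T}) : Prop := InvariantMap {
  im_scale : forall x, sysK0_scale S x -> sysK0_scale T (g x);
  im_side : forall b x, sysK0_summand S (side b) x -> sysK0_summand T (side b) (g x);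
  im_sym : forall s x, preserves_sides s -> g (sysK0_sym S s x) = sysK0_sym T s (g x);
  im_joint : forall x, sys_joint_scale S x -> sys_joint_scale T (g x.1, h x.2)
}.

Definition lifts S T (g : sysK0 S -> sysK0 T) (h : sysH1 S -> sysH1 T) k l
    (K : 'M[int]_4) (z : int) : Prop :=
  (forall v, g (to_K0 S k v) = to_K0 T l (v *m K)) /\
  (forall c, h (to_H1 S k c) = to_H1 T l (z * c)).

Definition D4_class : 'rV[int]_4 := proj_class
  (block_unit C D4_sizes (inord 0) + block_unit C D4_sizes (inord 2)).

Lemma labdiag_delta n (x : 'I_(\sum_(i < 4) block_size n i)) :
  labdiag (delta_mx x x : 'M[C]_(\sum_(i < 4) block_size n i)).
Proof. by move=> b; rewrite lmx_delta delta_lmx. Qed.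

Lemma D4_classE : D4_class = delta_mx 0 (inord 0) + delta_mx 0 (inord 2).
Proof.
apply/rowP => j; apply/eqP; rewrite -(eqr_int C); apply/eqP.
pose x := base D4_sizes (inord 0); pose y := base D4_sizes (inord 2).
have xy : x != y.
  by apply/eqP => /(congr1 (@lab _)); rewrite !lab_base => /(congr1 val); rewrite /= !inordK.
pose p : 'M[C]_(\sum_(i < 4) D4_sizes i) := delta_mx x x + delta_mx y y.
have dp : labdiag p by apply: labdiagD; exact: labdiag_delta.
have pp : is_projection p.
  split; last by rewrite mx_starD (is_projection_delta C x).2 (is_projection_delta C y).2.
  rewrite mulmxDl !mulmxDr !mul_delta_mx !mul_delta_mx_0 ?addr0 ?add0r //.
  by rewrite eq_sym.
have := congr1 (fun r : 'rV_4 => r 0 j) (cls_projection dp pp).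
rewrite [X in _ = X -> _]mxE => <-.
have -> : cls p = cls (delta_mx x x) + cls (delta_mx y y).
  by apply/rowP => i; rewrite !mxE mulmxDr raddfD.
by rewrite !cls_delta !lab_base !mxE intrD !rmorph_nat.
Qed.

(** Realized by a single summand of identity type, which fits because every block has size at least
    1. *)
Lemma D4_joint S k : sys_joint_scale S (to_K0 S k D4_class, to_H1 S k 1).
Proof.
pose N t := (t == (false, false) : nat).
have N1 (F : bool * bool -> int) : \sum_t (N t)%:Z * F t = F (false, false).
  rewrite (bigD1 (false, false)) //= big1 ?addr0 ?mul1r // => t /negPf nt.
  by rewrite /N nt mul0r.
have K1 : Kmx N = 1%:M.
  apply/matrixP => i j; rewrite !mxE N1; congr (_ == _)%:R.
  by rewrite /theta mulg1 perm1.
have [||phi [eK eH]] := @realize C D4_sizes (sys_size S k) N.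
- by rewrite (bigD1 (false, false)).
- move=> j; rewrite K1 (bigD1 j) //= big1 => [|i /negPf ij]; last by rewrite mxE ij mulr0.
  by rewrite mxE eqxx addr0 lez_nat block_size_gt0.
exists k, phi; rewrite eH /Hn N1 expr0; congr (to_K0 S k _, _).
by rewrite rigid_K0E eK K1 mulmx1.
Qed.

Section LiftRigid.
Variables (S T : generic_system C).
Variables (g : {additive sysK0 S -> sysK0 T}) (h : {additive sysH1 S -> sysH1 T}).
Hypothesis gh : invariant_map g h.

(* The minimal embedding of A(D4) in A_k of identity type has a joint
   class whose image under g (+) h determines a rigid embedding of A(D4); the
   summands and the symmetries of K_0 then force g and h on all of stage k. *)
Lemma lift_D4 k : exists l (psi : rigid_embedding C D4_sizes (sys_size T l)),
  lifts g h k l (rigid_K0mx psi) (rigid_H1 psi).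
Proof.
have [l [psi [/= eg eh]]] := im_joint gh (D4_joint S k).
exists l, psi; split; last first.
  pose f1 : {additive int -> sysH1 T} := h \o to_H1 S k.
  pose f2 : {additive int -> sysH1 T} := to_H1 T l \o rigid_H1map psi.
  move=> c; rewrite -[LHS]/(f1 c) -[RHS]/(f2 c); apply: eq_additive_int.
  by rewrite /f1 /f2 /= mulr1.
pose f1 : {additive 'rV[int]_4 -> sysK0 T} := g \o to_K0 S k.
pose f2 : {additive 'rV[int]_4 -> sysK0 T} := to_K0 T l \o mulmxr (rigid_K0mx psi).
move=> v; rewrite -[LHS]/(f1 v) -[RHS]/(f2 v); apply: eq_additive_row => i.
have sd b j : top j = b -> sysK0_summand S (side b) (to_K0 S k (delta_mx 0 j)).
  move=> jb; exists k, (delta_mx 0 j); split=> // i'; rewrite sideE mxE -jb.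
  by case: (eqVneq i' j) => [->|_]; rewrite ?eqxx // andbF.
have top0 : top (inord 0) = true by rewrite /top inordK.
have top2 : top (inord 2) = false by rewrite /top inordK.
(* The joint scale only gives the image of the sum of the two classes. As [g] respects the summands
   of K_0, masking by side separates them. *)
have e02 (b : bool) : f1 (delta_mx 0 (inord (if b then 0 else 2))) =
    f2 (delta_mx 0 (inord (if b then 0 else 2))).
  have := congr1 (@sysK0_mask T b) eg.
  rewrite -/D4_class D4_classE !raddfD sysK0_maskD sysK0_maskE.
  rewrite (sysK0_mask_summand _ (im_side gh (sd _ _ top0))).
  rewrite (sysK0_mask_summand _ (im_side gh (sd _ _ top2))).
  rewrite rigid_K0mx_counts -mulmxA mask_comm mulmxA => e.
  have ej j : delta_mx 0 j *m mask b = delta_mx 0 j *+ (top j == b) :> 'rV_4.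
    apply/rowP => j'; rewrite mulmx_mask mulmxnE !mxE /=.
    by case: (eqVneq j' j) => [->|]; rewrite ?andbF ?mul0rn.
  move: e; rewrite mulmxDl !ej top0 top2 /f1 /f2 /= rigid_K0mx_counts.
  by case: b {ej} => /=; rewrite ?mulr1n ?mulr0n ?addr0 ?add0r.
(* The symmetries carry the equality to the other block of each side; [col_perm] moves basis vectors
   by the inverse permutation. *)
have sym i' s : preserves_sides s -> f1 (delta_mx 0 i') = f2 (delta_mx 0 i') ->
    f1 (delta_mx 0 (s i')) = f2 (delta_mx 0 (s i')).
  move=> ps e.
  have es : delta_mx 0 (s i') = col_perm s^-1 (delta_mx 0 i') :> 'rV[int]_4.
    by apply/rowP => j; rewrite !mxE /= (can2_eq (permKV s) (permK s)).
  have ps' : preserves_sides s^-1 by move=> x; rewrite -{2}[x](permKV s) ps.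
  rewrite es /f1 /f2 /= -sysK0_symE // (im_sym gh) // -[X in sysK0_sym T _ X]/(f1 _) e.
  by rewrite sysK0_symE // -!rigid_K0E rigid_K0_sym.
have p12 : preserves_sides sym12.
  by have := preserves_theta (true, false); rewrite /theta mulg1.
have p34 : preserves_sides sym34.
  by have := preserves_theta (false, true); rewrite /theta mul1g.
have := sym _ _ p12 (e02 true); have := sym _ _ p34 (e02 false).
have := e02 true; have := e02 false; rewrite !tpermL.
have ->: i = inord i by rewrite inord_val.
by case: i => [[|[|[|[|//]]]] ?].
Qed.

(** The type counts of the embedding of A(D4) are reused for A_k. They fit because [g] sends the
    class of the unit of A_k to the class of a projection. *)
Lemma lift_rigid k m : exists2 l, (m <= l)%N &
  exists phi : rigid_embedding C (sys_size S k) (sys_size T l),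
    lifts g h k l (rigid_K0mx phi) (rigid_H1 phi).
Proof.
have [l1 [psi [gK hK]]] := lift_D4 k.
have [l2 [p [cp pp ep]]] : sysK0_scale T (g (to_K0 S k (proj_class (1%:M : cycle_cstar C (sys_size S k))))).
  apply: (im_scale gh); exists k, 1%:M; split; [|exact: is_projection1|by []].
  by apply: labdiag_cycle_alg; exact: labdiag1.
have dp : labdiag p by apply: cycle_alg_labdiag => //; rewrite pp.2.
pose l3 := maxn l1 l2; pose c1 := connect T (leq_maxl l1 l2); pose c2 := connect T (leq_maxr l1 l2).
(* The two expressions for the image of the unit agree in the limit, hence from some finite stage
   on. *)
have [l4 el] : exists l0, forall l (c : connection T l3 l), (l0 <= l)%N ->
    proj_class (1%:M : cycle_cstar C (sys_size S k)) *m rigid_K0mx psi *m conn_K c1 *m conn_K c =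
    proj_class p *m conn_K c2 *m conn_K c.
  by apply: to_K0_eq; rewrite !conn_toK0 -gK.
pose l := maxn m (maxn l3 l4).
have l4l : (l4 <= l)%N by rewrite /l; lia.
have l3l : (l3 <= l)%N by rewrite /l; lia.
have c := connect T l3l; exists l; first exact: leq_maxl.
pose f := hom_comp (hom_comp c c1) (rigid_hom psi).
have fK : inv f (rigid_K0mx psi *m (conn_K c1 *m conn_K c)) (rigid_H1 psi * (conn_h c1 * conn_h c)).
  by apply: inv_comp; [exact: rigid_inv | apply: inv_comp; exact: conn_inv].
have [||psi' psiK] := @typed_rigid C _ _ f.
- by do 2?[apply: typed_comp; last by [exact: rigid_typed | exact: conn_typed]]; exact: conn_typed.
- by move=> a b /conn_inj/conn_inj/rigid_inj.
have [eK eH] := inv_uniq psiK fK.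
have [||phi [phiK phiH]] := @realize C (sys_size S k) (sys_size T l) (counts psi').
- by rewrite rigid_num_counts rigid_num_gt0.
- move=> j; rewrite -rigid_K0mx_counts eK.
  pose d := hom_comp c c2.
  have dK : inv d (conn_K c2 *m conn_K c) (conn_h c2 * conn_h c) by apply: inv_comp; exact: conn_inv.
  have [X [dX _]] : typed d by apply: typed_comp; exact: conn_typed.
  apply: le_trans (proj_class_le (d p) j).
  rewrite (proj_class_hom dK pp dp (pt_labdiag dX dp)) (mulmxA (proj_class p)) -el // -!mulmxA mxE.
  by apply: ler_sum => i _; rewrite proj_class1.
exists phi; rewrite phiK phiH -rigid_K0mx_counts -rigid_H1_counts eK eH; split.
  by move=> v; rewrite gK !mulmxA !conn_toK0.
by move=> z; rewrite hK -(conn_toH1 c1) -(conn_toH1 c); congr (to_H1 T l _); ring.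
Qed.

End LiftRigid.
End LiftInvariants.

(** * The intertwining argument *)

Section Intertwining.
Variable C : numClosedFieldType.
Implicit Types S T : generic_system C.

Notation "''X_' n" := 'M[C]_(\sum_(i < 4) block_size n i)
  (at level 8, n at level 2, format "''X_' n").
Notation hom n n' := (star_hom (cycle_cstar C n) (cycle_cstar C n')).

Lemma inj_surj_bij (A B : Type) (f : A -> B) :
  injective f -> (forall y, exists x, f x = y) -> bijective f.
Proof.
move=> fi /choice[g gK]; exists g => // x; exact/fi/gK.
Qed.

Lemma star_hom_ex (U V : starAlgType C) (f : U -> V) : linear f ->
  {morph f : x y / smul x y} -> {morph f : x / sstar x} ->
  exists phi : star_hom U V, phi =1 f.
Proof.
move=> lf fM fS; pose L : {linear U -> V} := HB.pack f (GRing.isLinear.Build C U V _ f lf).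
by exists (@StarHom C U V L fM fS).
Qed.

Lemma to_K0_eqmx S k (A B : 'M[int]_4) :
  (forall v, to_K0 S k (v *m A) = to_K0 S k (v *m B)) ->
  exists l0, forall l (c : connection S k l), (l0 <= l)%N ->
    A *m conn_K c = B *m conn_K c.
Proof.
move=> e; have /choice[l0 l0P] : forall i : 'I_4, exists l0, forall l (c : connection S k l),
    (l0 <= l)%N -> delta_mx 0 i *m A *m conn_K c = (delta_mx 0 i : 'rV_4) *m B *m conn_K c.
  by move=> i; exact/to_K0_eq/e.
exists (\max_i l0 i)%N => l c le; apply/row_matrixP => i; rewrite !rowE !mulmxA l0P //.
by apply: leq_trans le; exact: leq_bigmax.
Qed.

Record lifting S T (g : sysK0 S -> sysK0 T) (h : sysH1 S -> sysH1 T) k l := Lifting {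
  lift_hom :> hom (sys_size S k) (sys_size T l);
  lift_K : 'M[int]_4;
  lift_h : int;
  lift_typed : typed lift_hom;
  lift_inj : injective lift_hom;
  lift_inv : inv lift_hom lift_K lift_h;
  liftP : lifts g h k l lift_K lift_h
}.

Lemma lifting_ex S T (g : {additive sysK0 S -> sysK0 T}) (h : {additive sysH1 S -> sysH1 T})
    k m : invariant_map g h -> exists2 l, (m <= l)%N & inhabited (lifting g h k l).
Proof.
move=> gh; have [l ml [phi phiP]] := lift_rigid gh k m; exists l => //; split.
exact: (Lifting (@rigid_typed _ _ _ phi) (@rigid_inj _ _ _ phi) (rigid_inv phi) phiP).
Qed.

(* The discrepancy between the lift of the inverse and the connecting map is
   inner, and it is absorbed in the lift. *)
Lemma lifting_half_step S T (g : {additive sysK0 S -> sysK0 T}) (h : {additive sysH1 S -> sysH1 T})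
    (g' : {additive sysK0 T -> sysK0 S}) (h' : {additive sysH1 T -> sysH1 S}) k l m
    (F : lifting g h k l) :
  invariant_map g' h' -> cancel g g' -> cancel h h' ->
  exists k', (m <= k')%N /\ exists F' : lifting g' h' l k',
    forall a, to_lim (S := S) (F' (F a)) = to_lim (S := S) a.
Proof.
move=> gh' gK hK; have [k1 kk1 [F1]] := lifting_ex l k gh'.
pose c1 := connect S kk1.
(* Going to [T] and back induces the identity on the limit invariants, so at a finite stage it has
   the invariants of a connecting map; then [typed_conj] applies. *)
have [|l1 l1P] := @to_K0_eqmx S k1 (lift_K F *m lift_K F1) (conn_K c1).
  by move=> v; rewrite conn_toK0 -[RHS]gK (liftP F).1 (liftP F1).1 mulmxA.
have [|l2 l2P] := @to_H1_eq C S k1 (lift_h F1 * lift_h F) (conn_h c1).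
  by rewrite -[X in _ = to_H1 S k1 X]mulr1 conn_toH1 -[RHS]hK (liftP F).2 (liftP F1).2 mulr1.
pose k' := maxn m (maxn k1 (maxn l1 l2)).
have k1k' : (k1 <= k')%N by rewrite /k'; lia.
have c := connect S k1k'; exists k'; split; first by rewrite /k'; lia.
have [cE cK ch] := conn_comp c1 c (connect S (leq_trans kk1 k1k')).
set d := connect S _ in cE cK ch.
pose f := hom_comp (hom_comp c F1) F.
have fK : inv f (conn_K d) (conn_h d).
  rewrite -cK -ch -l1P; last by rewrite /k'; lia.
  rewrite mulrC -l2P; last by rewrite /k'; lia.
  rewrite -mulmxA (mulrC (conn_h c)) (mulrC (lift_h F1)) -mulrA.
  by apply: inv_comp; [|apply: inv_comp]; [exact: lift_inv|exact: lift_inv|exact: conn_inv].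
have [|u [tu iu ue]] := typed_conj _ (conn_typed d) fK (conn_inv d).
  apply: typed_comp (lift_typed F); apply: typed_comp (lift_typed F1); exact: conn_typed.
have ui : injective u.
  pose p := base (sys_size S k') (inord 0); apply: (@hom_inj _ _ _ _ p); apply/eqP => e.
  have := inv_cls iu (delta_mx p p); rewrite e map_mx1 mulmx1 cls_delta => /rowP/(_ (lab p)).
  by rewrite !mxE mulmx0 mxtrace0 !eqxx => /eqP; rewrite eq_sym oner_eq0.
have tF' : typed (hom_comp u (hom_comp c F1)).
  apply: typed_comp => //; apply: typed_comp (lift_typed F1); exact: conn_typed.
have iF' : injective (hom_comp u (hom_comp c F1)) by move=> a b /ui/conn_inj/lift_inj.
have vF' := inv_comp (inv_comp (lift_inv F1) (conn_inv c)) iu.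
rewrite mulmx1 mulr1 in vF'.
have [F' F'E] : exists F' : lifting g' h' l k', lift_hom F' = hom_comp u (hom_comp c F1).
  unshelve eexists (Lifting tF' iF' vF' _); last by [].
  split=> [v|z]; first by rewrite (liftP F1).1 mulmxA conn_toK0.
  by rewrite (liftP F1).2 -(conn_toH1 c) mulrCA mulrA.
by exists F' => a; rewrite F'E -(conn_lim d) ue.
Qed.

Section Limit.
Variables (S T : generic_system C).
Variables (g : {additive sysK0 S -> sysK0 T}) (h : {additive sysH1 S -> sysH1 T}).
Variables (g' : {additive sysK0 T -> sysK0 S}) (h' : {additive sysH1 T -> sysH1 S}).
Hypotheses (gh : invariant_map g h) (gh' : invariant_map g' h').
Hypotheses (gK : cancel g g') (gK' : cancel g' g) (hK : cancel h h') (hK' : cancel h' h).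

Record stage := Stage { source : nat; target : nat; stage_lift :> lifting g h source target }.

(** The part of the graph of the limit map that is known at stage [s]. *)
Definition stage_rel (s : stage) (x : cstar_lim S) (y : cstar_lim T) :=
  exists a, x = to_lim (S := S) (k := source s) a /\ y = to_lim (S := T) (s a).

(** Two half steps: the first returns to [S], the second goes to [T] again. The new lift extends the
    old graph, and the whole old target stage lies in its range, which gives surjectivity in the
    limit. *)
Lemma stage_next (s : stage) : exists s' : stage,
  [/\ (source s < source s')%N, (target s < target s')%N,
      forall x y, stage_rel s x y -> stage_rel s' x y
    & forall b, exists x, stage_rel s' x (to_lim (S := T) (k := target s) b)].
Proof.
have [k' [kk' [F' F'E]]] := lifting_half_step (source s).+1 s gh' gK hK.
have [l' [ll' [F E]]] := lifting_half_step (target s).+1 F' gh gK' hK'.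
exists (Stage F); split=> // [x y [a [-> ->]]|b].
  by exists (F' (s a)); rewrite F'E E.
by exists (to_lim (S := S) (F' b)), (F' b); rewrite E.
Qed.

Lemma intertwined_limits : exists Phi : star_hom (cstar_lim S) (cstar_lim T),
  bijective Phi /\
  forall b x, diag_summand T (side b) (Phi x) <-> diag_summand S (side b) x.
Proof.
have [l0 _ [F0]] := lifting_ex 0 0 gh.
have /choice[next nextP] := stage_next.
pose st m := iter m next (Stage F0).
have src m : (m <= source (st m))%N.
  by elim: m => // m IH; have [lt _ _ _] := nextP (st m); exact: leq_ltn_trans lt.
have tgt m : (m <= target (st m))%N.
  by elim: m => // m IH; have [_ lt _ _] := nextP (st m); exact: leq_ltn_trans lt.
have mono m p x y : (m <= p)%N -> stage_rel (st m) x y -> stage_rel (st p) x y.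
  move=> /subnK <-; elim: (p - m)%N => //= q IH /IH.
  by have [_ _ e _] := nextP (st (q + m)); exact: e.
have func m p x y y' : stage_rel (st m) x y -> stage_rel (st p) x y' -> y = y'.
  move=> /(mono _ _ _ _ (leq_maxl m p)) [a [-> ->]].
  by move=> /(mono _ _ _ _ (leq_maxr m p)) [a' [/to_lim_inj <- ->]].
have total k a : exists y, stage_rel (st k) (to_lim (S := S) (k := k) a) y.
  exists (to_lim (S := T) (st k (connect S (src k) a))), (connect S (src k) a).
  by rewrite conn_lim.
have /choice[Phi PhiP] : forall x, exists y, exists m, stage_rel (st m) x y.
  move=> x; have [k [a ->]] := sdlim_surj x.
  by have [y ay] := total k a; exists y, k.
have PhiE m x y : stage_rel (st m) x y -> Phi x = y.
  by have [p] := PhiP x; apply: func.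
have common x y : exists m a b, [/\ x = to_lim (S := S) (k := source (st m)) a,
    y = to_lim (S := S) (k := source (st m)) b,
    Phi x = to_lim (S := T) (st m a) & Phi y = to_lim (S := T) (st m b)].
  have [m mx] := PhiP x; have [p py] := PhiP y.
  have [a [-> ->]] := mono _ _ _ _ (leq_maxl m p) mx.
  have [b [-> ->]] := mono _ _ _ _ (leq_maxr m p) py.
  by exists (maxn m p), a, b.
have [|||f fE] := @star_hom_ex (cstar_lim S) (cstar_lim T) Phi.
- move=> c x y; have [m [a [b [-> -> -> ->]]]] := common x y.
  apply: (PhiE m); exists (c *: a + b).
  by rewrite homD homZ !to_limD !to_limZ.
- move=> x y; have [m [a [b [-> -> -> ->]]]] := common x y.
  by apply: (PhiE m); exists (a *m b); rewrite homM !to_limM.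
- move=> x; have [m [a [_ [-> _ -> _]]]] := common x x.
  by apply: (PhiE m); exists (a ^t*); rewrite homS !to_limS.
exists f; split.
  apply: inj_surj_bij => [x y|y].
    rewrite !fE; have [m [a [b [-> -> -> ->]]]] := common x y.
    by move=> /to_lim_inj/lift_inj ->.
  have [l [b ->]] := sdlim_surj y; have [_ _ _ /(_ (connect T (tgt l) b))[x]] := nextP (st l).
  by rewrite conn_lim => /(PhiE l.+1) e; exists x; rewrite fE.
move=> b x; rewrite fE; have [m [a [_ [-> _ -> _]]]] := common x x.
rewrite !in_sideP; have [X [fX _]] := lift_typed (st m); split=> -[da Pa]; split.
- exact: (pt_labdiag_inj fX (@lift_inj _ _ _ _ _ _ (st m))).
- by apply: (@lift_inj _ _ _ _ _ _ (st m)); rewrite -(pt_P fX).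
- exact: pt_labdiag fX _ da.
- by rewrite (pt_P fX) Pa.
Qed.

End Limit.
End Intertwining.

(** * Homomorphisms that respect the two diagonal summands *)

Section SidedHoms.
Variable C : numClosedFieldType.
Implicit Types n : block_sizes.

Notation "''X_' n" := 'M[C]_(\sum_(i < 4) block_size n i)
  (at level 8, n at level 2, format "''X_' n").
Notation hom n n' := (star_hom (cycle_cstar C n) (cycle_cstar C n')).

Definition sided n n' (f : hom n n') : Prop :=
  forall b (a : 'X_n), in_side b a -> in_side b (f a : 'X_n').

Section Sided.
Variables (n n' : block_sizes) (f : hom n n').
Hypothesis sf : sided f.

Lemma in_side_P m b (a : 'X_m) : labdiag a -> in_side b (P m b *m a).
Proof.
by move=> da; split; [apply: labdiagM => //; exact: labdiag_lmx | rewrite mulmxA PP].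
Qed.

Lemma split_P m b (a : 'X_m) : a = P m b *m a + P m (~~ b) *m a.
Proof. by case: b; rewrite -mulmxDl ?[_ + P _ true]addrC P_sum mul1mx. Qed.

(** [f (P s)] lies under [P s] for both sides, so the mixed terms are killed by orthogonality. *)
Lemma sided_P b (a : 'X_n) : P n' b *m f a = f (P n b *m a).
Proof.
have side s : P n' s *m f (P n s) = f (P n s).
  have [_] := sf (in_side_P s (@labdiag1 C n)).
  by rewrite mulmx1.
rewrite [in LHS](split_P b a) homD mulmxDr !homM !mulmxA side -(side (~~ b)) !mulmxA.
have -> : P n' b *m P n' (~~ b) = 0 :> 'X_n' by rewrite -{1}[b]negbK PN.
by rewrite !mul0mx addr0.
Qed.

Lemma sided_Pr b (a : 'X_n) : f a *m P n' b = f (a *m P n b) :> 'X_n'.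
Proof.
by rewrite -[a]trmxCK homS -[P n' b]PS -mx_starM sided_P -homS mx_starM PS.
Qed.

Lemma sided_labdiag (a : 'X_n) : labdiag a -> labdiag (f a : 'X_n').
Proof.
move=> da; rewrite [in X in labdiag X](split_P true a) homD.
by apply: labdiagD; [case: (sf (in_side_P true da)) | case: (sf (in_side_P false da))].
Qed.

End Sided.

Lemma mxtrace_star_eq0 m (a : 'M[C]_m) : \tr (a ^t* *m a) = 0 -> a = 0.
Proof.
move=> e; apply/matrixP => i j; apply/eqP; rewrite mxE -normr_eq0 -sqrf_eq0.
have e' : \sum_k \sum_l `|a l k| ^+ 2 = 0.
  rewrite -[RHS]e; apply: eq_bigr => k _; rewrite mxE; apply: eq_bigr => l _.
  by rewrite !mxE mulrC normCK.
have pos k l : true -> 0 <= `|a l k| ^+ 2 by rewrite exprn_ge0.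
have h : \sum_l `|a l j| ^+ 2 = 0.
  by apply: (psumr_eq0P _ e') => // k _; apply: sumr_ge0 => l _; exact: pos.
by rewrite (psumr_eq0P (pos j) h).
Qed.

Lemma comm_trace1 n n' (f : hom n n') p (a : 'X_n) :
  \tr (f a : 'X_n') = \tr a * \tr (f (delta_mx p p) : 'X_n').
Proof.
have := @comm_trace _ _ _ f 1%:M p _ a; rewrite !mul1mx; apply=> c.
by rewrite mul1mx mulmx1.
Qed.

Lemma mxtrace_hom_neq0 n n' (f : hom n n') p : injective f ->
  \tr (f (delta_mx p p) : 'X_n') != 0.
Proof.
move=> fi; have [idem _] := hom_projection f (is_projection_delta C p).
rewrite (mxtrace_idem idem) pnatr_eq0 mxrank_eq0; apply/eqP => e.
have : f (delta_mx p p) = f 0 by rewrite e hom0.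
by move=> /fi/matrixP/(_ p p); rewrite !mxE !eqxx => /eqP; rewrite oner_eq0.
Qed.

(** The matrices in the corner of side [b] that exchange its two blocks. *)
Definition offdiag n b (a : 'X_n) : Prop :=
  [/\ P n b *m a = a, a *m P n b = a & G n b *m a = - (a *m G n b)].

Lemma mxtrace_offdiag n b (d y : 'X_n) : in_side b d -> offdiag b y -> \tr (d *m y) = 0.
Proof.
move=> [dd Pd] [Py _ Gy]; have yG : y *m G n b = - (G n b *m y) by rewrite Gy opprK.
apply/eqP; rewrite -[_ == 0](mulrn_eq0 _ 2) mulr2n addr_eq0; apply/eqP.
rewrite -{1}Pd -GG -!mulmxA mxtrace_mulC mulmxA dd -!mulmxA yG.
by rewrite mulmxN mulmxA GG Py mulmxN raddfN.
Qed.

(* The diagonal part d of f a is orthogonal to f a after applying g, since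
   g d is diagonal and g (f a) is not; g scales the trace, so d = 0. *)
Lemma sided_offdiag n n' n'' (f : hom n n') (g : hom n' n'') W b (a : 'X_n) :
  sided f -> sided g -> injective g -> pretyped (hom_comp g f) W ->
  offdiag b a -> offdiag b (f a : 'X_n').
Proof.
move=> sf sg gi gfW [Pa aP Ga].
pose y : 'X_n' := f a.
have Py : P n' b *m y = y by rewrite /y (sided_P sf) Pa.
have yP : y *m P n' b = y by rewrite /y (sided_Pr sf) aP.
(* Averaging over conjugation by the symmetry: [d] is twice the block diagonal part of [y]. *)
pose d := y + G n' b *m y *m G n' b.
have Gd : G n' b *m d = G n' b *m y + y *m G n' b.
  by rewrite mulmxDr !mulmxA GG Py.
have dG : d *m G n' b = G n' b *m y + y *m G n' b.
  by rewrite mulmxDl -!mulmxA GG yP addrC.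
have GGN m s : G m (~~ s) *m G m s = 0 :> 'X_m.
  by rewrite -[G m (~~ s)]GP -mulmxA PGN mulmx0.
have GGN' m s : G m s *m G m (~~ s) = 0 :> 'X_m by rewrite -{1}[s]negbK GGN.
have GyN : G n' (~~ b) *m y = 0.
  by rewrite -Py mulmxA -[P _ b]GG mulmxA GGN !mul0mx.
have yGN : y *m G n' (~~ b) = 0.
  by rewrite -yP -mulmxA -[P _ b]GG -mulmxA GGN' !mulmx0.
have sd : in_side b d.
  split; last by rewrite mulmxDr Py !mulmxA PG.
  move=> s; have [->|sb] := eqVneq s b; first by rewrite Gd dG.
  have -> : s = ~~ b by move: sb; case: (s); case: (b).
  rewrite mulmxDr mulmxDl GyN yGN !mulmxA GGN !mul0mx -!mulmxA.
  by rewrite GGN' !mulmx0.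
have sdS : in_side b (d ^t*).
  split; first exact: labdiagS sd.1.
  have dP : d *m P n' b = d by rewrite mulmxDl yP -(mulmxA (G n' b *m y)) GP.
  by rewrite -[in RHS]dP mx_starM PS.
have og : offdiag b (g y : 'X_n'').
  have gfP := pt_P gfW b a; have gfG := pt_G gfW b a; have gfGr := pt_Gr gfW b a.
  rewrite !hom_compE in gfP gfG gfGr; split.
  - by rewrite gfP Pa.
  - by rewrite (sided_Pr sg) yP.
  by rewrite gfG gfGr Ga homN homN mulmxN (pt_comm gfW).
have t0 : \tr (d ^t* *m y) = 0.
  pose p := base n' (inord 0).
  have := mxtrace_offdiag (sg _ _ sdS) og; rewrite -homM (comm_trace1 g p).
  by move/eqP; rewrite mulf_eq0 (negPf (mxtrace_hom_neq0 p gi)) orbF => /eqP.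
have d0 : d = 0.
  (* Faithfulness of the trace. Both summands of [d] contribute the trace of [d* y], because [d*]
     commutes with [G]. *)
  apply: mxtrace_star_eq0; rewrite {2}/d mulmxDr mxtraceD t0 add0r.
  rewrite !mulmxA -(sdS.1 b) -!mulmxA mxtrace_mulC -!mulmxA GG yP.
  exact: t0.
split=> //; apply/eqP; rewrite -addr_eq0 -[X in X == 0]Gd d0.
by rewrite mulmx0.
Qed.

End SidedHoms.

(** * Construction, uniqueness and commutation of the signs *)

Section PretypedOfSided.
Variable C : numClosedFieldType.
Implicit Types n : block_sizes.

Notation "''X_' n" := 'M[C]_(\sum_(i < 4) block_size n i)
  (at level 8, n at level 2, format "''X_' n").
Notation hom n n' := (star_hom (cycle_cstar C n) (cycle_cstar C n')).

Section SelfCorner.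
Variables (n n' : block_sizes) (f : hom n n').

Lemma corner_sumS p (u : 'X_n') : (corner_sum f f p u) ^t* = corner_sum f f p (u ^t* ).
Proof.
rewrite mx_star_sum; apply: eq_bigr => x _.
by rewrite !mx_starM -!homS !trmx_delta !map_delta_mx mulmxA.
Qed.

Lemma corner_sum_delta p (u : 'X_n') x y :
  corner_sum f f p u *m f (delta_mx x y) = f (delta_mx x p) *m u *m f (delta_mx p y).
Proof.
rewrite mulmx_suml (bigD1 x) //= [X in _ + X]big1 ?addr0 => [|z zx].
  by rewrite -(mulmxA (_ *m u)) -homM mul_delta_mx.
by rewrite -(mulmxA (_ *m u)) -homM mul_delta_mx_0 // hom0 mulmx0.
Qed.

Lemma corner_sumM p (u v : 'X_n') :
  corner_sum f f p u *m corner_sum f f p v = corner_sum f f p (u *m f (delta_mx p p) *m v).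
Proof.
rewrite [X in _ *m X]/corner_sum mulmx_sumr; apply: eq_bigr => x _.
by rewrite !mulmxA corner_sum_delta.
Qed.

Lemma corner_sum1 p : corner_sum f f p 1%:M = f 1%:M.
Proof.
rewrite -[in RHS]delta1 hom_sum; apply: eq_bigr => x _.
by rewrite mulmx1 -homM mul_delta_mx.
Qed.

Lemma corner_sum_unit p (u : 'X_n') : corner_sum f f p u *m f 1%:M = corner_sum f f p u.
Proof. by rewrite mulmx_suml; apply: eq_bigr => x _; rewrite -(mulmxA (_ *m u)) hom1r. Qed.

End SelfCorner.

(** An index in block 0 or 2, where [sgn] is 1, so that the corner of [f] at this index sees [G]
    without a correction. *)
Definition side_base n b := base n (inord (if b then 0 else 2)).

Lemma top_side_base n b : top (lab (side_base n b)) = b.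
Proof. by rewrite lab_base /top; case: b; rewrite inordK. Qed.

Lemma sgn_side_base n b : sgn (lab (side_base n b)) = 1 :> C.
Proof. by rewrite lab_base /sgn; case: b; rewrite inordK. Qed.

Section Construct.
Variables (n n' : block_sizes) (f : hom n n').
Hypothesis sf : sided f.
Hypothesis of_off : forall b (a : 'X_n), offdiag b a -> offdiag b (f a : 'X_n').

(** Matrix units within a block stay block diagonal and commute with [G]; those between the two
    blocks of a side stay off-diagonal and anticommute. *)
Lemma sided_G_delta b x y : top (lab x) = b -> top (lab y) = b ->
  G n' b *m f (delta_mx x y) =
    (sgn (lab x) * sgn (lab y)) *: (f (delta_mx x y) *m G n' b) :> 'X_n'.
Proof.
move=> tx ty; have [exy|nxy] := eqVneq (lab x) (lab y).
  rewrite exy sgn_sq scale1r; apply: sided_labdiag => // s.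
  by rewrite lmx_delta delta_lmx exy.
have sxy : sgn (lab x) * sgn (lab y) = -1 :> C.
  have := eq_sgn C (lab x) (lab y); rewrite (negPf nxy) tx ty eqxx => /esym/eqP.
  by rewrite mulf_eq0 invr_eq0 pnatr_eq0 /= addrC addr_eq0 => /eqP.
have [_ _ ->] : offdiag b (f (delta_mx x y) : 'X_n').
  apply: of_off; split; rewrite ?lmx_delta ?delta_lmx ?tx ?ty ?eqxx ?scale1r //.
  rewrite -scaleNr; congr (_ *: _).
  by rewrite -[LHS]mulr1 -(sgn_sq C (lab y)) mulrA sxy mulN1r.
by rewrite sxy scaleN1r.
Qed.

(** The sign is [G] restricted to the corner at a positive index and amplified; [sided_G_delta] says
    how this relates to [G] on the remaining corners. *)
Lemma pretyped_of_sided :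
  pretyped f (fun b => corner_sum f f (side_base n b) (G n' b)).
Proof.
have GfE b : G n' b *m f (delta_mx (side_base n b) (side_base n b)) =
    f (delta_mx (side_base n b) (side_base n b)) *m G n' b :> 'X_n'.
  by rewrite sided_G_delta ?top_side_base // sgn_side_base mulr1 scale1r.
split=> [b|b|b|b a|b a].
- by rewrite corner_sumS GS.
- rewrite corner_sumM GfE -mulmxA GG -[in RHS](corner_sum1 f (side_base n b)).
  apply: eq_bigr => x _; rewrite mulmx1 -!mulmxA (sided_P sf) lmx_delta top_side_base eqxx scale1r.
  by rewrite -!homM !mul_delta_mx.
- exact: corner_sum_unit.
- exact: corner_sum_comm.
suff e : G n' b *m f 1%:M = corner_sum f f (side_base n b) (G n' b) *m f (G n b) :> 'X_n'.
  by rewrite homM mulmxA -e -mulmxA hom1l.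
have -> : G n b = \sum_x G n b *m delta_mx x x :> 'X_n by rewrite -[LHS]mulmx1 -delta1 mulmx_sumr.
rewrite -[in LHS]delta1 !hom_sum !mulmx_sumr; apply: eq_bigr => x _.
rewrite lmx_delta homZ -scalemxAr corner_sum_delta; case: eqP => [tx|/eqP tx].
  rewrite -mulmxA [in RHS]sided_G_delta ?top_side_base // sgn_side_base mul1r -scalemxAr scalerA sgn_sq scale1r.
  by rewrite mulmxA -homM mul_delta_mx sided_G_delta // sgn_sq scale1r.
rewrite scale0r -GP -mulmxA (sided_P sf) lmx_delta (negPf tx) scale0r hom0.
exact: mulmx0.
Qed.

End Construct.

(** On matrix units starting in a positive block [pt_G] reads [G f = X f], and amplification
    recovers [X] from this corner. *)
Lemma pretyped_uniq n n' (f : hom n n') X Y b : pretyped f X -> pretyped f Y -> X b = Y b.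
Proof.
suff key Z : pretyped f Z -> Z b = corner_sum f f (side_base n b) (G n' b) *m f 1%:M.
  by move=> fX fY; rewrite (key X) // (key Y).
move=> fZ; rewrite corner_sum_unit -(pt_unit fZ) -(corner_sum1 f (side_base n b)) mulmx_sumr.
apply: eq_bigr => x _; rewrite mulmx1 mulmxA (pt_comm fZ).
set p := side_base n b.
have e : G n' b *m f (delta_mx p x) = Z b *m f (delta_mx p x) :> 'X_n'.
  by rewrite (pt_G fZ) lmx_delta top_side_base eqxx sgn_side_base scale1r.
by rewrite -!mulmxA e.
Qed.

Section Dichotomy.
Variables (n n' n'' : block_sizes) (f : hom n n') (g : hom n' n'').
Variables (X : bool -> 'X_n') (Y : bool -> 'X_n'').
Hypotheses (fX : pretyped f X) (gY : pretyped g Y) (gi : injective g) (fi : injective f).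
Hypothesis tgf : typed (hom_comp g f).

Let w := X true *m X false.

Lemma w_unit : w *m f 1%:M = w.
Proof. by rewrite -mulmxA (pt_unit fX). Qed.

Lemma w_unitl : f 1%:M *m w = w.
Proof. by rewrite mulmxA -(pt_comm fX) (pt_unit fX). Qed.

(* Comparing the commuting signs of g o f shows that g (w w) commutes with the
   range of g; so w w is a scalar in the corner of f 1, of square 1. *)
Lemma w_central (c : 'X_n') : w *m w *m c *m f 1%:M = f 1%:M *m c *m (w *m w).
Proof.
have [W [gfW cW]] := tgf.
have WE b : W b = Y b *m g (X b).
  exact: (pretyped_uniq b gfW (pt_comp gY fX)).
(* [A] and [A'] commute with the range of [g] and are inverse to each other in the corner of [g 1];
   they carry all the noncommutation of the signs of [g]. *)
pose A := Y true *m Y false; pose A' := Y false *m Y true.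
have Ac (x : 'X_n') : A *m g x = g x *m A.
  by rewrite -mulmxA (pt_comm gY) mulmxA (pt_comm gY) mulmxA.
have A'c (x : 'X_n') : A' *m g x = g x *m A'.
  by rewrite -mulmxA (pt_comm gY) mulmxA (pt_comm gY) mulmxA.
have AA' : A' *m A = g 1%:M.
  rewrite mulmxA -(mulmxA (Y false)) (pt_sq gY) -mulmxA -(pt_comm gY) mulmxA.
  by rewrite (pt_sq gY) hom1l.
have e1 : A *m g w = A' *m g (X false *m X true).
  have := cW; rewrite !WE !mulmxA -!(mulmxA (Y _)) -!(pt_comm gY) !mulmxA.
  by rewrite -!mulmxA -!homM.
have AA1 : A *m A' = g 1%:M.
  rewrite mulmxA -(mulmxA (Y true)) (pt_sq gY) -mulmxA -(pt_comm gY) mulmxA.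
  by rewrite (pt_sq gY) hom1l.
have e2 : A *m A *m g w = g (X false *m X true).
  by rewrite -mulmxA e1 mulmxA AA1 hom1l.
have e3 : A *m A *m g (w *m w) = g (f 1%:M).
  rewrite homM mulmxA e2 -homM; congr (g _).
  rewrite mulmxA -(mulmxA (X false)) (pt_sq fX) -mulmxA -(pt_comm fX) mulmxA.
  by rewrite (pt_sq fX) hom1l.
clearbody A A'.
have s1 x : A' *m (A *m g x) = g x by rewrite mulmxA AA' hom1l.
have s2 x : A' *m (A *m (A *m g x)) = A *m g x.
  by rewrite mulmxA AA' mulmxA -Ac -mulmxA hom1l.
have e4 : g (w *m w) = A' *m A' *m g (f 1%:M).
  by move: (w *m w) e3 => z <-; rewrite -!(mulmxA A') -(mulmxA A) s2 s1.
have A2c x : A' *m A' *m g x = g x *m (A' *m A').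
  by rewrite -mulmxA A'c mulmxA A'c mulmxA.
apply: gi; transitivity (A' *m A' *m g (f 1%:M *m c *m f 1%:M)).
  by rewrite -(mulmxA (w *m w)) homM e4 -(mulmxA (A' *m A')) -homM mulmxA.
by rewrite [RHS]homM e4 mulmxA -A2c -(mulmxA (A' *m A')) -homM.
Qed.

Lemma w_scalar : exists mu : C, w *m w = mu *: f 1%:M.
Proof.
have sandwich (a b : 'X_n') i j k l : (a *m delta_mx i j *m b) k l = a k i * b j l.
  rewrite mxE (bigD1 j) //= [X in _ + X]big1 => [|y /negPf yj].
    rewrite addr0 mxE (bigD1 i) //= [X in _ + X]big1 => [|x /negPf xi].
      by rewrite addr0 mxE !eqxx mulr1.
    by rewrite mxE xi mulr0.
  rewrite mxE big1 ?mul0r // => x _.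
  by rewrite mxE yj andbF mulr0.
have ww1 : w *m w *m f 1%:M = w *m w by rewrite -mulmxA w_unit.
have [[i j] /= pij|p0] := pickP (fun ij => (f 1%:M : 'X_n') ij.1 ij.2 != 0).
  (* With [e = f 1], centrality for [delta_mx j k] reads [(w w) i j * e k l = e i j * (w w) k l], so
     a nonzero entry of [e] gives the ratio. *)
  exists ((w *m w) i j / (f 1%:M : 'X_n') i j); apply/matrixP => k l.
  have := congr1 (fun m : 'X_n' => m i l) (w_central (delta_mx j k)).
  by rewrite !sandwich => e; rewrite [RHS]mxE [RHS]mulrAC e mulrAC mulfV // mul1r.
exists 0; rewrite scale0r -ww1; suff -> : f 1%:M = 0 :> 'X_n' by rewrite mulmx0.
by apply/matrixP => i j; rewrite mxE; apply/eqP; rewrite -[_ == _]negbK (p0 (i, j)).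
Qed.

(** The reversed product [w'] is the inverse of [w] in the corner of [f 1]. Conjugation by [X true]
    turns [w w] into [w' w'], so both equal the scalar [mu]; hence [mu] has square 1 and
    [w = mu w']. *)
Lemma sign_dichotomy : w = X false *m X true \/ w = - (X false *m X true).
Proof.
have [mu e] := w_scalar; pose w' := X false *m X true.
have w'w : w' *m w = f 1%:M.
  rewrite mulmxA -(mulmxA (X false)) (pt_sq fX) -mulmxA -(pt_comm fX) mulmxA.
  by rewrite (pt_sq fX) hom1l.
have w'1 : w' *m f 1%:M = w' by rewrite -mulmxA (pt_unit fX).
have w'w' : w' *m w' = mu *: f 1%:M.
  have -> : w' *m w' = X true *m (w *m w) *m X true.
    by rewrite /w /w' !mulmxA (pt_sq fX) -!mulmxA (mulmxA (f _)) -(pt_comm fX) (pt_unit fX).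
  by rewrite e -scalemxAr -scalemxAl (pt_unit fX) (pt_sq fX).
have mu2 : mu ^+ 2 = 1.
  have : (mu ^+ 2 - 1) *: (f 1%:M : 'X_n') = 0.
    have ww1 : w' *m w' *m (w *m w) = f 1%:M.
      by rewrite -(mulmxA w' w') (mulmxA w' w) w'w w_unitl w'w.
    move: ww1; rewrite w'w' e -scalemxAl -scalemxAr scalerA hom1l -expr2 => e2.
    by rewrite scalerBl scale1r e2 subrr.
  move/eqP; rewrite scaler_eq0 subr_eq0 => /orP[/eqP //|/eqP e0].
  have : f 1%:M = f 0 by rewrite e0 hom0.
  move/fi/matrixP/(_ (base n (inord 0)) (base n (inord 0))).
  by rewrite !mxE eqxx => /eqP; rewrite oner_eq0.
have wE : w = mu *: w'.
  by rewrite -w_unitl -w'w -mulmxA e -scalemxAr w'1.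
move/eqP: mu2; rewrite sqrf_eq1 => /orP[] /eqP muE; [left|right];
  by rewrite wE muE ?scale1r ?scaleN1r.
Qed.

End Dichotomy.
End PretypedOfSided.

(** * Anticommuting signs *)

Section Anticommuting.
Variable C : numClosedFieldType.
Implicit Types n : block_sizes.

Notation "''X_' n" := 'M[C]_(\sum_(i < 4) block_size n i)
  (at level 8, n at level 2, format "''X_' n").
Notation hom n n' := (star_hom (cycle_cstar C n) (cycle_cstar C n')).

(** Only the invariants are matched: with anticommuting signs [f] is not conjugate to any [phi]. *)
Definition realizable n n' (f : hom n n') : Prop :=
  exists phi : rigid_embedding C n n', inv f (rigid_K0mx phi) (rigid_H1 phi).

Section Anti.
Variables (n n' : block_sizes) (f : hom n n') (X : bool -> 'X_n').
Hypotheses (fX : pretyped f X) (aX : X true *m X false = - (X false *m X true)).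

Lemma anti_swap b : X b *m X (~~ b) = - (X (~~ b) *m X b).
Proof. by case: b; rewrite //= aX opprK. Qed.

Lemma eq_opp0 (x : C) : x = - x -> x = 0.
Proof.
by move=> e; apply/eqP; rewrite -[_ == 0](mulrn_eq0 _ 2) mulr2n addr_eq0; apply/eqP.
Qed.

(* Conjugation by the other sign negates X b. *)
Lemma anti_trace b (a : 'X_n) : \tr (X b *m f a) = 0.
Proof.
pose Y := X (~~ b).
have e : Y *m (Y *m f a) = f a by rewrite mulmxA (pt_sq fX) hom1l.
apply: eq_opp0; rewrite -{1}e mulmxA anti_swap mulNmx raddfN /=; congr (- _).
by rewrite -mulmxA mxtrace_mulC -!mulmxA -(pt_comm fX) e.
Qed.

Lemma anti_trace2 (a : 'X_n) : \tr (X true *m X false *m f a) = 0.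
Proof.
apply: eq_opp0; rewrite [in RHS]aX mulNmx raddfN opprK /=.
by rewrite -mulmxA mxtrace_mulC -!mulmxA -(pt_comm fX).
Qed.

(** The sign has trace 0 over a minimal projection, so its two eigenspaces there have equal
    dimension. *)
Lemma anti_even p : exists r, \tr (f (delta_mx p p)) = (2 * r)%N%:R.
Proof.
pose q := half_proj f X true false *m f (delta_mx p p); exists (\rank q).
have [idem _] := hom_projection f (is_projection_delta C p).
rewrite natrM -(@mxtrace_idem C _ q).
  rewrite /q /half_proj -scalemxAl mxtraceZ mulrA mulfV ?pnatr_eq0 // mul1r mulmxDl mxtraceD hom1l.
  by rewrite -scalemxAl mxtraceZ anti_trace mulr0 addr0.
rewrite /q -mulmxA (mulmxA (f _)) -half_proj_comm // -mulmxA idem mulmxA.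
by rewrite half_projM // eqxx.
Qed.

(** All nontrivial Fourier coefficients vanish, as they do for the constant count [r], whose total
    is [4 r]. *)
Lemma anti_realizable p r : injective f ->
  \tr (f (delta_mx p p)) = (4 * r)%N%:R -> realizable f.
Proof.
move=> fi e4; pose N (_ : bool * bool) := r.
have fN : inv f (Kmx N) (Hn N).
  apply: (pretyped_counts (p := p) fX) => [|b|].
  - by rewrite e4 sum_types natrM /N; ring.
  - by rewrite anti_trace sum_types /N; case: b => /=; ring.
  by rewrite anti_trace2 sum_types /N /=; ring.
have [||phi [eK eH]] := @realize C n n' N.
- rewrite sum_types /N; have := mxtrace_hom_neq0 p fi; rewrite e4 pnatr_eq0; lia.
- by apply: (inv_fits fN); apply: (pt_labdiag fX); exact: labdiag1.
by exists phi; rewrite eK eH.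
Qed.

End Anti.
End Anticommuting.

(** * Star homomorphisms of the limits at finite stages *)

Section LiftHoms.
Variable C : numClosedFieldType.
Implicit Types S T : generic_system C.

Notation "''X_' n" := 'M[C]_(\sum_(i < 4) block_size n i)
  (at level 8, n at level 2, format "''X_' n").
Notation hom n n' := (star_hom (cycle_cstar C n) (cycle_cstar C n')).

Lemma star_homD (U V : starAlgType C) (f : star_hom U V) x y : f (x + y) = f x + f y.
Proof. exact: linearD. Qed.

Lemma star_homZ (U V : starAlgType C) (f : star_hom U V) c x : f (c *: x) = c *: f x.
Proof. exact: linearZ. Qed.

Fact to_lim_linear S k : linear (@to_lim C S k).
Proof. by move=> c a b; rewrite (to_limD (S := S)) to_limZ. Qed.

HB.instance Definition _ S k := GRing.isLinear.Build C (cycle_cstar C (sys_size S k)) (cstar_lim S) _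
  (@to_lim C S k) (@to_lim_linear S k).

Definition lifts_hom S T (Phi : star_hom (cstar_lim S) (cstar_lim T)) k l
    (f : hom (sys_size S k) (sys_size T l)) : Prop :=
  forall a, to_lim (S := T) (f a) = Phi (to_lim (S := S) a).

Definition side_preserving S T (Phi : star_hom (cstar_lim S) (cstar_lim T)) : Prop :=
  forall b x, diag_summand S (side b) x -> diag_summand T (side b) (Phi x).

(** The images of the finitely many matrix units lie in one stage. The linear extension is a star
    homomorphism because that stage embeds in the limit. *)
Lemma lifts_hom_ex S T (Phi : star_hom (cstar_lim S) (cstar_lim T)) k m :
  exists2 l, (m <= l)%N & exists f, @lifts_hom S T Phi k l f.
Proof.
have /choice[lv lvP] : forall xy, exists l, exists b,
    Phi (to_lim (S := S) (k := k) (delta_mx xy.1 xy.2)) = to_lim (S := T) (k := l) b.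
  by move=> xy; apply: sdlim_surj.
pose l := maxn m (\max_xy lv xy).
have lvl xy : (lv xy <= l)%N by apply: leq_trans (leq_bigmax xy) _; exact: leq_maxr.
have /choice[F FP] : forall xy, exists b,
    to_lim (S := T) (k := l) b = Phi (to_lim (S := S) (k := k) (delta_mx xy.1 xy.2)).
  move=> xy; have [b ->] := lvP xy.
  by exists (connect T (lvl xy) b); rewrite conn_lim.
exists l; first exact: leq_maxl.
pose f (a : cycle_cstar C (sys_size S k)) : cycle_cstar C (sys_size T l) :=
  \sum_x \sum_y (a : 'X_(sys_size S k)) x y *: F (x, y).
have fE a : to_lim (S := T) (f a) = Phi (to_lim (S := S) a).
  rewrite /f [in RHS](matrix_sum_delta a) !linear_sum; apply: eq_bigr => x _.
  rewrite !linear_sum; apply: eq_bigr => y _.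
  by rewrite !linearZ /= FP.
have [|||phi phiE] := @star_hom_ex C _ _ f.
- by move=> c a b; apply: (@to_lim_inj C T l); rewrite fE !to_limD !to_limZ !fE star_homD star_homZ.
- by move=> a b; apply: (@to_lim_inj C T l); rewrite to_limM !fE to_limM star_homM.
- by move=> a; apply: (@to_lim_inj C T l); rewrite to_limS !fE to_limS star_homS.
by exists phi => a; rewrite phiE fE.
Qed.

Lemma lifts_hom_comp S T U (Phi : star_hom (cstar_lim S) (cstar_lim T))
    (Psi : star_hom (cstar_lim T) (cstar_lim U)) k l m
    (f : hom (sys_size S k) (sys_size T l)) (g : hom (sys_size T l) (sys_size U m)) :
  lifts_hom Phi f -> lifts_hom Psi g ->
  forall a, to_lim (S := U) (hom_comp g f a) = Psi (Phi (to_lim (S := S) a)).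
Proof. by move=> fP gP a; rewrite hom_compE gP fP. Qed.

Lemma lifts_hom_inj S T (Phi : star_hom (cstar_lim S) (cstar_lim T)) k l
    (f : hom (sys_size S k) (sys_size T l)) : injective Phi -> lifts_hom Phi f -> injective f.
Proof.
move=> Pi fP a b e; apply: (@to_lim_inj C S k); apply: Pi.
by rewrite -!fP e.
Qed.

Lemma lifts_hom_sided S T (Phi : star_hom (cstar_lim S) (cstar_lim T)) k l
    (f : hom (sys_size S k) (sys_size T l)) : side_preserving Phi -> lifts_hom Phi f -> sided f.
Proof.
by move=> Ps fP b a /in_sideP sa; apply/in_sideP; rewrite fP; exact: Ps.
Qed.

End LiftHoms.

(** * Lifts with the invariants of a rigid embedding *)

Section RealizableLifts.
Variable C : numClosedFieldType.
Implicit Types S T : generic_system C.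

Notation "''X_' n" := 'M[C]_(\sum_(i < 4) block_size n i)
  (at level 8, n at level 2, format "''X_' n").
Notation hom n n' := (star_hom (cycle_cstar C n) (cycle_cstar C n')).

Record side_iso S T (Phi : star_hom (cstar_lim S) (cstar_lim T))
    (Psi : star_hom (cstar_lim T) (cstar_lim S)) : Prop := SideIso {
  si_K : cancel Phi Psi;
  si_K' : cancel Psi Phi;
  si_side : side_preserving Phi;
  si_side' : side_preserving Psi
}.

Lemma side_iso_sym S T Phi Psi : @side_iso S T Phi Psi -> side_iso Psi Phi.
Proof. by case. Qed.

Lemma lifts_roundtrip S T Phi Psi k l k' (f : hom (sys_size S k) (sys_size T l))
    (g : hom (sys_size T l) (sys_size S k')) (c : connection S k k') :
  @side_iso S T Phi Psi -> lifts_hom Phi f -> lifts_hom Psi g -> c =1 hom_comp g f.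
Proof.
move=> si fP gP a; apply: (@to_lim_inj C S k'); rewrite (lifts_hom_comp fP gP).
by rewrite (si_K si) conn_lim.
Qed.

Lemma lifts_hom_typed_comp S T Phi Psi k l k' (f : hom (sys_size S k) (sys_size T l))
    (g : hom (sys_size T l) (sys_size S k')) : (k <= k')%N ->
  @side_iso S T Phi Psi -> lifts_hom Phi f -> lifts_hom Psi g -> typed (hom_comp g f).
Proof.
move=> kk si fP gP; have c := connect S kk.
exact: eq_typed (lifts_roundtrip c si fP gP) (conn_typed c).
Qed.

Lemma lifts_hom_pretyped S T Phi Psi k l (f : hom (sys_size S k) (sys_size T l)) :
  @side_iso S T Phi Psi -> lifts_hom Phi f -> exists X, pretyped f X.
Proof.
move=> si fP; have [k' kk [g gP]] := lifts_hom_ex Psi l k.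
have [W [gfW _]] := lifts_hom_typed_comp kk si fP gP.
have sf := lifts_hom_sided (si_side si) fP; have sg := lifts_hom_sided (si_side' si) gP.
have gi := lifts_hom_inj (can_inj (si_K' si)) gP.
eexists; apply: pretyped_of_sided => // b a; exact: sided_offdiag gfW.
Qed.

Lemma lifts_hom_dichotomy S T Phi Psi k l (f : hom (sys_size S k) (sys_size T l)) :
  @side_iso S T Phi Psi -> lifts_hom Phi f ->
  exists2 X, pretyped f X & X true *m X false = X false *m X true \/
    X true *m X false = - (X false *m X true).
Proof.
move=> si fP; have [X fX] := lifts_hom_pretyped si fP; exists X => //.
have [k' kk [g gP]] := lifts_hom_ex Psi l k.
have [Y gY] := lifts_hom_pretyped (side_iso_sym si) gP.
apply: (sign_dichotomy fX gY); last exact: lifts_hom_typed_comp kk si fP gP.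
  exact: lifts_hom_inj (can_inj (si_K' si)) gP.
exact: lifts_hom_inj (can_inj (si_K si)) fP.
Qed.

(* When the signs of the lifts f and f' anticommute, each multiplicity is even,
   so that of f' o g o f is divisible by 4 and all types can be given the same
   number of summands. *)
Lemma realizable_lift S T Phi Psi k m : @side_iso S T Phi Psi ->
  exists2 l, (m <= l)%N & exists f : hom (sys_size S k) (sys_size T l),
    lifts_hom Phi f /\ realizable f.
Proof.
move=> si; have inj S' T' Phi' Psi' (si' : @side_iso S' T' Phi' Psi') := can_inj (si_K si').
have [l ml [f fP]] := lifts_hom_ex Phi k m.
have fi := lifts_hom_inj (inj _ _ _ _ si) fP.
have [X fX [cX|aX]] := lifts_hom_dichotomy si fP.
  by exists l => //; exists f; split=> //; apply: typed_rigid => //; exists X.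
have [k' kk [g gP]] := lifts_hom_ex Psi l k.
have gi := lifts_hom_inj (inj _ _ _ _ (side_iso_sym si)) gP.
have tgf := lifts_hom_typed_comp kk si fP gP.
have [l' ml' [f' fP']] := lifts_hom_ex Phi k' m.
have fi' := lifts_hom_inj (inj _ _ _ _ si) fP'.
pose f2 := hom_comp f' (hom_comp g f).
have fP2 : lifts_hom Phi f2.
  by move=> a; rewrite hom_compE fP' (lifts_hom_comp fP gP) (si_K si).
have fi2 := lifts_hom_inj (inj _ _ _ _ si) fP2.
exists l' => //; exists f2; split=> //.
(* As [g f] is a connecting map, its signs commute; those of [f2] then commute or anticommute as
   those of [f'] do. *)
have [X' fX' [cX'|aX']] := lifts_hom_dichotomy si fP'.
  by apply: typed_rigid => //; apply: typed_comp => //; exists X'.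
have [W [gfW cW]] := tgf.
pose p := base (sys_size S k) (inord 0); pose q := base (sys_size T l) (inord 0).
pose p' := base (sys_size S k') (inord 0).
have [r er] := anti_even fX aX p; have [r' er'] := anti_even fX' aX' p'.
apply: (anti_realizable (pt_comp fX' gfW) _ (p := p) (r := r * r' * \rank (g (delta_mx q q)))) => //.
  rewrite !mulmxA -(mulmxA (X' true)) -(mulmxA (X' false)) -!(pt_comm fX').
  by rewrite !mulmxA aX' -!mulmxA -!homM cW mulNmx -mulmxA.
rewrite /f2 !hom_compE (comm_trace1 f' p') (comm_trace1 g q) er er'.
have [idem _] := hom_projection g (is_projection_delta C q).
by rewrite (mxtrace_idem idem) !natrM; ring.
Qed.

End RealizableLifts.

(** * Maps induced on K_0 and H_1 *)

Section InducedMaps.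
Variable C : numClosedFieldType.
Implicit Types S T : generic_system C.

Notation hom n n' := (star_hom (cycle_cstar C n) (cycle_cstar C n')).

Lemma dlim_map_ex (U : nat -> zmodType) (F : forall k, {additive U k -> U k.+1}) (V : zmodType)
    (u : forall k, U k -> V) :
  (forall k, zmod_morphism (u k)) -> (forall k a, u k.+1 (F k a) = u k a) ->
  exists g : {additive dlim F -> V}, forall k (a : U k), g (dlim_in F a) = u k a.
Proof.
move=> uB uF.
have shiftE m k (a : U k) : u _ (dlim_shift F m a) = u k a.
  by elim: m => //= m IH; rewrite uF.
pose g (x : dlim F) := let w := cid (dlim_surj x) in u (projT1 w) (projT1 (cid (projT2 w))).
have gE k (a : U k) : g (dlim_in F a) = u k a.
  rewrite /g; case: cid => l /= e; case: cid => b /= {e}.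
  move=> /dlim_inP[m [p]]; rewrite !iter_dlim_step -(shiftE m k a) -(shiftE p l b).
  move: (dlim_shift F m a) (dlim_shift F p b) => a' b' e.
  by rewrite -[LHS]/(u (tag (Tagged U b')) (tagged (Tagged U b'))) -e.
have gB : zmod_morphism g.
  move=> x y; have [[k [a b]] /= [-> ->]] := dlim_surj2 x y.
  by rewrite -raddfB !gE uB.
pose G : {additive dlim F -> V} := HB.pack g (GRing.isZmodMorphism.Build _ _ g gB).
by exists G.
Qed.

Definition good_lift S T (Phi : star_hom (cstar_lim S) (cstar_lim T)) k l
    (f : hom (sys_size S k) (sys_size T l))
    (phi : rigid_embedding C (sys_size S k) (sys_size T l)) : Prop :=
  lifts_hom Phi f /\ inv f (rigid_K0mx phi) (rigid_H1 phi).

Lemma good_lift_ex S T Phi Psi k m : @side_iso C S T Phi Psi ->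
  exists2 l, (m <= l)%N & exists f phi, @good_lift S T Phi k l f phi.
Proof.
move=> si; have [l ml [f [fP [phi fphi]]]] := realizable_lift k m si.
by exists l => //; exists f, phi.
Qed.

(** After passing to a common target stage the two lifts coincide as homomorphisms, and a
    homomorphism determines its invariants. *)
Lemma good_lift_coherent S T Phi k l f phi k' l' f' phi' (c : connection S k k') :
  @good_lift S T Phi k l f phi -> @good_lift S T Phi k' l' f' phi' ->
  (forall v, to_K0 T l (v *m rigid_K0mx phi) = to_K0 T l' (v *m conn_K c *m rigid_K0mx phi')) /\
  (forall z, to_H1 T l (rigid_H1 phi * z) = to_H1 T l' (rigid_H1 phi' * (conn_h c * z))).
Proof.
move=> [fP fK] [fP' fK'].
pose d := connect T (leq_maxl l l'); pose d' := connect T (leq_maxr l l').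
have e : hom_comp d f =1 hom_comp d' (hom_comp f' c).
  move=> a; apply: (@to_lim_inj C T (maxn l l')).
  by rewrite !hom_compE !conn_lim fP' conn_lim fP.
have [eK eh] := inv_uniq (eq_inv e (inv_comp fK (conn_inv d)))
  (inv_comp (inv_comp (conn_inv c) fK') (conn_inv d')).
split=> [v|z]; first by rewrite -(conn_toK0 d) -(conn_toK0 d') -!mulmxA eK !mulmxA.
rewrite -(conn_toH1 d) -(conn_toH1 d'); congr (to_H1 T _ _).
by rewrite !mulrA (mulrC (conn_h d)) eh; ring.
Qed.

(** Required of every good lift, so that any convenient stage and lift may be used. *)
Definition induced S T (Phi : star_hom (cstar_lim S) (cstar_lim T))
    (g : sysK0 S -> sysK0 T) (h : sysH1 S -> sysH1 T) : Prop :=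
  forall k l f phi, @good_lift S T Phi k l f phi ->
    lifts g h k l (rigid_K0mx phi) (rigid_H1 phi).

Lemma induced_ex S T Phi Psi : @side_iso C S T Phi Psi ->
  exists (g : {additive sysK0 S -> sysK0 T}) (h : {additive sysH1 S -> sysH1 T}),
    induced Phi g h.
Proof.
move=> si; have ex k : exists l, exists f phi, @good_lift S T Phi k l f phi.
  by have [l _ e] := good_lift_ex k 0 si; exists l.
pose L k := projT1 (cid (ex k)); pose f k := projT1 (cid (projT2 (cid (ex k)))).
pose phi k := projT1 (cid (projT2 (cid (projT2 (cid (ex k)))))).
have good k : good_lift Phi (f k) (phi k) := projT2 (cid (projT2 (cid (projT2 (cid (ex k)))))).
have next k := good_lift_coherent (conn_next (conn_id S k)) (good k) (good k.+1).
have [||g gE] := @dlim_map_ex _ (fun k => rigid_K0 (sys_map S k)) (sysK0 T)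
    (fun k v => to_K0 T (L k) (v *m rigid_K0mx (phi k))).
- by move=> k v w; rewrite mulmxBl raddfB.
- by move=> k v; have [-> _] := next k; rewrite /= mul1mx.
have [||h hE] := @dlim_map_ex _ (fun k => rigid_H1map (sys_map S k)) (sysH1 T)
    (fun k z => to_H1 T (L k) (rigid_H1 (phi k) * z)).
- by move=> k v w; rewrite mulrBr raddfB.
- by move=> k z; have [_ ->] := next k; rewrite /= mul1r.
exists g, h => k l f' psi fpsi; have [eK eH] := good_lift_coherent (conn_id S k) fpsi (good k).
by split=> [v|z]; [rewrite eK mulmx1; exact: gE | rewrite eH mul1r; exact: hE].
Qed.

(** A lift followed by a lift of the inverse is a connecting map, which acts trivially in the
    limit. *)
Lemma induced_cancel S T Phi Psi g h g' h' : @side_iso C S T Phi Psi ->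
  @induced S T Phi g h -> @induced T S Psi g' h' -> cancel g g' /\ cancel h h'.
Proof.
move=> si gh gh'; have si' := side_iso_sym si.
have E k : exists k' l (c : connection S k k') (phi : rigid_embedding C (sys_size S k) (sys_size T l))
      (psi : rigid_embedding C (sys_size T l) (sys_size S k')),
    [/\ lifts g h k l (rigid_K0mx phi) (rigid_H1 phi),
        lifts g' h' l k' (rigid_K0mx psi) (rigid_H1 psi),
        rigid_K0mx phi *m rigid_K0mx psi = conn_K c & rigid_H1 phi * rigid_H1 psi = conn_h c].
  have [l _ [f [phi fphi]]] := good_lift_ex k 0 si.
  have [k' kk [f' [psi fpsi]]] := good_lift_ex l k si'.
  have c := connect S kk; exists k', l, c, phi, psi.
  have [|_ eK eH] := @lim_hom_uniq C S k k' (hom_comp f' f) (rigid_K0mx phi *m rigid_K0mx psi)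
    (rigid_H1 phi * rigid_H1 psi) c ^~ (inv_comp fphi.2 fpsi.2).
    by move=> a; rewrite (lifts_hom_comp fphi.1 fpsi.1) (si_K si).
  by split=> //; [exact: gh fphi | exact: gh' fpsi].
split=> x.
  have [k [v ->]] := to_K0_surj x; have [k' [l [c [phi [psi [[e _] [e' _] eK _]]]]]] := E k.
  by rewrite e e' -mulmxA eK conn_toK0.
have [k [z ->]] : exists k z, x = to_H1 S k z by exact: dlim_surj.
have [k' [l [c [phi [psi [[_ e] [_ e'] _ eH]]]]]] := E k.
by rewrite e e' mulrA (mulrC (rigid_H1 psi)) eH conn_toH1.
Qed.

Lemma induced_invariant S T Phi Psi (g : {additive sysK0 S -> sysK0 T})
    (h : {additive sysH1 S -> sysH1 T}) :
  @side_iso C S T Phi Psi -> induced Phi g h ->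
  invariant_map g h /\ forall x, sysK0_pos S x -> sysK0_pos T (g x).
Proof.
move=> si gh; have E k : exists l f phi, @good_lift S T Phi k l f phi.
  by have [l _ e] := good_lift_ex k 0 si; exists l.
split; last first.
  move=> x [k [v [v0 ->]]]; have [l [f [phi good]]] := E k.
  exists l, (v *m rigid_K0mx phi); rewrite (gh _ _ _ _ good).1; split=> // j.
  by rewrite mxE; apply: sumr_ge0 => i _; rewrite mulr_ge0 // rigid_K0mxE.
split.
(* The projection is moved by the lift [f] itself, which preserves block diagonality; [phi] only
   shares its action on K_0. *)
- move=> x [k [p [cp pp ->]]]; have [l [f [phi good]]] := E k.
  have dp : labdiag p by apply: cycle_alg_labdiag => //; rewrite pp.2.
  have dfp := sided_labdiag (lifts_hom_sided (si_side si) good.1) dp.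
  exists l, (f p); split; [exact: labdiag_cycle_alg | exact: hom_projection |].
  by rewrite (gh _ _ _ _ good).1 (proj_class_hom good.2).
- move=> b x [k [v [v0 ->]]]; have [l [f [phi good]]] := E k.
  exists l, (v *m rigid_K0mx phi); rewrite (gh _ _ _ _ good).1; split=> // j jb.
  rewrite mxE big1 // => i _; have [ib|/v0 ->] := boolP (side b i); last by rewrite mul0r.
  rewrite rigid_K0mx_counts mxE big1 ?mulr0 // => t _; case: eqP => [e|]; last by rewrite mulr0.
  by move: jb ib; rewrite -e !sideE top_theta => /negPf ->.
- move=> s x ps; have [k [v ->]] := to_K0_surj x; have [l [f [phi good]]] := E k.
  rewrite sysK0_symE // !(gh _ _ _ _ good).1 sysK0_symE //; congr (to_K0 T l _).
  by rewrite -!rigid_K0E rigid_K0_sym.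
(* [phi] replaces the lift here: its composition with [psi] is typed, so a rigid embedding of A(D4)
   with the same invariants exists. *)
move=> x [k [psi ->]] /=; have [l [f [phi good]]] := E k.
have [||psi' psiK] := @typed_rigid C _ _ (hom_comp (rigid_hom phi) (rigid_hom psi)).
- by apply: typed_comp; exact: rigid_typed.
- by move=> a b /rigid_inj/rigid_inj.
have [eK eH] := inv_uniq psiK (inv_comp (rigid_inv psi) (rigid_inv phi)).
exists l, psi'; rewrite !rigid_K0E eK eH (gh _ _ _ _ good).1 (gh _ _ _ _ good).2 mulmxA.
by rewrite [rigid_H1 phi * _]mulrC.
Qed.

End InducedMaps.

Local Open Scope classical_set_scope.

(** * From limit algebras back to ordered inclusions *)

Section OrderedInclusions.
Variable C : numClosedFieldType.

Lemma star_hom_inverse (U V : starAlgType C) (f : star_hom U V) : bijective f ->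
  exists g : star_hom V U, cancel f g /\ cancel g f.
Proof.
move=> [f' fK f'K]; have fi := can_inj fK.
have [|||g gE] := @star_hom_ex C V U f'.
- by move=> c x y; apply: fi; rewrite star_homD star_homZ !f'K.
- by move=> x y; apply: fi; rewrite star_homM !f'K.
- by move=> x; apply: fi; rewrite star_homS !f'K.
by exists g; split=> x; rewrite gE.
Qed.

Lemma star_hom_comp3 (U V W Z : starAlgType C) (f : star_hom U V) (g : star_hom V W)
    (h : star_hom W Z) : exists k : star_hom U Z, forall x, k x = h (g (f x)).
Proof.
have [|||k kE] := @star_hom_ex C U Z (fun x => h (g (f x))).
- by move=> c x y; rewrite !(star_homD, star_homZ).
- by move=> x y; rewrite !star_homM.
- by move=> x; rewrite !star_homS.
by exists k.
Qed.

Lemma additive_inverse (U V : zmodType) (f : {additive U -> V}) : bijective f ->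
  exists g : {additive V -> U}, cancel f g /\ cancel g f.
Proof.
move=> [f' fK f'K]; have f'B : zmod_morphism f'.
  by move=> x y; apply: (can_inj fK); rewrite raddfB !f'K.
pose g : {additive V -> U} := HB.pack f' (GRing.isZmodMorphism.Build _ _ f' f'B).
by exists g.
Qed.

Variables D1 D2 D : starAlgType C.
Implicit Type pi : generic_ordered_inclusion D1 D2 D.

Definition summand b pi : set D := if b then summand1 pi else summand2 pi.

Lemma goi_iso_inverse pi : exists (beta : star_hom D (cstar_lim (goi_system pi))) 
    (beta' : star_hom (cstar_lim (goi_system pi)) D),
  [/\ cancel beta beta', cancel beta' beta
    & forall b x, diag_summand (goi_system pi) (side b) (beta x) <-> summand b pi x].
Proof.
have [beta [bb _ b1 b2]] := goi_iso pi.
have [beta' [bK b'K]] := star_hom_inverse bb; exists beta, beta'; split=> // b x.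
have <- : beta @` summand b pi = diag_summand (goi_system pi) (side b) by case: b.
split=> [[y sy /(can_inj bK) <-] //|sx]; by exists x.
Qed.

Lemma side_iso_of_alpha pi1 pi2 :
  (exists alpha : star_hom D D,
     [/\ bijective alpha,
         alpha @` summand1 pi1 = summand1 pi2
       & alpha @` summand2 pi1 = summand2 pi2]) <->
  (exists Phi Psi, @side_iso C (goi_system pi1) (goi_system pi2) Phi Psi).
Proof.
have [b1 [b1' [b1K b1K' s1]]] := goi_iso_inverse pi1.
have [b2 [b2' [b2K b2K' s2]]] := goi_iso_inverse pi2.
split=> [[alpha [ab a1 a2]]|[Phi [Psi [PK PK' Ps Ps']]]].
  have [alpha' [aK aK']] := star_hom_inverse ab.
  have as' b : alpha @` summand b pi1 = summand b pi2 by case: b.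
  have [Phi PE] := star_hom_comp3 b1' alpha b2.
  have [Psi PE'] := star_hom_comp3 b2' alpha' b1.
  exists Phi, Psi; split=> [x|x|b x|b x].
  - by rewrite PE PE' b2K aK b1K'.
  - by rewrite PE PE' b1K aK' b2K'.
  - rewrite -{1}[x]b1K' PE => /s1 sx; apply/s2.
    by rewrite -as'; exists (b1' x).
  rewrite -{1}[x]b2K' PE' => /s2; rewrite -as' => -[y sy ey].
  by rewrite -ey aK; apply/s1.
have [alpha aE] := star_hom_comp3 b1 Phi b2'.
have [alpha' aE'] := star_hom_comp3 b2 Psi b1'.
have as' b : alpha @` summand b pi1 = summand b pi2.
  apply/seteqP; split=> [_ [x /s1/Ps sx <-]|y /s2/Ps' sy].
    by apply/s2; rewrite aE b2K'.
  by exists (alpha' y); [apply/s1; rewrite aE' b1K' | rewrite aE aE' b1K' PK' b2K].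
exists alpha; split; [|exact: (as' true)|exact: (as' false)].
by exists alpha' => x; rewrite aE aE' ?b1K' ?b2K' (PK, PK') ?b1K ?b2K.
Qed.

Lemma side_iso_of_invariants pi1 pi2 (gamma0 : {additive K0 pi1 -> K0 pi2})
    (gamma1 : {additive H1 pi1 -> H1 pi2}) :
  scaled_group_iso gamma0 -> symmetry_preserving gamma0 -> bijective gamma1 ->
  dsum_map gamma0 gamma1 @` joint_scale pi1 = joint_scale pi2 ->
  exists Phi Psi, @side_iso C (goi_system pi1) (goi_system pi2) Phi Psi.
Proof.
move=> [gb gp gs g1 g2] gsym hb joint.
have [g' [gK gK']] := additive_inverse gb; have [h' [hK hK']] := additive_inverse hb.
have gD b : gamma0 @` sysK0_summand (goi_system pi1) (side b) =
    sysK0_summand (goi_system pi2) (side b) by case: b.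
have sym s x : preserves_sides s ->
    gamma0 (sysK0_sym (goi_system pi1) s x) = sysK0_sym (goi_system pi2) s (gamma0 x).
  by move=> ps; have := gsym s ps => /(congr1 (@^~ x)).
have gh : @invariant_map C (goi_system pi1) (goi_system pi2) gamma0 gamma1.
  split=> [x sx|b x sx|s x ps|x sx].
  - by have : K0_scale pi2 (gamma0 x) by rewrite -gs; exists x.
  - by rewrite -gD; exists x.
  - exact: sym.
  - by have : joint_scale pi2 (gamma0 x.1, gamma1 x.2) by rewrite -joint; exists x.
have gh' : @invariant_map C (goi_system pi2) (goi_system pi1) g' h'.
  split=> [x|b x|s x ps|x].
  - by rewrite -[sysK0_scale _]gs => -[y sy <-]; rewrite gK.
  - by rewrite -gD => -[y sy <-]; rewrite gK.
  - by rewrite -{1}[x]gK' -sym // gK.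
  by rewrite -[sys_joint_scale _]joint => -[y sy <-] /=; rewrite gK hK -surjective_pairing.
have [Phi [Pb Ps]] := intertwined_limits gh gh' gK gK' hK hK'.
have [Psi [PK PK']] := star_hom_inverse Pb.
exists Phi, Psi; split=> // [b x|b x]; first by move/Ps.
by rewrite -{1}[x]PK' => /Ps.
Qed.

Lemma invariants_of_side_iso pi1 pi2 Phi Psi :
  @side_iso C (goi_system pi1) (goi_system pi2) Phi Psi ->
  exists (gamma0 : {additive K0 pi1 -> K0 pi2}) (gamma1 : {additive H1 pi1 -> H1 pi2}),
     [/\ scaled_group_iso gamma0,
         symmetry_preserving gamma0,
         bijective gamma1
       & dsum_map gamma0 gamma1 @` joint_scale pi1 = joint_scale pi2].
Proof.
move=> si; have [g [h gh]] := induced_ex si.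
have si' := side_iso_sym si; have [g' [h' gh']] := induced_ex si'.
have [gK hK] := induced_cancel si gh gh'; have [gK' hK'] := induced_cancel si' gh' gh.
have [[gs gD sym gj] gp] := induced_invariant si gh.
have [[gs' gD' _ gj'] gp'] := induced_invariant si' gh'.
have image (A : set (K0 pi1)) (B : set (K0 pi2)) :
    (forall x, A x -> B (g x)) -> (forall y, B y -> A (g' y)) -> g @` A = B.
  move=> AB BA; apply/seteqP; split=> [_ [x /AB Bx <-] //|y /BA Ay].
  by exists (g' y).
exists g, h; split.
- split; first by exists g'.
  + exact: image.
  + exact: image.
  + by apply: image; [exact: (gD true) | exact: (gD' true)].
  + by apply: image; [exact: (gD false) | exact: (gD' false)].
- by move=> s ps; apply/funext => x; exact: sym.
- by exists h'.
apply/seteqP; split=> [_ [x /gj jx <-] //|y /gj' jy].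
by exists (g' y.1, h' y.2) => //; rewrite /dsum_map /= gK' hK' -surjective_pairing.
Qed.

End OrderedInclusions.

Theorem theorem5p3 (R : realType) (D1 D2 D : starAlgType R[i])
    (hD1 : two_symmetric D1) (hD2 : two_symmetric D2)
    (pi1 pi2 : generic_ordered_inclusion D1 D2 D) :
  (exists alpha : star_hom D D,
     [/\ bijective alpha,
         alpha @` summand1 pi1 = summand1 pi2
       & alpha @` summand2 pi1 = summand2 pi2])
  <->
  (exists (gamma0 : {additive K0 pi1 -> K0 pi2})
          (gamma1 : {additive H1 pi1 -> H1 pi2}),
     [/\ scaled_group_iso gamma0,
         symmetry_preserving gamma0,
         bijective gamma1
       & dsum_map gamma0 gamma1 @` joint_scale pi1 = joint_scale pi2]).
Proof.
split=> [/side_iso_of_alpha[Phi [Psi /invariants_of_side_iso]] //|[gamma0 [gamma1 [g0 sg b1 j]]]].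
exact/side_iso_of_alpha/(side_iso_of_invariants g0 sg b1 j).
Qed.
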